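(* Let $\beta\in\{1,2,4\}$, let $N$ be a positive integer and let $R>0$. Define $$\widehat I_N^{(\beta)}(R)=\frac1{N!}\int_{\sigma_l>0,\ \sum_{j=1}^N\sigma_j^2\le R^2}\delta\Big(1-\prod_{l=1}^N\sigma_l\Big)\prod_{1\le j<k\le N}|\sigma_j^2-\sigma_k^2|^{\beta}\,d\sigma_1\cdots d\sigma_N .$$ Then for every $c>0$, $$\widehat I_N^{(\beta)}(R)=\frac{R^{\beta N(N-1)}}{2^N N!}\prod_{j=1}^N\frac{\Gamma(1+\beta j/2)}{\Gamma(1+\beta/2)}\;\frac1{2\pi i}\int_{c-i\infty}^{c+i\infty}\frac{\prod_{j=1}^N\Gamma\big(s/2+\beta(N-j)/2\big)}{\Gamma\big(sN/2+\beta N(N-1)/2+1\big)}\,R^{sN}\,ds .$$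
   Context: $\Gamma$ is the gamma function and $\delta$ is the Dirac delta function. The delta-function integral of a function $F$ over a region $D\subset(0,\infty)^N$ is understood by integrating out one variable: $\int_D\delta(1-\prod_{l=1}^N\sigma_l)F(\sigma_1,\dots,\sigma_N)\,d\sigma_1\cdots d\sigma_N$ means $\int F(\sigma_1,\dots,\sigma_N)\,(\sigma_1\cdots\sigma_{N-1})^{-1}\,d\sigma_1\cdots d\sigma_{N-1}$ with $\sigma_N=1/(\sigma_1\cdots\sigma_{N-1})$, over those $(\sigma_1,\dots,\sigma_{N-1})\in(0,\infty)^{N-1}$ for which $(\sigma_1,\dots,\sigma_N)\in D$.
   Formalization: The case N=1, R=1 is excluded: there the left side equals 1, while the contour integral on the right diverges (as a principal value the right side equals 1/2). *)

(* Defs.v *)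
From HB Require Import structures.
From mathcomp Require Import all_boot all_order all_algebra.
From mathcomp Require Import complex.
From mathcomp Require Import all_classical all_reals all_analysis.

Set Implicit Arguments.
Unset Strict Implicit.
Unset Printing Implicit Defensive.

Import Order.TTheory GRing.Theory Num.Theory.
Import numFieldNormedType.Exports.

Local Open Scope classical_set_scope.
Local Open Scope ring_scope.
Local Open Scope complex_scope.

Section LebesgueTuple.
Context {R : realType}.

Let T := measurableTypeR R.

Definition cons_pair n (p : T * n.-tuple T) : n.+1.-tuple T :=
  [tuple of p.1 :: p.2].

Lemma measurable_cons_pair n :
  measurable_fun [set: T * n.-tuple T] (@cons_pair n).
Proof. exact: measurable_cons. Qed.

Section ConsMeasure.
Variables (n : nat) (m : {sigma_finite_measure set (n.-tuple T) -> \bar R}).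

Definition cons_measure : set (n.+1.-tuple T) -> \bar R :=
  pushforward (@lebesgue_measure R \x m)%E (@cons_pair n).

Let M : {measure set (n.+1.-tuple T) -> \bar R} :=
  measure_function_pushforward__canonical__measure_function_Measure
    (@lebesgue_measure R \x m)%E (@measurable_cons_pair n).

Let cons_measure0 : cons_measure set0 = 0%E.
Proof. exact: (measure0 M). Qed.

Let cons_measure_ge0 A : (0 <= cons_measure A)%E.
Proof. exact: (measure_ge0 M). Qed.

Let cons_measure_semi_sigma_additive : semi_sigma_additive cons_measure.
Proof. exact: (@measure_semi_sigma_additive _ _ _ M). Qed.

HB.instance Definition _ := isMeasure.Build _ _ _ cons_measure
  cons_measure0 cons_measure_ge0 cons_measure_semi_sigma_additive.

Let cons_measure_sigma_finite : sigma_finite setT cons_measure.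
Proof.
have /sigma_finiteP[F [TF ndF Foo]] := sigma_finiteT (@lebesgue_measure R).
have /sigma_finiteP[G [TG ndG Goo]] := sigma_finiteT m.
pose g (t : n.+1.-tuple T) : T * n.-tuple T := (thead t, [tuple of behead t]).
have gK : g \o (@cons_pair n) = id.
  by apply/funext => -[x t] /=; rewrite /g /cons_pair theadE;
    congr pair; apply/val_inj.
have mg : measurable_fun [set: n.+1.-tuple T] g.
  by apply: measurable_fun_pair; [exact: measurable_tnth|
                                  exact: measurable_behead].
exists (fun k => g @^-1` (F k `*` G k)).
  rewrite -preimage_bigcup (_ : \bigcup_k _ = setT) ?preimage_setT//.
  apply/seteqP; split=> // -[x y] _.
  have [i _ Fx] : (\bigcup_i F i) x by rewrite -TF.
  have [j _ Gy] : (\bigcup_i G i) y by rewrite -TG.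
  exists (maxn i j) => //; split.
  - by move: x Fx; exact/subsetPset/ndF/leq_maxl.
  - by move: y Gy; exact/subsetPset/ndG/leq_maxr.
move=> k; have [mF Fk] := Foo k; have [mG Gk] := Goo k.
have mFG : measurable (F k `*` G k) by exact: measurableX.
split; first by rewrite -[X in measurable X]setTI; exact: mg.
rewrite /cons_measure /pushforward -comp_preimage gK preimage_id.
by rewrite product_measure1E// lte_mul_pinfty// ge0_fin_numE.
Qed.

HB.instance Definition _ := @Measure_isSigmaFinite.Build _ _ _ cons_measure
  cons_measure_sigma_finite.

End ConsMeasure.

(* n-dimensional Lebesgue measure on (the product sigma-algebra of) R^n. *)
Fixpoint lebesgue_tuple n : {sigma_finite_measure set (n.-tuple T) -> \bar R} :=
  match n with
  | 0 => \d_([tuple] : 0.-tuple T)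
  | k.+1 => cons_measure (lebesgue_tuple k)
  end.

End LebesgueTuple.
Arguments lebesgue_tuple {R} n.

(* t = (sigma_1, ..., sigma_{N-1}) completed by
   sigma_N = 1 / (sigma_1 ... sigma_{N-1}). *)
Definition complete_unit_prod (R : fieldType) (N : nat) (t : seq R) :
    'I_N -> R :=
  fun i => nth 0 (rcons t (\prod_(x <- t) x)^-1) i.

(* int_D delta(1 - prod_l sigma_l) F(sigma) dsigma for D in (0,oo)^N, with the
   last variable integrated out. *)
Definition delta_integral (R : realType) (N : nat)
    (D : set ('I_N -> R)) (F : ('I_N -> R) -> R) : \bar R :=
  (\int[lebesgue_tuple N.-1]_(t in
      [set t : (N.-1).-tuple (measurableTypeR R) |
         (forall i, (0 < tnth t i)%R) /\ D (complete_unit_prod t)])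
    (F (complete_unit_prod t) * (\prod_(x <- t) x)^-1)%:E)%E.

Definition cintegral d (T : measurableType d) (R : realType)
    (mu : {measure set T -> \bar R}) (D : set T) (f : T -> R[i]) : R[i] :=
  (\int[mu]_(x in D) complex.Re (f x)) +i* (\int[mu]_(x in D) complex.Im (f x)).

(* a ^ z = exp (z * ln a), for a > 0. *)
Definition cpow (R : realType) (a : R) (z : R[i]) : R[i] :=
  (expR (complex.Re z * ln a))%:C
  * (cos (complex.Im z * ln a) +i* sin (complex.Im z * ln a)).

(* Euler's integral, hence the gamma function for Re z > 0 only: outside this
   half-plane it is not the analytic continuation. *)
Definition cGamma (R : realType) (z : R[i]) : R[i] :=
  cintegral (@lebesgue_measure R) `]0, +oo[
    (fun t => (expR (- t))%:C * cpow t (z - 1)).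

(* The improper integral of f over the upward line Re s = c exists and is L:
   s = c + i y, ds = i dy, both ends of the segment tending to infinity
   independently.  The annotation R[i]^o gives the usual topology of the complex
   numbers. *)
Definition is_vline_integral (R : realType) (c : R) (f : R[i] -> R[i])
    (L : R[i]) : Prop :=
  (fun ab : R * R =>
     ('i%C * cintegral (@lebesgue_measure R) `[- ab.1, ab.2]
             (fun y => f (c +i* y)) : R[i]^o))
    @ filter_prod (pinfty_nbhs R) (pinfty_nbhs R) --> (L : R[i]^o).

(* Extended-real valued: the Lebesgue integral of a nonnegative function. *)
Definition Ihat (R : realType) (beta N : nat) (r : R) : \bar R :=
  ((N`!%:R^-1)%:E * @delta_integral R N
    [set s | (forall l, 0 < s l)%R /\ (\sum_(j < N) s j ^+ 2 <= r ^+ 2)%R]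
    (fun s => \prod_(j < N) \prod_(k < N | (j < k)%N)
                `|s j ^+ 2 - s k ^+ 2| ^+ beta)%R)%E.

(* Main.v *)
(* With g = beta / 2 and x_j = sigma_j ^ 2, let
     L_N(z) = int prod x_j ^ (z-1) e ^ (-x_j) prod_(j<k) |x_j - x_k| ^ beta dx.
   Aomoto's integration by parts gives L_N(z+1) = prod_j (z + g j) L_N(z); as
   in Wielandt's theorem, this recurrence and the growth of L_N determine it up
   to a factor, so L_N(z) = C_N prod_j Gamma(z + g j).  Separating the smallest
   x_j expresses L_(N+1)(1) by L_N(1 + beta), whence C_N by induction.
   On the other hand, scaling out the product of the x_j writes L_N(z) as
   N Gamma(W + 1) times the Laplace transform at W = z N + g N (N - 1) of the
   function K(tau) = int 1(sum x_j <= e ^ tau) prod_(j<k) |x_j - x_k| ^ beta over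
   the hypersurface prod x_j = 1, and Ihat is a multiple of K(2 ln r).  K is
   locally Hoelder continuous of exponent 1/2 for N > 1 and is the indicator
   function of [0, +oo[ for N = 1, so that the Laplace transform can be inverted
   at 2 ln r under Dini's condition. *)
Require Import Defs.
From HB Require Import structures.
From mathcomp Require Import all_boot all_order all_algebra fingroup perm.
From mathcomp Require Import complex.
From mathcomp Require Import all_classical all_reals all_analysis measurable_realfun.
From mathcomp Require Import ring lra.

Set Implicit Arguments.
Unset Strict Implicit.
Unset Printing Implicit Defensive.

Import Order.TTheory GRing.Theory Num.Theory.
Import numFieldNormedType.Exports.

Local Open Scope classical_set_scope.
Local Open Scope ring_scope.

(** A complex integral is carried as a real integral of a weight times cos (y s + th): the phases th
    = 0 and th = - pi / 2 give its real and imaginary parts. The variables are u_j = ln x_j, so that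
    scaling becomes translation. The growth of L_N enters as the limit L_N(z + n) ~ n ^ (N z) L_N(n)
    along the integers n: the recurrence on the real axis forces the positive weight at exponent n
    to concentrate, which yields this limit for complex z as well. Two obstacles shape the rest. For
    beta = 1 the pair factors are not differentiable on the diagonal, so the integration by parts is
    done for a smoothed weight, and its boundary of validity is reached only after symmetrisation.
    And the integrand on the vertical line need not be absolutely integrable, so its integral is
    improper and is computed from an explicit primitive that has a limit at each end. At N = 1 and r
    = 1 the integrand is 2 / s, whose integral with independent ends diverges; for all other N and r
    > 0, K is continuous at 2 ln r. *)

(** * Changes of variables for the Lebesgue integral on the line *)

Section OneDim.
Context {R : realType}.
Notation mu := (@lebesgue_measure R).
Notation TR := (measurableTypeR R).

Lemma lebesgue_translate (q : R) (A : set TR) : measurable A ->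
  pushforward mu (fun x : TR => x + q : TR) A = mu A.
Proof.
move=> mA; have mq : measurable_fun [set: TR] (fun x : TR => x + q : TR).
  exact: measurable_funD.
pose M : {measure set TR -> \bar R} :=
  measure_function_pushforward__canonical__measure_function_Measure mu mq.
apply/esym/(@lebesgue_measure_unique R M) => //= _ [[a b]] _ <-.
rewrite /M /= /pushforward /=.
rewrite (_ : _ @^-1` _ = `]a - q, b - q]%classic).
  rewrite !lebesgue_measure_itv/= !lte_fin ltrD2r.
  by case: ifP => // _; rewrite -!EFinB; congr EFin; ring.
by apply/seteqP; split => x /=; rewrite !in_itv/= ltrBlDr lerBrDr.
Qed.

Lemma ge0_integral_translate (q : R) (g : R -> \bar R) :
  measurable_fun [set: R] g -> (forall x, 0 <= g x)%E ->
  (\int[mu]_x g (x + q)%R = \int[mu]_x g x)%E.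
Proof.
move=> mg g0; have mq : measurable_fun [set: TR] (fun x : TR => x + q : TR).
  exact: measurable_funD.
rewrite [RHS](@eq_measure_integral _ _ _ _ (pushforward mu (fun x : TR => x + q : TR))).
  by rewrite ge0_integral_pushforward.
by move=> A mA _; apply/esym/lebesgue_translate.
Qed.

Lemma ge0_integral_scale (a : R) (g : R -> \bar R) : 0 < a ->
  measurable_fun [set: R] g -> (forall x, 0 <= g x)%E ->
  (\int[mu]_x g x = a%:E * \int[mu]_x g (a * x)%R)%E.
Proof.
move=> a0 mg g0; have ma : measurable_fun [set: TR] (fun x : TR => a * x : TR).
  exact: measurable_funM.
pose M : {measure set TR -> \bar R} :=
  measure_function_pushforward__canonical__measure_function_Measure mu ma.
(* The pushforward under x |-> a x, multiplied by a, agrees with the Lebesgue measure on half-open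
   intervals, hence everywhere. *)
rewrite (@eq_measure_integral _ _ _ _ (mscale (PosNum a0)%:num%:nng M)).
  by rewrite ge0_integral_mscale//= /M ge0_integral_pushforward.
move=> A mA _.
apply: (@lebesgue_measure_unique R (mscale (PosNum a0)%:num%:nng M)) => //= _ [[b c]] _ <-.
rewrite /M /= /mscale /= /pushforward /=.
rewrite (_ : _ @^-1` _ = `]b / a, c / a]%classic).
  rewrite !lebesgue_measure_itv/= !lte_fin ltr_pM2r ?invr_gt0//.
  case: ifP => // _; rewrite -?EFinB ?mule0// -EFinM; congr EFin.
  by field; rewrite gt_eqF.
by apply/seteqP; split => x /=; rewrite !in_itv/= ltr_pdivrMr// ler_pdivlMr// mulrC.
Qed.

Lemma integral_expRN_itv :
  (\int[mu]_(y in `[expR (-1)%R, 1%R]) (y^-1)%:E = 1%:E)%E.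
Proof.
have e1 : expR (-1) < 1 :> R by rewrite expR_lt1 ltrN10.
rewrite (@continuous_FTC2 _ (fun y : R => y^-1) (@ln R) _ _ e1); last 3 first.
- apply: continuous_in_subspaceT => x; rewrite inE/= in_itv/= => /andP[x0 _].
  apply: inv_continuous; rewrite gt_eqF//; exact: lt_le_trans x0; rewrite expR_gt0.
- split.
  + move=> x; rewrite in_itv/= => /andP[x0 _].
    by apply: ex_derive; apply: is_derive1_ln; exact: lt_trans (expR_gt0 _) x0.
  + apply: cvg_at_right_filter; apply: continuous_ln; exact: expR_gt0.
  + apply: cvg_at_left_filter; apply: continuous_ln; exact: ltr01.
- move=> x; rewrite in_itv/= => /andP[x0 _].
  have x00 : 0 < x by exact: lt_trans (expR_gt0 _) x0.
  by rewrite derive1E; apply: derive_val; exact: is_derive1_ln.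
by rewrite ln1 expRK -EFinB sub0r opprK.
Qed.

Lemma integral_indicE d (T : measurableType d) (m : {measure set T -> \bar R})
    (D : set T) (f : T -> \bar R) : measurable D ->
  (\int[m]_(x in D) f x = \int[m]_x ((x \in D)%:R%:E * f x))%E.
Proof.
move=> mD; rewrite integral_mkcond; apply: eq_integral => x _.
by rewrite patchE; case: ifPn => _; rewrite ?mul1e ?mul0e.
Qed.

Lemma integral_haar_itv :
  (\int[mu]_y ((expR (-1) <= y <= 1)%R%:R%:E * (expR (- ln y))%:E) = 1%:E)%E.
Proof.
rewrite -integral_expRN_itv [RHS]integral_indicE; last exact: measurable_itv.
apply: eq_integral => y _; rewrite mem_setE in_itv/=.
have [/andP[y0 _]|_] := boolP (_ <= _ <= _); last by rewrite !mul0e.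
by rewrite expRN lnK// posrE (lt_le_trans _ y0)// expR_gt0.
Qed.

(** An interval of logarithmic length 1, hence of mass 1 for dx / x. *)
Let k_ : R -> \bar R := fun y => (expR (-1) <= y <= 1)%R%:R%:E.

Let mk_ : measurable_fun [set: R] k_.
Proof.
apply/measurable_EFinP; rewrite (_ : (fun _ => _) = \1_(`[expR (-1), 1]%classic : set R)).
  exact: measurable_indic.
by apply/funext => y; rewrite indicE mem_setE in_itv.
Qed.

Let k0_ y : (0 <= k_ y)%E. Proof. by rewrite lee_fin. Qed.

Let k_neg_ y : y <= 0 -> k_ y = 0%E.
Proof.
by move=> y0; rewrite /k_ (leNgt (expR _)) (le_lt_trans y0) ?expR_gt0.
Qed.

Let integral_k_ (x : R) : 0 < x -> (\int[mu]_u k_ (x * expR (- u)))%E = 1%:E.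
Proof.
move=> x0; transitivity (\int[mu]_u (\1_(`[ln x, ln x + 1]%classic : set R) u)%:E)%E.
  apply: eq_integral => u _; rewrite /k_ indicE mem_setE in_itv/=.
  rewrite -{1 2}(lnK x0) -expRD ler_expR expR_le1.
  by congr (EFin (nat_of_bool _)%:R); apply/idP/idP; lra.
rewrite integral_indic//= setIT.
apply: etrans (lebesgue_measure_itv _) _; rewrite /= lte_fin ltrDl ltr01.
by rewrite -EFinB; congr EFin; ring.
Qed.

(** The five properties of the kernel that the change of variables x = e ^ u relies on; its concrete
    form is hidden from there on. *)
Let haar_kernel : exists k : R -> \bar R,
  [/\ measurable_fun [set: R] k, forall y, (0 <= k y)%E,
      forall y, y <= 0 -> k y = 0%E,
      forall x, 0 < x -> (\int[mu]_u k (x * expR (- u))%R)%E = 1%:E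
    & (\int[mu]_y (k y * (expR (- ln y))%:E) = 1%:E)%E].
Proof.
exists k_; split; [exact: mk_|exact: k0_|exact: k_neg_|exact: integral_k_|].
exact: integral_haar_itv.
Qed.

(* Uniqueness of the Haar measure: if k has Haar integral 1, both sides are the
   double integral of g x * k (x / e ^ u) over x > 0 and u. *)
Lemma ge0_integral_expR (g : R -> \bar R) :
  measurable_fun [set: R] g -> (forall x, 0 <= g x)%E ->
  (\int[mu]_(x in `]0%R, +oo[) g x = \int[mu]_u ((expR u)%:E * g (expR u)))%E.
Proof.
move=> mg g0; have [k [mk k0 k_neg integral_k integral_haar]] := haar_kernel.
pose p (x : R) : R := (0 < x)%R%:R.
have mp : measurable_fun [set: R] p.
  rewrite (_ : p = \1_(`]0, +oo[%classic : set R)); first exact: measurable_indic.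
  by apply/funext => y; rewrite indicE mem_setE in_itv/= andbT.
have p0 x : (0 <= (p x)%:E)%E by rewrite lee_fin /p ler0n.
have p1 x : 0 < x -> p x = 1 by rewrite /p => ->.
have pN x : x <= 0 -> p x = 0 by rewrite /p ltNge => ->.
have pE x : (0 < x)%R%:R = p x by [].
clearbody p.
pose F (z : R * R) := ((p z.1)%:E * g z.1 * k (z.1 * expR (- z.2))%R)%E.
have mF : measurable_fun [set: R * R] F.
  apply: emeasurable_funM; first apply: emeasurable_funM.
  - by apply/measurable_EFinP; exact: measurableT_comp.
  - exact: measurableT_comp.
  - apply: measurableT_comp => //; apply: measurable_funM => //.
    apply: measurableT_comp => //; exact: measurableT_comp.
have F0 z : (0 <= F z)%E by rewrite /F; apply: mule_ge0 => //; exact: mule_ge0.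
have FE x u : F (x, u) = ((p x)%:E * g x * k (x * expR (- u))%R)%E by [].
clearbody F.
have Fub := @fubini_tonelli _ _ _ _ R mu mu F mF F0.
transitivity (\int[mu]_x \int[mu]_u F (x, u))%E.
  rewrite integral_indicE; last exact: measurable_itv.
  apply: eq_integral => x _; rewrite mem_setE in_itv/= andbT pE.
  under eq_integral do rewrite FE.
  have [x0|x0] := ltP 0 x; last first.
    by under eq_integral do rewrite (pN _ x0) !mul0e; rewrite (pN _ x0) mul0e integral0.
  rewrite ge0_integralZl.
  - by rewrite (integral_k _ x0) mule1.
  - by [].
  - apply: measurableT_comp; first exact: mk.
    apply: measurable_funM; first exact: measurable_cst.
    by apply: measurableT_comp => //; exact: measurableT_comp.
  - by [].
  - exact: mule_ge0.
rewrite Fub.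
have e0 u : (0 <= (expR u)%:E :> \bar R)%E by rewrite lee_fin expR_ge0.
(* [F'] is e ^ u F (e ^ u y, u), that is, F after the substitution x = e ^ u y; for y <= 0 both
   vanish. *)
pose F' (z : R * R) := (k z.2 * ((expR z.1)%:E * g (expR z.1 * z.2)%R))%E.
have mF' : measurable_fun [set: R * R] F'.
  apply: emeasurable_funM; first by apply: measurableT_comp; [exact: mk|exact: measurable_snd].
  apply: emeasurable_funM.
    by apply/measurable_EFinP; exact: measurableT_comp.
  apply: measurableT_comp; first exact: mg.
  apply: measurable_funM; last exact: measurable_snd.
  exact: measurableT_comp.
have F'0 z : (0 <= F' z)%E.
  rewrite /F'; apply: mule_ge0; first exact: k0.
  apply: mule_ge0; [exact: e0|exact: g0].
have F'E u y : F' (u, y) = (k y * ((expR u)%:E * g (expR u * y)%R))%E by [].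
clearbody F'.
transitivity (\int[mu]_u \int[mu]_y F' (u, y))%E.
  apply: eq_integral => u _; rewrite [LHS](@ge0_integral_scale (expR u)).
  - rewrite -ge0_integralZl; [|by []| | |].
    + apply: eq_integral => y _; rewrite FE F'E.
      have [y0|y0] := ltP 0 y; last first.
        have yu : expR u * y <= 0 by rewrite (pmulr_rle0 _ (expR_gt0 _)).
        by rewrite (k_neg _ y0) (pN _ yu) !mul0e mule0.
      have yu : 0 < expR u * y by exact: mulr_gt0 (expR_gt0 _) y0.
      rewrite (p1 _ yu) mul1e -mulrA (mulrC y) mulrA expRxMexpNx_1 mul1r.
      by rewrite muleA muleC.
    + apply: (measurableT_comp mF); apply: measurable_fun_pair.
        by apply: measurable_funM; [exact: measurable_cst|exact: measurable_id].
      exact: measurable_cst.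
    + by move=> y _; exact: F0.
    + exact: e0.
  - exact: expR_gt0.
  - by apply: (measurableT_comp mF); exact: measurable_fun_pair.
  - by move=> x; exact: F0.
rewrite (@fubini_tonelli _ _ _ _ R mu mu F' mF' F'0).
transitivity (\int[mu]_y ((k y * (expR (- ln y))%:E) * (\int[mu]_u ((expR u)%:E * g (expR u)))))%E.
  apply: eq_integral => y _; under eq_integral do rewrite F'E.
  have [y0|y0] := ltP 0 y; last first.
    by under eq_integral do rewrite (k_neg _ y0) mul0e; rewrite integral0 (k_neg _ y0) !mul0e.
  have mge : measurable_fun [set: R] (fun u => (expR u)%:E * g (expR u))%E.
    apply: emeasurable_funM; first exact/measurable_EFinP.
    by apply: measurableT_comp; [exact: mg|exact: measurable_expR].
  have eg0 u : (0 <= (expR u)%:E * g (expR u))%E by apply: mule_ge0; [exact: e0|exact: g0].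
  rewrite -ge0_integralZl; [|by []|exact: mge|by []|apply: mule_ge0; [exact: k0|exact: e0]].
  (* Translating u by ln y turns e ^ u into e ^ u y and accounts for the factor 1 / y. *)
  rewrite -[RHS](ge0_integral_translate (ln y)); last 2 first.
  - by apply: emeasurable_funM => //; exact: measurable_cst.
  - by move=> u; apply: mule_ge0; [apply: mule_ge0; [exact: k0|exact: e0]|exact: eg0].
  apply: eq_integral => u _; rewrite expRD expRN (lnK _) ?posrE// -muleA; congr (_ * _)%E.
  rewrite muleA -EFinM; congr (_%:E * _)%E; field; rewrite gt_eqF//.
rewrite ge0_integralZr.
- by rewrite integral_haar mul1e.
- by [].
- apply: emeasurable_funM => //; apply/measurable_EFinP.
  by apply: measurableT_comp => //; apply: measurableT_comp => //; exact: measurable_ln.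
- by move=> y _; apply: mule_ge0; [exact: k0|exact: e0].
- by apply: integral_ge0 => u _; apply: mule_ge0; [exact: e0|exact: g0].
Qed.

End OneDim.

(** * Integration over tuples: Tonelli, coordinatewise substitution, exchange of coordinates *)

Section Tuple.
Context {R : realType}.
Notation mu := (@lebesgue_measure R).
Notation TR := (measurableTypeR R).
Notation leb := (@lebesgue_tuple R).

Let pushforward_cons n : {measure set (n.+1.-tuple TR) -> \bar R} :=
  measure_function_pushforward__canonical__measure_function_Measure
    (mu \x leb n)%E (@measurable_cons_pair R n).

Lemma ge0_integral_cons n (f : n.+1.-tuple TR -> \bar R) :
  measurable_fun setT f -> (forall t, 0 <= f t)%E ->
  (\int[leb n.+1]_t f t = \int[mu]_x \int[leb n]_t f [tuple of x :: t])%E.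
Proof.
move=> mf f0.
rewrite (@eq_measure_integral _ _ _ _ (pushforward_cons n)); last by [].
rewrite ge0_integral_pushforward; [|exact: measurable_cons_pair|by []|by []|by []].
rewrite preimage_setT fubini_tonelli1; [by []| |by move=> z; exact: f0].
by apply: measurableT_comp; [exact: mf|exact: measurable_cons_pair].
Qed.

Lemma ge0_integral_cons2 n (f : n.+1.-tuple TR -> \bar R) :
  measurable_fun setT f -> (forall t, 0 <= f t)%E ->
  (\int[leb n.+1]_t f t = \int[leb n]_t \int[mu]_x f [tuple of x :: t])%E.
Proof.
move=> mf f0.
rewrite (@eq_measure_integral _ _ _ _ (pushforward_cons n)); last by [].
rewrite ge0_integral_pushforward; [|exact: measurable_cons_pair|by []|by []|by []].
rewrite preimage_setT fubini_tonelli2; [by []| |by move=> z; exact: f0].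
by apply: measurableT_comp; [exact: mf|exact: measurable_cons_pair].
Qed.

Lemma integral_tuple0 (f : 0.-tuple TR -> \bar R) :
  (\int[leb 0]_t f t = f [tuple])%E.
Proof.
rewrite [LHS](@eq_measure_integral _ _ _ _ (\d_([tuple] : 0.-tuple TR))); last by [].
have fE : f = cst (f [tuple]) by apply/funext => t; rewrite (tuple0 t).
rewrite integral_dirac; [by rewrite diracT mul1e|by []|].
by rewrite fE; exact: measurable_cst.
Qed.

Lemma measurable_cons1 n (x : TR) :
  measurable_fun setT (fun t : n.-tuple TR => [tuple of x :: t]).
Proof. exact: (measurable_cons (f := fun=> x) (g := id)). Qed.

Lemma measurable_cons2 n (t : n.-tuple TR) :
  measurable_fun setT (fun x : TR => [tuple of x :: t]).
Proof. exact: (measurable_cons (f := id) (g := fun=> t)). Qed.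

Lemma measurable_fun_cons_integral n (f : n.+1.-tuple TR -> \bar R) :
  measurable_fun setT f -> (forall t, 0 <= f t)%E ->
  measurable_fun setT (fun x => \int[leb n]_t f [tuple of x :: t])%E.
Proof.
move=> mf f0.
apply: (@measurable_fun_fubini_tonelli_F _ _ _ _ R (leb n) (f \o @cons_pair R n)).
  by apply: measurableT_comp; [exact: mf|exact: measurable_cons_pair].
by move=> z; exact: f0.
Qed.

Lemma measurable_fun_cons_integral2 n (f : n.+1.-tuple TR -> \bar R) :
  measurable_fun setT f -> (forall t, 0 <= f t)%E ->
  measurable_fun setT (fun t : n.-tuple TR => \int[mu]_x f [tuple of x :: t])%E.
Proof.
move=> mf f0.
apply: (@measurable_fun_fubini_tonelli_G _ _ _ _ R mu (f \o @cons_pair R n)).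
  by apply: measurableT_comp; [exact: mf|exact: measurable_cons_pair].
by move=> z; exact: f0.
Qed.

Lemma measurable_cons_comp n (x : TR) (f : n.+1.-tuple TR -> \bar R) :
  measurable_fun setT f ->
  measurable_fun setT (fun t : n.-tuple TR => f [tuple of x :: t]).
Proof. by move=> mf; apply: measurableT_comp => //; exact: measurable_cons1. Qed.

Lemma measurable_map_tuple n (phi : R -> R) : measurable_fun [set: R] phi ->
  measurable_fun setT (fun t : n.-tuple TR => [tuple of map phi t] : n.-tuple TR).
Proof.
move=> mphi; apply/measurable_fun_tnthP => i.
rewrite (_ : _ \o _ = fun t => phi (tnth t i)); last first.
  by apply/funext => t /=; rewrite tnth_map.
apply: (@measurableT_comp _ _ _ _ _ _ phi) => //; exact: measurable_tnth.
Qed.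

Lemma measurable_prod_tuple n (w : R -> R) : measurable_fun [set: R] w ->
  measurable_fun setT (fun t : n.-tuple TR => \prod_(i < n) w (tnth t i)).
Proof.
move=> mw; apply: measurable_prod => i _.
apply: (@measurableT_comp _ _ _ _ _ _ w) => //; exact: measurable_tnth.
Qed.

Section CoordSubst.
Variables (phi w1 w2 : R -> R).
Hypotheses (mphi : measurable_fun [set: R] phi).
Hypotheses (mw1 : measurable_fun [set: R] w1) (mw2 : measurable_fun [set: R] w2).
Hypotheses (w10 : forall x, 0 <= w1 x) (w20 : forall x, 0 <= w2 x).
Hypothesis subst1 : forall g : R -> \bar R, measurable_fun [set: R] g ->
  (forall x, 0 <= g x)%E ->
  (\int[mu]_x ((w1 x)%:E * g x) = \int[mu]_x ((w2 x)%:E * g (phi x)))%E.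

(** The weights carry the Jacobian; moreover [w1] may vanish on part of the line, so that [phi] need
    only reach the set where [w1] is positive. The rule passes to tuples by peeling off the head
    with Tonelli's theorem. *)
Lemma ge0_integral_map_tuple n (F : n.-tuple TR -> \bar R) :
  measurable_fun setT F -> (forall t, 0 <= F t)%E ->
  (\int[leb n]_t ((\prod_(i < n) w1 (tnth t i))%:E * F t) =
   \int[leb n]_t ((\prod_(i < n) w2 (tnth t i))%:E * F [tuple of map phi t]))%E.
Proof.
elim: n F => [|n IH] F mF F0.
  by rewrite !integral_tuple0 !big_ord0; congr (_ * F _)%E; rewrite [RHS]tuple0.
have mP (w : R -> R) m : measurable_fun [set: R] w ->
    measurable_fun setT (fun t : m.-tuple TR => (\prod_(i < m) w (tnth t i))%:E).
  by move=> mw; apply/measurable_EFinP; exact: measurable_prod_tuple.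
have P0 (w : R -> R) m (t : m.-tuple TR) : (forall x, 0 <= w x) ->
    (0 <= (\prod_(i < m) w (tnth t i))%:E)%E.
  by move=> w0; rewrite lee_fin prodr_ge0.
have mmF m (G : m.-tuple TR -> \bar R) : measurable_fun setT G ->
    measurable_fun setT (fun t : m.-tuple TR => G [tuple of map phi t]).
  by move=> mG; apply: measurableT_comp => //; exact: measurable_map_tuple.
have mF1 x := measurable_cons_comp x mF.
have prodS (w : R -> R) x (t : n.-tuple TR) :
    (\prod_(i < n.+1) w (tnth [tuple of x :: t] i)) =
    w x * \prod_(i < n) w (tnth t i).
  by rewrite big_ord_recl; congr (_ * _); apply: eq_bigr => i _; rewrite tnthS.
have mapS x (t : n.-tuple TR) :
    [tuple of map phi [tuple of x :: t]] = [tuple of phi x :: [tuple of map phi t]].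
  exact: val_inj.
rewrite [LHS]ge0_integral_cons; last 2 first.
- by apply: emeasurable_funM; [exact: mP|exact: mF].
- by move=> t; apply: mule_ge0; [exact: P0|exact: F0].
rewrite [RHS]ge0_integral_cons; last 2 first.
- by apply: emeasurable_funM; [exact: mP|exact: mmF].
- by move=> t; apply: mule_ge0; [exact: P0|exact: F0].
(* The inner integral once the tail has been substituted by induction; the head is then handled by
   [subst1] for [G]. *)
pose G x := (\int[leb n]_t ((\prod_(i < n) w2 (tnth t i))%:E * F [tuple of x :: [tuple of map phi t]]))%E.
have mG : measurable_fun setT G.
  apply: (@measurable_fun_fubini_tonelli_F _ _ _ _ R (leb n)
   (fun z => (\prod_(i < n) w2 (tnth z.2 i))%:E * F [tuple of z.1 :: [tuple of map phi z.2]])%E).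
    apply: emeasurable_funM.
      exact: (measurableT_comp (mP _ _ _)).
    apply: measurableT_comp => //.
    apply: (measurable_cons (f := fst) (g := fun z : TR * n.-tuple TR => [tuple of map phi z.2])) => //.
    by apply: (measurableT_comp (measurable_map_tuple _)).
  by move=> z; apply: mule_ge0; [exact: P0|exact: F0].
transitivity (\int[mu]_x ((w1 x)%:E * G x))%E.
  apply: eq_integral => x _.
  under eq_integral do rewrite prodS EFinM -muleA.
  rewrite ge0_integralZl.
  - by rewrite IH; [|exact: mF1|by move=> t; exact: F0].
  - by [].
  - by apply: emeasurable_funM; [exact: mP|exact: mF1].
  - by move=> t _; apply: mule_ge0; [exact: P0|exact: F0].
  - by rewrite lee_fin; exact: w10.
rewrite subst1; [|exact: mG|]; last first.
  by move=> x; apply: integral_ge0 => t _; apply: mule_ge0; [exact: P0|exact: F0].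
apply: eq_integral => x _.
under [RHS]eq_integral do rewrite prodS mapS EFinM -muleA.
rewrite ge0_integralZl; [by []|by []| | |].
- apply: emeasurable_funM; first exact: mP.
  by apply: (mmF _ (fun t => F [tuple of phi x :: t])); exact: mF1.
- by move=> t _; apply: mule_ge0; [exact: P0|exact: F0].
- by rewrite lee_fin; exact: w20.
Qed.

End CoordSubst.

Definition swap_tuple n (i j : 'I_n) (t : n.-tuple TR) : n.-tuple TR :=
  [tuple tnth t (tperm i j k) | k < n].

Lemma tnth_swap n (i j k : 'I_n) (t : n.-tuple TR) :
  tnth (swap_tuple i j t) k = tnth t (tperm i j k).
Proof. by rewrite tnth_mktuple. Qed.

Lemma measurable_swap_tuple n (i j : 'I_n) : measurable_fun setT (swap_tuple i j).
Proof.
apply/measurable_fun_tnthP => k.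
rewrite (_ : _ \o _ = fun t => tnth t (tperm i j k)).
  exact: measurable_tnth.
by apply/funext => t /=; rewrite tnth_swap.
Qed.

Lemma measurable_swap_comp n (i j : 'I_n) (f : n.-tuple TR -> \bar R) :
  measurable_fun setT f -> measurable_fun setT (fun t => f (swap_tuple i j t)).
Proof. by move=> mf; apply: measurableT_comp => //; exact: measurable_swap_tuple. Qed.

(** A transposition that fixes the head acts on the tail, (0 1) is Tonelli's theorem, and every
    other (0 a) is the conjugate of (0 1) by (1 a). *)
Lemma ge0_integral_swap n (i j : 'I_n) (f : n.-tuple TR -> \bar R) :
  measurable_fun setT f -> (forall t, 0 <= f t)%E ->
  (\int[leb n]_t f (swap_tuple i j t) = \int[leb n]_t f t)%E.
Proof.
elim: n i j f => [|n IH] i j f mf f0; first by case: i.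
have swapC m (a b : 'I_m) : swap_tuple a b = swap_tuple b a.
  by apply/funext => t; rewrite /swap_tuple tpermC.
have ordP m (k : 'I_m.+1) : k = ord0 \/ exists k', k = lift ord0 k'.
  by case: (unliftP ord0 k) => [k' ->|->]; [right; exists k'|left].
have liftswap (a b : 'I_n) (g : n.+1.-tuple TR -> \bar R) :
    measurable_fun setT g -> (forall t, 0 <= g t)%E ->
    (\int[leb n.+1]_t g (swap_tuple (lift ord0 a) (lift ord0 b) t) =
     \int[leb n.+1]_t g t)%E.
  move=> mg g0; rewrite ge0_integral_cons; last 2 first.
  - exact: measurable_swap_comp.
  - by move=> t; exact: g0.
  rewrite [RHS]ge0_integral_cons; [|exact: mg|exact: g0].
  apply: eq_integral => x _.
  rewrite -[RHS](IH a b); last 2 first.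
  - exact: measurable_cons_comp.
  - by move=> t; exact: g0.
  apply: eq_integral => t _; congr (g _); apply: eq_from_tnth => k.
  rewrite tnth_swap; have [->|[k' ->]] := ordP _ k; first by rewrite tpermD.
  rewrite tnthS tnth_swap; have [->|ak] := eqVneq k' a; first by rewrite !tpermL tnthS.
  have [->|bk] := eqVneq k' b; first by rewrite !tpermR tnthS.
  by rewrite !tpermD ?tnthS// ?(inj_eq lift_inj) eq_sym.
have swap0 (a : 'I_n) (g : n.+1.-tuple TR -> \bar R) :
    measurable_fun setT g -> (forall t, 0 <= g t)%E ->
    (\int[leb n.+1]_t g (swap_tuple ord0 (lift ord0 a) t) =
     \int[leb n.+1]_t g t)%E.
  move: a g; clear i j f mf f0 IH; case: n liftswap => [|m] liftswap; first by case.
  move=> a g mg g0.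
  have base (h : m.+2.-tuple TR -> \bar R) : measurable_fun setT h -> (forall t, 0 <= h t)%E ->
    (\int[leb m.+2]_t h (swap_tuple ord0 (lift ord0 ord0) t) = \int[leb m.+2]_t h t)%E.
    move=> mh h0.
    have E (k : m.+2.-tuple TR -> \bar R) : measurable_fun setT k -> (forall t, 0 <= k t)%E ->
      (\int[leb m.+2]_t k t = \int[mu]_x \int[mu]_y \int[leb m]_t k [tuple of x :: [tuple of y :: t]])%E.
      move=> mk k0; rewrite ge0_integral_cons; [|exact: mk|exact: k0].
      apply: eq_integral => x _; apply: ge0_integral_cons; first exact: measurable_cons_comp.
      by move=> t; exact: k0.
    rewrite E; [|exact: measurable_swap_comp|by move=> t; exact: h0].
    rewrite [RHS]E; [|exact: mh|exact: h0].
    rewrite [RHS](@fubini_tonelli _ _ _ _ R mu mu (fun z => \int[leb m]_t h [tuple of z.1 :: [tuple of z.2 :: t]])%E); last 2 first.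
    - apply: (@measurable_fun_fubini_tonelli_F _ _ _ _ R (leb m)
        (fun z : (TR * TR) * m.-tuple TR => h [tuple of z.1.1 :: [tuple of z.1.2 :: z.2]])).
        apply: measurableT_comp; first exact: mh.
        apply: (measurable_cons (f := fun z : (TR * TR) * m.-tuple TR => z.1.1)
          (g := fun z => [tuple of z.1.2 :: z.2])).
          exact: (measurableT_comp measurable_fst measurable_fst).
        apply: (measurable_cons (f := fun z : (TR * TR) * m.-tuple TR => z.1.2)
          (g := snd)).
          exact: (measurableT_comp measurable_snd measurable_fst).
        exact: measurable_snd.
      by move=> z; exact: h0.
    - by move=> z; apply: integral_ge0 => t _; exact: h0.
    apply: eq_integral => x _; apply: eq_integral => y _; apply: eq_integral => t _.
    congr (h _); apply: eq_from_tnth => k; rewrite tnth_swap.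
    have [->|[k' ->]] := ordP _ k; first by rewrite tpermL tnthS.
    have [->|[k2 ->]] := ordP _ k'; first by rewrite tpermR tnthS.
    by rewrite tpermD// !tnthS.
  have [->|a0] := eqVneq a ord0; first exact: base.
  have E t : swap_tuple ord0 (lift ord0 a) t =
     swap_tuple (lift ord0 ord0) (lift ord0 a) (swap_tuple ord0 (lift ord0 ord0)
       (swap_tuple (lift ord0 ord0) (lift ord0 a) t)).
    apply: eq_from_tnth => k; rewrite !tnth_swap; congr tnth.
    rewrite -!permM; congr (fun_of_perm _ _).
    have -> : tperm ord0 (lift ord0 a) = (tperm ord0 (lift ord0 ord0) ^ tperm (lift ord0 ord0) (lift ord0 a))%g.
      by rewrite tpermJ tpermD// tpermL.
    by rewrite conjgE tpermV mulgA.
  under eq_integral do rewrite E.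
  rewrite (liftswap ord0 a (fun t => g (swap_tuple (lift ord0 ord0) (lift ord0 a)
     (swap_tuple ord0 (lift ord0 ord0) t)))); last 2 first.
  - by apply: (measurable_swap_comp _ _ (f := fun t => g (swap_tuple _ _ t))); exact: measurable_swap_comp.
  - by move=> t; exact: g0.
  rewrite (base (fun t => g (swap_tuple (lift ord0 ord0) (lift ord0 a) t))); last 2 first.
  - exact: measurable_swap_comp.
  - by move=> t; exact: g0.
  exact: liftswap.
case: (unliftP ord0 i) => [i' ->|->]; case: (unliftP ord0 j) => [j' ->|->].
- exact: liftswap.
- by rewrite swapC swap0.
- exact: swap0.
- apply: eq_integral => t _; congr f; apply: eq_from_tnth => k.
  by rewrite tnth_swap tperm1 perm1.
Qed.

Lemma integral_swap n (i j : 'I_n) (f : n.-tuple TR -> \bar R) :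
  measurable_fun setT f ->
  (\int[leb n]_t f (swap_tuple i j t) = \int[leb n]_t f t)%E.
Proof.
move=> mf; rewrite [LHS]integralE [RHS]integralE.
rewrite -(ge0_integral_swap i j (measurable_funepos mf)); last by move=> t; exact: funepos_ge0.
rewrite -(ge0_integral_swap i j (measurable_funeneg mf)); last by move=> t; exact: funeneg_ge0.
by congr (_ - _)%E; apply: eq_integral => t _; rewrite ?funeposE ?funenegE.
Qed.

Lemma integrable_swap n (i j : 'I_n) (f : n.-tuple TR -> \bar R) :
  (leb n).-integrable setT f ->
  (leb n).-integrable setT (fun t => f (swap_tuple i j t)).
Proof.
move=> /integrableP[mf fi]; apply/integrableP; split.
  exact: measurable_swap_comp.
rewrite (ge0_integral_swap i j (f := fun t => `|f t|%E)); first exact: fi.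
  by apply: measurableT_comp; [exact: abse_measurable|exact: mf].
by move=> t; exact: abse_ge0.
Qed.

End Tuple.

(** * Domination and dominated convergence for real-valued functions *)

Section IntegrableReal.
Context d (T : measurableType d) (R : realType) (m : {measure set T -> \bar R}).

Lemma le_integrableT (f g : T -> R) : measurable_fun setT f ->
  (forall x, `|f x| <= g x) -> m.-integrable setT (fun x => (g x)%:E) ->
  m.-integrable setT (fun x => (f x)%:E).
Proof.
move=> mf fg ig; apply: (le_integrable measurableT _ _ ig).
  exact/measurable_EFinP.
by move=> x _; rewrite !abse_EFin lee_fin (le_trans (fg x))// ler_norm.
Qed.

Lemma dominated_convergenceT (f_ : nat -> T -> R) (f g : T -> R) :
  (forall n, measurable_fun setT (f_ n)) -> measurable_fun setT f ->
  (forall x, f_ n x @[n --> \oo] --> f x) -> (forall n x, `|f_ n x| <= g x) ->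
  m.-integrable setT (fun x => (g x)%:E) ->
  (\int[m]_x (f_ n x)%:E)%E @[n --> \oo] --> (\int[m]_x (f x)%:E)%E.
Proof.
move=> mf_ mf ff fg ig.
have [] := @dominated_convergence _ T R m setT measurableT
  (fun n x => (f_ n x)%:E) (fun x => (f x)%:E) (fun x => (g x)%:E).
- by move=> n; exact/measurable_EFinP.
- exact/measurable_EFinP.
- by apply: aeW => x _; apply: cvg_EFin; [exact: nearW|exact: ff].
- exact: ig.
- by apply: aeW => x n _; rewrite abse_EFin lee_fin.
by [].
Qed.

End IntegrableReal.

(** * Exponential integrals, decay of the Gamma weight, integrals of derivatives *)

Section RealAnalysis.
Context {R : realType}.
Notation mu := (@lebesgue_measure R).
Notation TR := (measurableTypeR R).

Lemma is_derive_continuous (F : R -> R) (x l : R) :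
  is_derive x (1 : R) F l -> {for x, continuous F}.
Proof.
by move=> dF; apply: differentiable_continuous; apply/derivable1_diffP; apply: ex_derive; exact: dF.
Qed.

Lemma measurable_expRN_norm (k : R) : measurable_fun [set: R] (fun x : R => expR (- (k * `|x|))).
Proof.
apply: (measurableT_comp (@measurable_expR R)); apply: measurableT_comp => //.
by apply: measurable_funM => //; exact: measurableT_comp.
Qed.

Lemma integral_expRN_cy (k : R) : 0 < k ->
  (\int[mu]_(x in `[0%R, +oo[) (expR (- (k * x)))%:E = (k^-1)%:E)%E.
Proof.
move=> k0.
have dF (x : R) : is_derive x (1 : R) (fun x : R => - (k^-1 * expR (- (k * x)))) (expR (- (k * x))).
  by apply: is_derive_eq; rewrite /GRing.scale/=; field; exact: lt0r_neq0.
rewrite (@ge0_continuous_FTC2y _ _ (fun x : R => - (k^-1 * expR (- (k * x)))) _ 0).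
- by rewrite mulr0 oppr0 expR0 mulr1 -EFinB sub0r opprK.
- by move=> x _; exact: expR_ge0.
- apply: continuous_subspaceT => x.
  apply: continuous_comp; last exact: continuous_expR.
  by apply: continuousN; apply: continuousM; [exact: cst_continuous|exact: cvg_id].
- rewrite -[X in _ --> X]oppr0; apply: cvgN; rewrite -(mulr0 k^-1); apply: cvgMr.
  apply: (@cvg_comp _ _ _ (fun x : R => k * x) (fun x => expR (- x)) _ +oo%R); last exact: cvgr_expR.
  exact: (gt0_cvgMry k0 (@cvg_id _ _)).
- by move=> x _; apply: ex_derive; exact: dF.
- by apply: cvg_at_right_filter; exact: (is_derive_continuous (dF 0)).
- by move=> x _; rewrite derive1E; apply: derive_val; exact: dF.
Qed.

Lemma integral_expRN_norm (k : R) : 0 < k ->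
  (\int[mu]_x (expR (- (k * `|x|)))%:E = (2 / k)%:E)%E.
Proof.
move=> k0; rewrite ge0_symfun_integralT; last 3 first.
- by move=> x; exact: expR_ge0.
- move=> x; apply: continuous_comp; last exact: continuous_expR.
  apply: continuousN; apply: continuousM; first exact: cst_continuous.
  exact: norm_continuous.
- by move=> x /=; rewrite normrN.
rewrite (_ : [set x : R | (0 <= x)%R] = `[0%R, +oo[%classic); last first.
  by apply/seteqP; split=> x /=; rewrite in_itv/= andbT.
rewrite EFinM -(integral_expRN_cy k0); congr (_ * _)%E.
by apply: eq_integral => x; rewrite inE/= in_itv/= andbT => x0; rewrite ger0_norm.
Qed.

Lemma integrable_expRN_norm (k : R) : 0 < k ->
  mu.-integrable setT (fun x : R => (expR (- (k * `|x|)))%:E).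
Proof.
move=> k0; apply/integrableP; split.
  by apply/measurable_EFinP; exact: measurable_expRN_norm.
under eq_integral do rewrite gee0_abs ?lee_fin ?expR_ge0//.
by rewrite integral_expRN_norm// ltry.
Qed.

(** The n-th power of 1 + x <= n (1 + x / n) <= n e ^ (x / n). *)
Lemma expR_ge_exprn (n : nat) (x : R) : (0 < n)%N -> 0 <= x ->
  (1 + x) ^+ n <= n%:R ^+ n * expR x.
Proof.
move=> n0 x0; have nR : 0 < n%:R :> R by rewrite ltr0n.
have n1 : 1 <= n%:R :> R by rewrite ler1n.
have -> : expR x = expR (x / n%:R) ^+ n.
  by rewrite -expRM_natl; congr expR; field; exact: lt0r_neq0.
rewrite -exprMn; apply: lerXn2r; rewrite ?nnegrE; [lra|by rewrite mulr_ge0 ?expR_ge0// ltW|].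
have nx : n%:R * (x / n%:R) = x by field; exact: lt0r_neq0.
have h := ler_wpM2l (ltW nR) (expR_ge1Dx (x / n%:R)).
rewrite mulrDr mulr1 nx in h; lra.
Qed.

(* The weight x ^ a (1 + x) ^ m e ^ (-x) dx / x of the Gamma integral, in the
   variable u = ln x. *)
Definition gker (a : R) (m : nat) (u : R) : R :=
  expR (a * u) * (1 + expR u) ^+ m * expR (- expR u).

Lemma gker_ge0 (a : R) m u : 0 <= gker a m u.
Proof. by rewrite !mulr_ge0 ?exprn_ge0 ?expR_ge0// addr_ge0// expR_ge0. Qed.

Lemma measurable_gker (a : R) m : measurable_fun [set: R] (gker a m).
Proof.
apply: measurable_funM; first apply: measurable_funM.
- by apply: (measurableT_comp (@measurable_expR R)); exact: measurable_funM.
- by apply: measurable_funX; apply: measurable_funD => //; exact: measurable_expR.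
- by apply: (measurableT_comp (@measurable_expR R)); apply: measurableT_comp => //; exact: measurable_expR.
Qed.

(** With x = e ^ u and an integer p >= a, the weight is at most n ^ n x ^ a / (1 + x) ^ (p + 1).
    This decays like x ^ a as x tends to 0 and at least like 1 / x as x tends to infinity, whence
    the rate k = min (a, 1). *)
Lemma gker_bound (a : R) m : 0 < a ->
  exists C, exists k, [/\ 0 <= C, 0 < k & forall u, gker a m u <= C * expR (- (k * `|u|))].
Proof.
move=> a0; pose p := (Num.truncn a).+1; pose n := (m + p.+1)%N.
have ap : a <= p%:R by rewrite ltW// truncnS_gt.
have n0 : (0 < n)%N by rewrite /n addnS.
exists (n%:R ^+ n), (Num.min a 1); split.
- by rewrite exprn_ge0.
- by rewrite lt_min a0 ltr01.
move=> u; have x0 := expR_gt0 u; set x := expR u in x0 *.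
have nn0 : 0 <= n%:R ^+ n :> R by rewrite exprn_ge0.
have x10 : 0 < 1 + x by lra.
have h : (1 + x) ^+ m * expR (- x) <= n%:R ^+ n / (1 + x) ^+ p.+1.
  rewrite ler_pdivlMr ?exprn_gt0// mulrAC -exprD -/n.
  have := expR_ge_exprn n0 (ltW x0); rewrite -(ler_pM2r (expR_gt0 (- x))) => /le_trans; apply.
  by rewrite -mulrA expRxMexpNx_1 mulr1.
rewrite /gker -/x -mulrA; apply: (@le_trans _ _ (expR (a * u) * (n%:R ^+ n / (1 + x) ^+ p.+1))).
  by rewrite ler_wpM2l ?expR_ge0.
rewrite mulrCA ler_wpM2l//.
have [u0|u0] := leP 0 u.
- rewrite ger0_norm//; apply: (@le_trans _ _ (expR (- u))); last first.
    rewrite ler_expR lerN2 ler_piMl// ge_min lexx orbT//.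
  rewrite ler_pdivrMr ?exprn_gt0//.
  apply: (@le_trans _ _ (expR (- u) * x ^+ p.+1)).
    by rewrite /x -expRM_natl -expRD ler_expR -natr1; nra.
  rewrite ler_wpM2l ?expR_ge0//; apply: lerXn2r; rewrite ?nnegrE; lra.
- rewrite ltr0_norm//; apply: (@le_trans _ _ (expR (a * u))); last first.
    rewrite ler_expR mulrN opprK ler_wnM2r//; first exact: ltW.
    by rewrite ge_min lexx.
  rewrite ler_pdivrMr ?exprn_gt0// ler_peMr ?expR_ge0// exprn_ege1//; lra.
Qed.

Lemma integrable_gker (a : R) m : 0 < a -> mu.-integrable setT (EFin \o gker a m).
Proof.
move=> a0; have [C [k [C0 k0 h]]] := gker_bound m a0.
apply: (@le_integrableT _ TR R mu (gker a m) (fun x => C * expR (- (k * `|x|)))).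
- exact: measurable_gker.
- by move=> u; rewrite ger0_norm ?gker_ge0.
- have := @integrableZl _ TR R mu setT measurableT C _ (integrable_expRN_norm k0).
  exact.
Qed.

Lemma integral_derivative_eq0 (F f : R -> R) (C k : R) : 0 < k ->
  (forall x : R, is_derive x (1 : R) F (f x)) -> continuous f ->
  mu.-integrable setT (EFin \o f) ->
  (forall x, `|F x| <= C * expR (- (k * `|x|))) ->
  (\int[mu]_x (f x)%:E = 0)%E.
Proof.
move=> k0 dF cf fi Fb.
(* The radius n + 1 keeps the interval nondegenerate for the fundamental theorem of calculus. *)
pose b (n : nat) (x : R) : bool := - n.+1%:R <= x <= n.+1%:R.
have mf : measurable_fun [set: R] f by exact: continuous_measurable_fun.
have mb (n : nat) : measurable_fun [set: R] (fun x => (b n x)%:R : R).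
  rewrite (_ : (fun x => _) = \1_(`[- n.+1%:R, n.+1%:R]%classic : set R)).
    exact: measurable_indic.
  by apply/funext => x; rewrite indicE mem_setE in_itv.
have cv : (\int[mu]_x ((b n x)%:R * f x)%:E)%E @[n --> \oo] --> (\int[mu]_x (f x)%:E)%E.
  apply: (@dominated_convergenceT _ TR R mu (fun n x => (b n x)%:R * f x) f (fun x => `|f x|)).
  - by move=> n; exact: (measurable_funM (mb n) mf).
  - exact: mf.
  - move=> x; apply: cvg_near_cst; near=> n.
    rewrite /b -ler_norml.
    have -> : `|x| <= n.+1%:R; last by rewrite mul1r.
    rewrite -natr1 (@le_trans _ _ n%:R) ?lerDl//.
    near: n; exact: nbhs_infty_ger.
  - by move=> n x; rewrite normrM ler_piMl//; case: (b n x); rewrite ?normr1 ?normr0.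
  - exact: (integrable_abse fi).
have E n : (\int[mu]_x ((b n x)%:R * f x)%:E = (F n.+1%:R - F (- n.+1%:R))%:E)%E.
  transitivity (\int[mu]_(x in `[(- n.+1%:R)%R, n.+1%:R%R]) (f x)%:E)%E.
    rewrite [RHS]integral_indicE; last exact: measurable_itv.
    by apply: eq_integral => x _; rewrite mem_setE in_itv/= -/(b n x) EFinM.
  have cF (x : R) : {for x, continuous F} by exact: (is_derive_continuous (dF x)).
  rewrite (@continuous_FTC2 _ f F).
  - by [].
  - by rewrite gtrN.
  - exact: continuous_subspaceT.
  - split.
    + by move=> x _; apply: ex_derive; exact: dF.
    + by apply: cvg_at_right_filter; exact: cF.
    + by apply: cvg_at_left_filter; exact: cF.
  - by move=> x _; rewrite derive1E; apply: derive_val; exact: dF.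
rewrite -(cvg_lim _ cv)//; apply: cvg_lim => //.
under eq_fun do rewrite E.
apply: cvg_EFin; first exact: nearW.
have C0 : 0 <= C by have := le_trans (normr_ge0 _) (Fb 0); rewrite pmulr_lge0 ?expR_gt0.
apply: norm_cvg0; apply: (@squeeze_cvgr _ _ _ _ (cst 0) (fun n => 2 * C / k * harmonic n)).
- near=> n; rewrite /cst normr_ge0/=.
  apply: (le_trans (ler_normB _ _)); apply: (le_trans (lerD (Fb _) (Fb _))).
  have n0 : 0 < n.+1%:R :> R by rewrite ltr0n.
  rewrite normrN ger0_norm ?ler0n//.
  have kn : 0 < k * n.+1%:R by rewrite mulr_gt0.
  have h : expR (- (k * n.+1%:R)) <= (k * n.+1%:R)^-1.
    rewrite expRN lef_pV2 ?posrE ?expR_gt0//.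
    apply: (le_trans _ (expR_ge1Dx _)); lra.
  have -> : 2 * C / k / n.+1%:R = 2 * C * (k * n.+1%:R)^-1.
    by field; rewrite !lt0r_neq0.
  move: (expR _) (_^-1) h => e i h; have := ler_wpM2l C0 h; lra.
- exact: cvg_cst.
- rewrite -[X in _ --> X](mulr0 (2 * C / k)); apply: cvgMr; exact: cvg_harmonic.
Unshelve. all: by end_near.
Qed.

End RealAnalysis.

(** * Products over coordinates and over pairs of coordinates *)

Section TupleIntegrals.
Context {R : realType}.
Notation mu := (@lebesgue_measure R).
Notation TR := (measurableTypeR R).
Notation leb := (@lebesgue_tuple R).

Lemma integral_prod_tuple n (g : R -> R) : measurable_fun [set: R] g ->
  (forall x, 0 <= g x) -> mu.-integrable setT (EFin \o g) ->
  (\int[leb n]_t (\prod_(i < n) g (tnth t i))%:E =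
   ((\int[mu]_x g x) ^+ n)%:E)%E.
Proof.
move=> mg g0 ig; elim: n => [|n IH].
  by rewrite integral_tuple0 big_ord0 expr0.
have m1 m : measurable_fun setT (fun t : m.-tuple TR => (\prod_(i < m) g (tnth t i))%:E).
  by apply/measurable_EFinP; exact: measurable_prod_tuple.
have p0 m (t : m.-tuple TR) : (0 <= (\prod_(i < m) g (tnth t i))%:E)%E.
  by rewrite lee_fin; apply: prodr_ge0 => i _; exact: g0.
rewrite ge0_integral_cons; [|exact: m1|exact: p0].
transitivity (\int[mu]_x ((g x)%:E * ((\int[mu]_x g x) ^+ n)%:E))%E.
  apply: eq_integral => x _; rewrite -IH -ge0_integralZl; last 4 first.
  - by [].
  - exact: m1.
  - by move=> t _; exact: p0.
  - by rewrite lee_fin; exact: g0.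
  apply: eq_integral => t _; rewrite big_ord_recl EFinM; congr (_ * _%:E)%E.
  by apply: eq_bigr => i _; rewrite tnthS.
rewrite ge0_integralZr; last 4 first.
- by [].
- exact/measurable_EFinP.
- by move=> x _; rewrite lee_fin; exact: g0.
- by rewrite lee_fin exprn_ge0//; apply: Rintegral_ge0 => x _; exact: g0.
rewrite exprS EFinM; congr (_ * _)%E; rewrite /Rintegral fineK//.
exact: integrable_fin_num.
Qed.

Lemma integrable_prod_tuple n (g : R -> R) : measurable_fun [set: R] g ->
  (forall x, 0 <= g x) -> mu.-integrable setT (EFin \o g) ->
  (leb n).-integrable setT (fun t => (\prod_(i < n) g (tnth t i))%:E).
Proof.
move=> mg g0 ig; apply/integrableP; split.
  by apply/measurable_EFinP; exact: measurable_prod_tuple.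
under eq_integral.
  move=> t _; rewrite abse_EFin ger0_norm; last by apply: prodr_ge0 => i _; exact: g0.
  over.
by rewrite integral_prod_tuple// ltry.
Qed.

(** Fubini's theorem with the head integrated first, for a function that may change sign;
    integrability is first carried over to the product measure. *)
Lemma integral_cons_eq0 n (f : n.+1.-tuple TR -> R) :
  (leb n.+1).-integrable setT (fun t => (f t)%:E) ->
  (forall t : n.-tuple TR, \int[mu]_x (f [tuple of x :: t])%:E = 0)%E ->
  (\int[leb n.+1]_t (f t)%:E = 0)%E.
Proof.
move=> fi f0.
have mf : measurable_fun setT f by case/integrableP : fi => /measurable_EFinP.
pose M : {measure set (n.+1.-tuple TR) -> \bar R} :=
  measure_function_pushforward__canonical__measure_function_Measure
    (mu \x leb n)%E (@measurable_cons_pair R n).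
have mfc : measurable_fun setT (fun z : TR * n.-tuple TR => f (cons_pair z)).
  by apply: measurableT_comp; [exact: mf|exact: measurable_cons_pair].
have fi' : (mu \x leb n)%E.-integrable setT (fun z => (f (cons_pair z))%:E).
  apply/integrableP; split; first exact/measurable_EFinP.
  case/integrableP : fi => _.
  rewrite (@eq_measure_integral _ _ _ _ M); last by [].
  rewrite /M ge0_integral_pushforward//; first exact: measurable_cons_pair.
  by apply: measurableT_comp => //; exact/measurable_EFinP.
rewrite (@eq_measure_integral _ _ _ _ M); last by [].
rewrite /M (@integral_pushforward _ _ _ _ _ _ (@measurable_cons_pair R n)); last 3 first.
- exact/measurable_EFinP.
- by rewrite preimage_setT; exact: fi'.
- by [].
rewrite preimage_setT -(integral21_prod_meas1 fi').
rewrite (eq_integral (fun=> 0%E)); first exact: integral0.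
by move=> t _; exact: f0.
Qed.

(** Exchanging the two variables gives I = - I. This disposes of the odd part of the integrand in
    Aomoto's argument. *)
Lemma integral_antisym n (i j : 'I_n) (f : n.-tuple TR -> R) :
  (leb n).-integrable setT (fun t => (f t)%:E) ->
  (forall t, f (swap_tuple i j t) = - f t) ->
  (\int[leb n]_t (f t)%:E = 0)%E.
Proof.
move=> fi fN; have mf : measurable_fun setT (fun t => (f t)%:E) by case/integrableP : fi.
have := integral_swap i j mf.
under eq_integral do rewrite fN EFinN.
rewrite integralN; last exact: integrable_add_def.
have : (\int[leb n]_t (f t)%:E)%E \is a fin_num by exact: integrable_fin_num.
case: (integral _ _ _) => // r _ [] h; congr EFin; lra.
Qed.

Lemma prod_pair_sqr n (h : 'I_n -> 'I_n -> R) : (forall i j, h i j = h j i) ->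
  (\prod_(i < n) \prod_(j < n | (i < j)%N) h i j) ^+ 2 =
  \prod_(i < n) \prod_(j < n | j != i) h i j.
Proof.
move=> hC; transitivity
  ((\prod_(i < n) \prod_(j < n | (i < j)%N) h i j) *
   (\prod_(i < n) \prod_(j < n | (j < i)%N) h i j)).
  rewrite expr2; congr (_ * _).
  rewrite (exchange_big_dep predT)//=; apply: eq_bigr => i _.
  by apply: eq_bigr => j _; rewrite hC.
rewrite -big_split; apply: eq_bigr => i _ /=.
rewrite [RHS](bigID (fun j : 'I_n => (i < j)%N))/=; congr (_ * _); apply: eq_bigl => j.
- by case: (ltngtP i j) => h1; rewrite ?andbT ?andbF //; apply/esym/eqP => ji; move: h1; rewrite ji ltnn.
- by rewrite -leqNgt ltn_neqAle.
Qed.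

(** A permutation does not respect the condition i < j. The square of the product runs over all i !=
    j and is invariant, and nonnegativity allows the square root to be taken. *)
Lemma prod_pair_perm n (h : 'I_n -> 'I_n -> R) (s : {perm 'I_n}) :
  (forall i j, h i j = h j i) -> (forall i j, 0 <= h i j) ->
  \prod_(i < n) \prod_(j < n | (i < j)%N) h (s i) (s j) =
  \prod_(i < n) \prod_(j < n | (i < j)%N) h i j.
Proof.
move=> hC h0.
have p0 (k : 'I_n -> 'I_n -> R) : (forall i j, 0 <= k i j) ->
    0 <= \prod_(i < n) \prod_(j < n | (i < j)%N) k i j.
  by move=> k0; apply: prodr_ge0 => i _; apply: prodr_ge0.
apply/eqP; rewrite -(@eqrXn2 _ 2)//; [|exact: p0|exact: p0].
rewrite !prod_pair_sqr//.
rewrite [X in _ == X](reindex_inj (@perm_inj _ s))/=; apply/eqP/eq_bigr => i _.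
rewrite [RHS](reindex_inj (@perm_inj _ s))/=; apply: eq_bigl => j.
by rewrite (inj_eq perm_inj).
Qed.

Definition pairprod n (H : R -> R -> R) (t : n.-tuple R) : R :=
  \prod_(i < n) \prod_(j < n | (i < j)%N) H (tnth t i) (tnth t j).

Lemma pairprod_cons n H x (t : n.-tuple R) :
  pairprod H [tuple of x :: t] = (\prod_(j < n) H x (tnth t j)) * pairprod H t.
Proof.
rewrite /pairprod big_ord_recl; congr (_ * _).
  rewrite big_mkcond big_ord_recl/= mul1r; apply: eq_bigr => j _.
  by rewrite tnthS.
apply: eq_bigr => i _; rewrite big_mkcond big_ord_recl/= mul1r -big_mkcond/=.
by apply: eq_big => j; rewrite ?tnthS.
Qed.

Lemma pairprod_perm n H (t t' : n.-tuple R) (s : {perm 'I_n}) :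
  (forall x y, H x y = H y x) -> (forall x y, 0 <= H x y) ->
  (forall i, tnth t' i = tnth t (s i)) -> pairprod H t' = pairprod H t.
Proof.
move=> HC H0 ts; rewrite /pairprod.
under eq_bigr do under eq_bigr do rewrite !ts.
exact: (prod_pair_perm (h := fun i j => H (tnth t i) (tnth t j))).
Qed.

Lemma pairprod_ge0 n H (t : n.-tuple R) : (forall x y, 0 <= H x y) -> 0 <= pairprod H t.
Proof. by move=> H0; apply: prodr_ge0 => i _; apply: prodr_ge0. Qed.

(** Each index lies in n - 1 pairs; as w >= 1, the exponent b (n - 1) may be raised to b n, which
    spares the subtraction. *)
Lemma pairprod_le n (H : R -> R -> R) (w : R -> R) (t : n.-tuple R) (b : nat) :
  (forall x y, 0 <= H x y) -> (forall x, 1 <= w x) ->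
  (forall x y, H x y <= (w x * w y) ^+ b) ->
  pairprod H t <= \prod_(i < n) w (tnth t i) ^+ (b * n).
Proof.
move=> H0 w1 Hw; have w0 x : 0 <= w x by exact: le_trans (w1 x).
elim: n t => [|n IH] t; first by rewrite /pairprod !big_ord0.
case/tupleP: t => x t; rewrite pairprod_cons [leRHS]big_ord_recl/=.
under [X in _ <= _ * X]eq_bigr do rewrite tnthS mulnS exprD.
rewrite big_split/= mulrA; apply: ler_pM.
- by apply: prodr_ge0.
- exact: pairprod_ge0.
- apply: (@le_trans _ _ (\prod_(j < n) (w x * w (tnth t j)) ^+ b)).
    by apply: ler_prod => j _; rewrite H0 Hw.
  under [leLHS]eq_bigr do rewrite exprMn.
  rewrite big_split/= ler_wpM2r//; first by apply: prodr_ge0 => j _; rewrite exprn_ge0.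
  rewrite prodr_const card_ord -exprM -[tnth _ _]/x.
  by rewrite ler_weXn2l// leq_mul2l leqnSn orbT.
- exact: IH.
Qed.

Lemma measurable_pairprod n (H : R -> R -> R) :
  measurable_fun [set: R * R] (fun z => H z.1 z.2) ->
  measurable_fun setT (fun t : n.-tuple TR => pairprod H t).
Proof.
move=> mH; rewrite (_ : [eta pairprod H] = fun t : n.-tuple TR =>
    \prod_(i < n) \prod_(j < n) if (i < j)%N then H (tnth t i) (tnth t j) else 1); last first.
  by apply/funext => t; rewrite /pairprod; under eq_bigr do rewrite big_mkcond.
apply: measurable_prod => i _; apply: measurable_prod => j _.
case: (i < j)%N; last exact: measurable_cst.
have mij : measurable_fun setT (fun t : n.-tuple TR => (tnth t i, tnth t j) : R * R).
  by apply: measurable_fun_pair; exact: measurable_tnth.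
exact: (measurableT_comp mH mij).
Qed.

Lemma measurable_tsum n (f : R -> R) : measurable_fun [set: R] f ->
  measurable_fun setT (fun t : n.-tuple TR => \sum_(i < n) f (tnth t i)).
Proof.
move=> mf; apply: measurable_sum => i; apply: (measurableT_comp mf).
exact: measurable_tnth.
Qed.

End TupleIntegrals.

(** * Derivatives of products through logarithmic derivatives *)

Section LogDerivative.
Context {R : realType}.

(** Each factor comes with its logarithmic derivative [q i] as data, so nothing is divided by a
    factor that might vanish. *)
Lemma is_derive_prod_log I (s : seq I) (p : I -> R -> R) (q : I -> R) (u : R) :
  (forall i, is_derive u (1 : R) (p i) (p i u * q i)) ->
  is_derive u (1 : R) (fun u => \prod_(i <- s) p i u)
    ((\prod_(i <- s) p i u) * \sum_(i <- s) q i).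
Proof.
move=> dp; elim: s => [|i s IH].
  rewrite !big_nil mulr0 (_ : (fun _ => _) = cst 1); first exact: is_derive_cst.
  by apply/funext => v; rewrite big_nil.
rewrite !big_cons (_ : (fun _ => _) = p i * (fun u => \prod_(j <- s) p j u)); last first.
  by apply/funext => v; rewrite big_cons.
apply: (is_derive_eq (is_deriveM (dp i) IH)); rewrite /GRing.scale/=; ring.
Qed.

(** The positive e keeps the radicand away from 0, where the square root is differentiable; this
    covers odd exponents. *)
Lemma is_derive_sqrtX (b : nat) (e x u : R) : 0 < e ->
  is_derive u (1 : R) (fun u => Num.sqrt ((expR u - x) ^+ 2 + e) ^+ b)
   (Num.sqrt ((expR u - x) ^+ 2 + e) ^+ b *
     (b%:R * (expR u * (expR u - x) / ((expR u - x) ^+ 2 + e)))).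
Proof.
move=> e0; have h0 (v : R) : 0 < (expR v - x) ^+ 2 + e by rewrite ltr_wpDl ?sqr_ge0.
have dh : is_derive u (1 : R) (fun u => (expR u - x) ^+ 2 + e) (2 * (expR u - x) * expR u).
  rewrite (_ : (fun _ => _) = (fun u => (expR u - x) * (expR u - x) + e)); last first.
    by apply/funext => v; rewrite expr2.
  by apply: is_derive_eq; rewrite /GRing.scale/=; ring.
have ds := @is_derive1_comp _ (Num.sqrt : R -> R) (fun u => (expR u - x) ^+ 2 + e) u _ _
   (is_derive1_sqrt (h0 u)) dh.
case: b => [|b].
  rewrite mul0r mulr0 (_ : (fun _ => _) = cst 1); first exact: is_derive_cst.
  by apply/funext => v; rewrite expr0.
rewrite (_ : (fun _ => _) = ((Num.sqrt : R -> R) \o (fun u => (expR u - x) ^+ 2 + e)) ^+ b.+1); last first.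
  by apply/funext => v; rewrite fctE.
apply: (is_derive_eq (is_deriveX b.+1 ds)); rewrite /GRing.scale/=.
have := sqr_sqrtr (ltW (h0 u)); have : 0 < Num.sqrt ((expR u - x) ^+ 2 + e) by rewrite sqrtr_gt0.
set r := Num.sqrt _ => r0 r2; rewrite -r2 exprS; field.
by rewrite gt_eqF.
Qed.

End LogDerivative.

(** * The Selberg weight in logarithmic variables and its integrable majorants *)

Section SelbergWeight.
Context {R : realType}.
Notation mu := (@lebesgue_measure R).
Notation TR := (measurableTypeR R).
Notation leb := (@lebesgue_tuple R).
Variable beta : nat.

(* |e^u - e^v| ^ beta, smoothed at u = v when e > 0. *)
Definition vdm_factor (e u v : R) : R := Num.sqrt ((expR u - expR v) ^+ 2 + e) ^+ beta.

Definition tsum n (t : n.-tuple R) : R := \sum_(i < n) tnth t i.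
Definition texp n (t : n.-tuple R) : R := \sum_(i < n) expR (tnth t i).

(* In the variables x_i = exp t_i, this is prod x_i ^ a e ^ (-x_i) times the
   (smoothed) power of the Vandermonde product, times
   cos (y ln (prod x_i) + th); the phase th gives access to both the real and
   the imaginary part of (prod x_i) ^ (a + i y). *)
Definition swt (e a y th : R) n (t : n.-tuple R) : R :=
  expR (a * tsum t) * expR (- texp t) * pairprod (vdm_factor e) t
  * cos (y * tsum t + th).

Definition gkerprod (a : R) m n (t : n.-tuple R) : R := \prod_(i < n) gker a m (tnth t i).
Definition wprod n (t : n.-tuple R) : R := \prod_(i < n) (1 + expR (tnth t i)).

Lemma vdm_factorC e u v : vdm_factor e u v = vdm_factor e v u.
Proof. by rewrite /vdm_factor -[expR u - _]opprB sqrrN. Qed.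

Lemma vdm_factor_ge0 e u v : 0 <= vdm_factor e u v.
Proof. by rewrite exprn_ge0// sqrtr_ge0. Qed.

Lemma vdm_factor_le (e u v : R) : 0 <= e <= 1 ->
  vdm_factor e u v <= ((1 + expR u) * (1 + expR v)) ^+ beta.
Proof.
move=> e01; have u0 := expR_gt0 u; have v0 := expR_gt0 v.
have p0 : 0 <= (1 + expR u) * (1 + expR v) by rewrite mulr_ge0//; lra.
apply: lerXn2r; rewrite ?nnegrE ?sqrtr_ge0//.
rewrite -[leRHS](ger0_norm p0) -sqrtr_sqr ler_wsqrtr//.
move: (expR u) (expR v) u0 v0 {p0} => x z x0 z0; nra.
Qed.

Lemma measurable_vdm_factor e :
  measurable_fun [set: R * R] (fun z => vdm_factor e z.1 z.2).
Proof.
apply: measurable_funX; apply: (measurableT_comp (f := @Num.sqrt R)).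
  by apply: continuous_measurable_fun; exact: sqrt_continuous.
apply: measurable_funD => //; apply: measurable_funX; apply: measurable_funB;
  by apply: measurableT_comp => //; exact: measurable_expR.
Qed.

Lemma measurable_swt e a y th n :
  measurable_fun setT (fun t : n.-tuple TR => swt e a y th t).
Proof.
have ms : measurable_fun setT (fun t : n.-tuple TR => tsum t).
  by apply: measurable_sum => i; exact: measurable_tnth.
have me : measurable_fun setT (fun t : n.-tuple TR => texp t).
  by apply: measurable_tsum; exact: measurable_expR.
apply: measurable_funM; first apply: measurable_funM; first apply: measurable_funM.
- by apply: (measurableT_comp (@measurable_expR R)); exact: measurable_funM.
- by apply: (measurableT_comp (@measurable_expR R)); exact: measurableT_comp.
- by apply: measurable_pairprod; exact: measurable_vdm_factor.
- apply: (measurableT_comp (f := @cos R)).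
    by apply: continuous_measurable_fun; exact: continuous_cos.
  by apply: measurable_funD => //; exact: measurable_funM.
Qed.

Lemma wprod_ge1 n (t : n.-tuple R) : 1 <= wprod t.
Proof.
rewrite /wprod; elim/big_rec: _ => // i x _ x1.
by have := expR_gt0 (tnth t i); nra.
Qed.

Lemma wprod_ge n (t : n.-tuple R) i : 1 + expR (tnth t i) <= wprod t.
Proof.
rewrite /wprod (bigD1 i)//=.
have : 1 <= \prod_(j < n | j != i) (1 + expR (tnth t j)).
  by elim/big_rec: _ => // j x _ x1; have := expR_gt0 (tnth t j); nra.
by have := expR_gt0 (tnth t i); nra.
Qed.

Lemma gkerprodS a m n (t : n.-tuple R) : gkerprod a m.+1 t = gkerprod a m t * wprod t.
Proof.
rewrite /gkerprod /wprod -big_split/=; apply: eq_bigr => i _.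
by rewrite /gker exprS; ring.
Qed.

Lemma gkerprod_ge0 a m n (t : n.-tuple R) : 0 <= gkerprod a m t.
Proof. by apply: prodr_ge0 => i _; exact: gker_ge0. Qed.

Lemma gkerprod_cons a m n x (t : n.-tuple R) :
  gkerprod a m [tuple of x :: t] = gker a m x * gkerprod a m t.
Proof.
by rewrite /gkerprod big_ord_recl; congr (_ * _); apply: eq_bigr => i _; rewrite tnthS.
Qed.

Lemma integrable_gkerprod a m n : 0 < a ->
  (leb n).-integrable setT (fun t => (gkerprod a m t)%:E).
Proof.
move=> a0; apply: integrable_prod_tuple.
- exact: measurable_gker.
- exact: gker_ge0.
- exact: integrable_gker.
Qed.

Lemma integrable_swt_bound a m n (f : n.-tuple TR -> R) (C : R) : 0 < a ->
  measurable_fun setT f -> (forall t, `|f t| <= C * gkerprod a m t) ->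
  (leb n).-integrable setT (fun t => (f t)%:E).
Proof.
move=> a0 mf fb; apply: (le_integrableT mf fb).
exact: (integrableZl measurableT C (integrable_gkerprod m n a0)).
Qed.

(** The cosine is at most 1 and each pair factor at most ((1 + x_i) (1 + x_j)) ^ beta. The majorant
    is a product over the coordinates and is uniform in e, y and th. *)
Lemma swt_bound e a y th n (t : n.-tuple R) : 0 <= e <= 1 ->
  `|swt e a y th t| <= gkerprod a (beta * n) t.
Proof.
move=> e01; have P0 := pairprod_ge0 t (vdm_factor_ge0 e).
rewrite normrM (ger0_norm (mulr_ge0 (mulr_ge0 (expR_ge0 _) (expR_ge0 _)) P0)).
apply: (@le_trans _ _ (expR (a * tsum t) * expR (- texp t) * pairprod (vdm_factor e) t)).
  by rewrite ler_piMr ?mulr_ge0 ?expR_ge0// ler_norml cos_le1 cos_geN1.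
have -> : gkerprod a (beta * n) t = expR (a * tsum t) * expR (- texp t) *
    \prod_(i < n) (1 + expR (tnth t i)) ^+ (beta * n).
  rewrite /gkerprod /gker /tsum /texp mulr_sumr -sumrN !expR_sum -!big_split/=.
  by apply: eq_bigr => i _; ring.
rewrite ler_wpM2l ?mulr_ge0 ?expR_ge0//.
apply: (pairprod_le (w := fun x => 1 + expR x)).
- exact: vdm_factor_ge0.
- by move=> x; rewrite lerDl expR_ge0.
- by move=> u v; exact: vdm_factor_le.
Qed.

Lemma tsum_perm n (t t' : n.-tuple R) (s : {perm 'I_n}) (f : R -> R) :
  (forall i, tnth t' i = tnth t (s i)) ->
  \sum_(i < n) f (tnth t' i) = \sum_(i < n) f (tnth t i).
Proof.
move=> ts; rewrite [RHS](reindex_inj (@perm_inj _ s))/=.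
by apply: eq_bigr => i _; rewrite ts.
Qed.

Lemma swt_swap e a y th n (i j : 'I_n) (t : n.-tuple R) :
  swt e a y th (swap_tuple i j t) = swt e a y th t.
Proof.
have ts k : tnth (swap_tuple i j t) k = tnth t (tperm i j k) by exact: tnth_swap.
rewrite /swt /tsum /texp (tsum_perm id ts) (tsum_perm expR ts).
by rewrite (pairprod_perm (@vdm_factorC e) (@vdm_factor_ge0 e) ts).
Qed.

Lemma swt_cons e a y th n u (t : n.-tuple R) :
  swt e a y th [tuple of u :: t] =
  expR (a * (u + tsum t)) * expR (- (expR u + texp t)) *
  ((\prod_(j <- index_enum 'I_n) vdm_factor e u (tnth t j)) * pairprod (vdm_factor e) t) *
  cos (y * (u + tsum t) + th).
Proof.
rewrite /swt pairprod_cons; congr (expR (a * _) * expR (- _) * _ * cos (y * _ + _));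
  by rewrite /tsum /texp big_ord_recl; congr (_ + _); apply: eq_bigr => i _; rewrite tnthS.
Qed.

End SelbergWeight.

Lemma cvg_expr (R : realType) T (F : set_system T) (FF : Filter F) (f : T -> R) (l : R) (b : nat) :
  f x @[x --> F] --> l -> f x ^+ b @[x --> F] --> l ^+ b.
Proof.
move=> fl; elim: b => [|b IH].
  by under eq_fun do rewrite expr0; rewrite expr0; exact: cvg_cst.
by under eq_fun do rewrite exprS; rewrite exprS; exact: cvgM.
Qed.

(** * Aomoto's integration by parts *)

Section Aomoto.
Context {R : realType}.
Notation mu := (@lebesgue_measure R).
Notation TR := (measurableTypeR R).
Notation leb := (@lebesgue_tuple R).
Variable beta : nat.
Hypothesis beta_gt0 : (0 < beta)%N.
Variables (a y th : R) (n k : nat).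
Hypotheses (a_gt0 : 0 < a) (k_le : (k <= n)%N).

Local Notation w := (swt beta).

(* x_1 ... x_k, where x_0 is the head of the tuple. *)
Definition tailmon (t : n.+1.-tuple R) : R :=
  \prod_(i < n | (i < k)%N) expR (tnth t (lift ord0 i)).

Let x0 (t : n.+1.-tuple R) : R := expR (tnth t ord0).
Let x (t : n.+1.-tuple R) (j : 'I_n) : R := expR (tnth t (lift ord0 j)).
Let q e t j : R := (x0 t - x t j) ^+ 2 + e.
(** The logarithmic derivative in u_0 of the smoothed pair factor (0, j), divided by beta. *)
Let Rj e j (t : n.+1.-tuple R) : R := x0 t * (x0 t - x t j) / q e t j.
(** What remains of [Rj], multiplied by [tailmon], after averaging with its image under the exchange
    of x_0 and x_j. For j < k the monomial contains x_j, and x_j x_0 (x_0 - x_j) is odd, so nothing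
    remains. Otherwise the monomial is unchanged and x_0 (x_0 - x_j) averages to (x_0 - x_j) ^ 2 /
    2. *)
Let Sj e (j : 'I_n) (t : n.+1.-tuple R) : R :=
  if (j < k)%N then 0 else (x0 t - x t j) ^+ 2 / q e t j / 2.
(** The derivative of [tailmon] times the smoothed weight in the head variable; [Dsym] is the same
    with each [Rj] replaced by its symmetrised form. *)
Let Dint e (t : n.+1.-tuple R) : R := tailmon t *
  ((a - x0 t) * w e a y th t - y * w e a y (th - pi / 2) t
   + beta%:R * (\sum_(j < n) Rj e j t) * w e a y th t).
Let Dsym e (t : n.+1.-tuple R) : R := tailmon t *
  ((a - x0 t) * w e a y th t - y * w e a y (th - pi / 2) t
   + beta%:R * (\sum_(j < n) Sj e j t) * w e a y th t).
(** The odd part discarded by the symmetrisation. *)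
Let Ej e j (t : n.+1.-tuple R) : R := tailmon t * (Rj e j t - Sj e j t) * w e a y th t.

Let x0_gt0 t : 0 < x0 t. Proof. exact: expR_gt0. Qed.
Let x_gt0 t j : 0 < x t j. Proof. exact: expR_gt0. Qed.

Let tailmon_ge0 t : 0 <= tailmon t.
Proof. by apply: prodr_ge0 => i _; exact: expR_ge0. Qed.

Let tailmon_le t : tailmon t <= wprod t.
Proof.
rewrite /wprod big_ord_recl /tailmon big_mkcond/= -[leLHS]mul1r.
apply: ler_pM => //.
- by apply: prodr_ge0 => i _; case: ifP => _ //; exact: expR_ge0.
- by rewrite lerDl expR_ge0.
- apply: ler_prod => i _; have := expR_gt0 (tnth t (lift ord0 i)).
  by case: ifP => _; lra.
Qed.

Let x0_le t : x0 t <= wprod t.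
Proof. by have := wprod_ge t ord0; rewrite -/(x0 t); lra. Qed.

Let dx_le t j : `|x0 t - x t j| <= wprod t.
Proof.
have := wprod_ge t ord0; have := wprod_ge t (lift ord0 j).
rewrite -/(x0 t) -/(x t j); have := x0_gt0 t; have := x_gt0 t j.
by rewrite ler_norml; lra.
Qed.

Let wprod0 (t : n.+1.-tuple R) : 0 <= wprod t.
Proof. exact: le_trans (wprod_ge1 t). Qed.

Let q_gt0 (e : R) t j : 0 < e -> 0 < q e t j.
Proof. by move=> e0; rewrite ltr_wpDl ?sqr_ge0. Qed.

Let Sj_bound (e : R) j t : 0 <= e -> `|Sj e j t| <= 1.
Proof.
move=> e0; rewrite /Sj; case: ifP => _; first by rewrite normr0.
have p0 : 0 <= (x0 t - x t j) ^+ 2 by exact: sqr_ge0.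
rewrite /q; move: (_ ^+ 2) p0 => z z0.
have [->|z1] := eqVneq z 0; first by rewrite !mul0r normr0.
have ze : 0 < z + e by rewrite ltr_pwDl// lt_neqAle eq_sym z1.
rewrite ger0_norm; last by rewrite !divr_ge0// ltW.
by rewrite ler_pdivrMr// mul1r ler_pdivrMr//; lra.
Qed.

Let Rj_bound (e : R) j t : 0 < e -> `|Rj e j t| <= e^-1 * wprod t ^+ 2.
Proof.
move=> e0; rewrite /Rj !normrM (ger0_norm (ltW (x0_gt0 t))) mulrC.
apply: ler_pM; rewrite ?mulr_ge0//; [exact: ltW| |].
- have q0 := q_gt0 t j e0; rewrite ger0_norm ?invr_ge0 ?(ltW q0)// lef_pV2 ?posrE//.
  by rewrite /q lerDr sqr_ge0.
- by rewrite expr2; apply: ler_pM => //; exact: ltW.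
Qed.

Let m := (beta * n.+1)%N.

Let wb (e th' : R) (t : n.+1.-tuple R) : 0 <= e <= 1 -> `|w e a y th' t| <= gkerprod a m t.
Proof. exact: swt_bound. Qed.

(* Everything below is dominated by wprod ^ 4 times the basic Gamma weight. *)
Let G (t : n.+1.-tuple R) : R := @gkerprod R a m.+4 n.+1 t.

Let GE t : G t = gkerprod a m t * wprod t ^+ 4.
Proof. by rewrite /G !gkerprodS; ring. Qed.

Let boundG (f : n.+1.-tuple R -> R) (C g : R) t : 0 <= C ->
  0 <= g -> g <= C * wprod t ^+ 4 -> `|f t| <= g * gkerprod a m t ->
  `|f t| <= C * G t.
Proof.
move=> C0 g0 gC fb; apply: (le_trans fb).
by rewrite GE mulrA mulrAC ler_wpM2r ?gkerprod_ge0.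
Qed.

Let wp_le i j t : (i <= j)%N -> @wprod R n.+1 t ^+ i <= wprod t ^+ j.
Proof. by move=> ij; rewrite ler_weXn2l ?wprod_ge1. Qed.

Let mtnth (i : 'I_n.+1) : measurable_fun setT (fun t : n.+1.-tuple TR => expR (tnth t i)).
Proof. by apply: measurableT_comp; [exact: measurable_expR|exact: measurable_tnth]. Qed.

Let mtailmon : measurable_fun setT (tailmon : n.+1.-tuple TR -> R).
Proof.
rewrite (_ : tailmon = fun t => \prod_(i < n) if (i < k)%N then expR (tnth t (lift ord0 i)) else 1).
  apply: measurable_prod => i _; case: (i < k)%N; last exact: measurable_cst.
  exact: mtnth.
by apply/funext => t; rewrite /tailmon big_mkcond.
Qed.

Let mw (e th' : R) : measurable_fun setT (fun t : n.+1.-tuple TR => w e a y th' t).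
Proof. exact: measurable_swt. Qed.

Let mdx j : measurable_fun setT (fun t : n.+1.-tuple TR => x0 t - x t j).
Proof. by apply: measurable_funB; exact: mtnth. Qed.

Let mqV (e : R) j : 0 < e -> measurable_fun setT (fun t : n.+1.-tuple TR => (q e t j)^-1).
Proof.
move=> e0; rewrite (_ : (fun t => _) = fun t => expR (- ln (q e t j))); last first.
  by apply/funext => t; rewrite expRN lnK// posrE q_gt0.
apply: measurableT_comp; first exact: measurable_expR.
apply: measurableT_comp => //; apply: measurableT_comp; first exact: measurable_ln.
by apply: measurable_funD => //; exact: measurable_funX.
Qed.

Let mRj (e : R) j : 0 < e -> measurable_fun setT (fun t : n.+1.-tuple TR => Rj e j t).
Proof.
move=> e0; apply: measurable_funM; last exact: mqV.
by apply: measurable_funM; [exact: mtnth|exact: mdx].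
Qed.

Let mSj (e : R) j : 0 < e -> measurable_fun setT (fun t : n.+1.-tuple TR => Sj e j t).
Proof.
move=> e0; rewrite /Sj; case: (j < k)%N; first exact: measurable_cst.
apply: measurable_funM => //; apply: measurable_funM; last exact: mqV.
by apply: measurable_funX; exact: mdx.
Qed.

Let Ej_bound (e : R) j t : 0 < e <= 1 -> `|Ej e j t| <= (e^-1 + 1) * G t.
Proof.
move=> /andP[e0 e1]; apply: (boundG (g := wprod t * (e^-1 * wprod t ^+ 2 + wprod t ^+ 2))).
- by rewrite addr_ge0// invr_ge0 ltW.
- by rewrite mulr_ge0// addr_ge0// mulr_ge0// ?invr_ge0 ?exprn_ge0// ltW.
- have -> : wprod t * (e^-1 * wprod t ^+ 2 + wprod t ^+ 2) = (e^-1 + 1) * wprod t ^+ 3 by ring.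
  by rewrite ler_wpM2l ?wp_le// addr_ge0// invr_ge0 ltW.
- rewrite /Ej normrM; apply: ler_pM; rewrite ?mulr_ge0//; last first.
    by apply: wb; rewrite (ltW e0).
  rewrite normrM; apply: ler_pM => //.
    by rewrite ger0_norm; [exact: tailmon_le|exact: tailmon_ge0].
  apply: (le_trans (ler_normB _ _)); apply: lerD; first exact: Rj_bound.
  apply: (le_trans (Sj_bound _ _ (ltW e0))).
  by rewrite -(expr0 (wprod t)) wp_le.
Qed.

Let iEj (e : R) j : 0 < e <= 1 ->
  (leb n.+1).-integrable setT (fun t => (beta%:R * Ej e j t)%:E).
Proof.
move=> e01; have /andP[e0 e1] := e01.
apply: (@integrable_swt_bound R a m.+4 n.+1 (fun t => beta%:R * Ej e j t) (beta%:R * (e^-1 + 1))) => //.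
  apply: measurable_funM => //; apply: measurable_funM; last exact: mw.
  by apply: measurable_funM; [exact: mtailmon|apply: measurable_funB; [exact: mRj|exact: mSj]].
by move=> t; rewrite normrM ger0_norm ?ler0n// -mulrA ler_wpM2l ?ler0n// Ej_bound.
Qed.

Let Ej0 (e : R) j : 0 < e <= 1 -> (\int[leb n.+1]_t (beta%:R * Ej e j t)%:E = 0)%E.
Proof.
move=> e01; have e0 : 0 < e by case/andP : e01.
apply: (@integral_antisym _ _ ord0 (lift ord0 j)); first exact: iEj.
move=> t; rewrite -mulrN; congr (_ * _); rewrite /Ej swt_swap -mulNr; congr (_ * _).
set t' := swap_tuple _ _ t.
have E0 : x0 t' = x t j by rewrite /x0 /x tnth_swap tpermL.
have E1 : x t' j = x0 t by rewrite /x0 /x tnth_swap tpermR.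
have Eq : q e t' j = q e t j by rewrite /q E0 E1 -[x t j - _]opprB sqrrN.
have q0 := q_gt0 t j e0.
have Ei i : i != j -> tnth t' (lift ord0 i) = tnth t (lift ord0 i).
  by move=> ij; rewrite tnth_swap tpermD// (inj_eq lift_inj) eq_sym.
rewrite /Rj /Sj Eq E0 E1; have [jk|kj] := ltnP j k.
  have tE s : tailmon s = x s j * \prod_(i < n | (i < k)%N && (i != j)) expR (tnth s (lift ord0 i)).
    by rewrite /tailmon (bigD1 j).
  rewrite !tE E1 (eq_bigr (fun i => expR (tnth t (lift ord0 i)))); last first.
    by move=> i /andP[_ /Ei ->].
  by field; rewrite gt_eqF.
have -> : tailmon t' = tailmon t.
  apply: eq_bigr => i ik; rewrite Ei//; apply: contraTneq ik => ->.
  by rewrite -leqNgt.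
by field; rewrite gt_eqF.
Qed.

(** The constant does not involve e, so this is the majorant for the passage to the limit. *)
Let iDsym_bound (e : R) t : 0 <= e <= 1 ->
  `|Dsym e t| <= (a + 1 + `|y| + beta%:R * n%:R) * G t.
Proof.
move=> e01; have e0 : 0 <= e by case/andP : e01.
apply: (boundG (g := wprod t * ((a + wprod t) + `|y| + beta%:R * n%:R))).
- by rewrite !addr_ge0// ltW.
- by rewrite mulr_ge0// !addr_ge0// ltW.
- have W1 := wprod_ge1 t.
  apply: (@le_trans _ _ ((a + 1 + `|y| + beta%:R * n%:R) * wprod t ^+ 2)).
    have := normr_ge0 y; have : 0 <= beta%:R * n%:R :> R by rewrite mulr_ge0.
    move: (wprod t) (beta%:R * n%:R) W1 `|y| => W b W1 Y b0 Y0.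
    have aW : 0 <= W * (a * (W - 1)) by rewrite !mulr_ge0 ?subr_ge0//; [lra|exact: ltW].
    have YW : 0 <= W * (Y * (W - 1)) by rewrite !mulr_ge0 ?subr_ge0//; lra.
    have bW : 0 <= W * (b * (W - 1)) by rewrite !mulr_ge0 ?subr_ge0//; lra.
    by rewrite expr2; lra.
  by rewrite ler_wpM2l ?wp_le// !addr_ge0// ltW.
- rewrite /Dsym normrM -[leRHS]mulrA; apply: ler_pM => //.
    by rewrite ger0_norm; [exact: tailmon_le|exact: tailmon_ge0].
  have sb : `|\sum_(j < n) Sj e j t| <= n%:R.
    apply: (le_trans (ler_norm_sum _ _ _)).
    apply: (@le_trans _ _ (\sum_(j < n) 1)); last by rewrite sumr_const card_ord.
    by apply: ler_sum => j _; exact: Sj_bound.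
  have K0 := gkerprod_ge0 a m t; move: (wb th t e01) (wb (th - pi / 2) t e01).
  move: (w e a y th t) (w e a y (th - pi / 2) t) (gkerprod a m t) K0 => w1 w2 K K0 w1K w2K.
  move: (\sum_(j < n) _) sb => s sb.
  apply: (le_trans (ler_normD _ _)); rewrite [leRHS]mulrDl; apply: lerD.
    apply: (le_trans (ler_normB _ _)); rewrite !normrM [leRHS]mulrDl; apply: lerD.
      apply: ler_pM => //; apply: (le_trans (ler_normB _ _)).
      apply: lerD; first by rewrite ger0_norm// ltW.
      by rewrite ger0_norm ?(ltW (x0_gt0 t))// x0_le.
    by apply: ler_pM.
  rewrite normrM; apply: ler_pM => //.
  by rewrite normrM (ger0_norm (ler0n _ _)) ler_wpM2l.
Qed.

Let mDsym (e : R) : 0 < e -> measurable_fun setT (fun t : n.+1.-tuple TR => Dsym e t).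
Proof.
move=> e0; apply: measurable_funM; first exact: mtailmon.
apply: measurable_funD; first apply: measurable_funB.
- by apply: measurable_funM; [apply: measurable_funB => //; exact: mtnth|exact: mw].
- by apply: measurable_funM => //; exact: mw.
- apply: measurable_funM; last exact: mw.
  by apply: measurable_funM => //; apply: measurable_sum => j; exact: mSj.
Qed.

Let iDsym (e : R) : 0 < e <= 1 -> (leb n.+1).-integrable setT (fun t => (Dsym e t)%:E).
Proof.
move=> /andP[e0 e1]; apply: (integrable_swt_bound (m := m.+4) a_gt0); first exact: mDsym.
by move=> t; apply: iDsym_bound; rewrite (ltW e0).
Qed.

Let DintE e t : Dint e t = Dsym e t + \sum_(j < n) beta%:R * Ej e j t.
Proof.
rewrite -mulr_sumr /Dint /Dsym /Ej.
have -> : \sum_(j < n) tailmon t * (Rj e j t - Sj e j t) * w e a y th t =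
   tailmon t * ((\sum_(j < n) Rj e j t) - \sum_(j < n) Sj e j t) * w e a y th t.
  by rewrite -sumrB mulr_sumr mulr_suml.
ring.
Qed.

(** For a fixed tail the integrand is the derivative of a function of the head that decays
    exponentially, so every inner integral vanishes. *)
Let Dint0 (e : R) : 0 < e <= 1 -> (\int[leb n.+1]_t (Dint e t)%:E = 0)%E.
Proof.
move=> e01; have /andP[e0 e1] := e01.
have iD : (leb n.+1).-integrable setT (fun t => (Dint e t)%:E).
  under eq_fun do rewrite DintE EFinD -sumEFin.
  apply: integrableD => //; first exact: iDsym.
  by apply: (integrable_sum measurableT) => j _; exact: iEj.
apply: integral_cons_eq0 => // t.
pose M := \prod_(i < n | (i < k)%N) expR (tnth t i).
have ME u : tailmon [tuple of u :: t] = M.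
  by rewrite /tailmon; apply: eq_bigr => i _; rewrite tnthS.
pose F u := M * w e a y th [tuple of u :: t].
have [C [d [C0 d0 gb]]] := gker_bound m.+4 a_gt0.
(* Differentiating the cosine gives - y times a sine, that is, - y times the cosine with phase th' -
   pi / 2. *)
have dw th' (u : R) : is_derive u (1 : R) (fun u => w e a y th' [tuple of u :: t])
    ((a - expR u) * w e a y th' [tuple of u :: t] - y * w e a y (th' - pi / 2) [tuple of u :: t]
     + beta%:R * (\sum_(j < n) Rj e j [tuple of u :: t]) * w e a y th' [tuple of u :: t]).
  have -> : (fun u => w e a y th' [tuple of u :: t]) =
     (fun u => expR (a * (u + tsum t)) * expR (- (expR u + texp t)) *
     pairprod (vdm_factor beta e) t) *
     ((fun u => \prod_(j <- index_enum 'I_n) vdm_factor beta e u (tnth t j)) *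
     (fun u => cos (y * (u + tsum t) + th'))).
    by apply/funext => v; rewrite swt_cons !fctE; ring.
  have dP := is_derive_prod_log (index_enum 'I_n) (fun j => is_derive_sqrtX beta (expR (tnth t j)) u e0).
  have dC : is_derive u (1 : R) (fun u => cos (y * (u + tsum t) + th'))
      (- y * sin (y * (u + tsum t) + th')).
    by apply: is_derive_eq; rewrite /GRing.scale/=; ring.
  have dA : is_derive u (1 : R) (fun u => expR (a * (u + tsum t)) * expR (- (expR u + texp t)) *
     pairprod (vdm_factor beta e) t) (expR (a * (u + tsum t)) * expR (- (expR u + texp t)) *
     pairprod (vdm_factor beta e) t * (a - expR u)).
    by apply: is_derive_eq; rewrite /GRing.scale/=; ring.
  apply: (is_derive_eq (is_deriveM dA (is_deriveM dP dC))).
  rewrite /GRing.scale/= !swt_cons !fctE.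
  have -> : cos (y * (u + tsum t) + (th' - pi / 2)) = sin (y * (u + tsum t) + th').
    by rewrite addrA cosB cos_pihalf sin_pihalf; ring.
  have -> : \sum_(j < n) Rj e j [tuple of u :: t] =
     \sum_(j < n) expR u * (expR u - expR (tnth t j)) / ((expR u - expR (tnth t j)) ^+ 2 + e).
    by apply: eq_bigr => j _; rewrite /Rj /q /x0 /x tnthS.
  rewrite -mulr_sumr /vdm_factor; ring.
have DE u : Dint e [tuple of u :: t] = M * ((a - expR u) * w e a y th [tuple of u :: t]
    - y * w e a y (th - pi / 2) [tuple of u :: t]
    + beta%:R * (\sum_(j < n) expR u * (expR u - expR (tnth t j)) / ((expR u - expR (tnth t j)) ^+ 2 + e))
      * w e a y th [tuple of u :: t]).
  rewrite /Dint ME; congr (_ * (_ + _ * _ * _)).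
  by apply: eq_bigr => j _; rewrite /Rj /q /x0 /x tnthS.
have dF (u : R) : is_derive u (1 : R) F (Dint e [tuple of u :: t]).
  have -> : F = cst M * (fun u => w e a y th [tuple of u :: t]) by apply/funext.
  apply: (is_derive_eq (is_deriveM (is_derive_cst M u (1 : R)) (dw th u))).
  by rewrite scaler0 addr0 /Dint ME.
have cD : continuous (fun u => Dint e [tuple of u :: t]).
  have cw th' : continuous (fun u => w e a y th' [tuple of u :: t]).
    by move=> u; exact: (is_derive_continuous (dw th' u)).
  move=> u; under eq_fun do rewrite DE.
  apply: cvgM; first exact: cvg_cst.
  apply: cvgD; first apply: cvgB.
  - apply: cvgM; last exact: cw.
    by apply: cvgB; [exact: cvg_cst|exact: continuous_expR].
  - by apply: cvgM; [exact: cvg_cst|exact: cw].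
  - apply: cvgM; last exact: cw.
    apply: cvgM; first exact: cvg_cst.
    apply: (cvg_big (@add_continuous R)) => j _.
    have cj : expR v - expR (tnth t j) @[v --> u] --> expR u - expR (tnth t j).
      by apply: cvgB; [exact: continuous_expR|exact: cvg_cst].
    apply: cvgM; first by apply: cvgM => //; exact: continuous_expR.
    apply: cvgV; first by rewrite gt_eqF// ltr_wpDl ?sqr_ge0.
    apply: cvgD; last exact: cvg_cst.
    exact: cvg_expr.
have Gt0 := gkerprod_ge0 a m.+4 t.
apply: (@integral_derivative_eq0 R F (fun u => Dint e [tuple of u :: t]) (C * gkerprod a m.+4 t) d) => //.
- pose B := (a + 1 + `|y| + beta%:R * n%:R) + \sum_(j < n) beta%:R * (e^-1 + 1).
  have mD : measurable_fun [set: R] (fun u => Dint e [tuple of u :: t]).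
    exact: continuous_measurable_fun.
  apply: (@le_integrableT _ TR R mu _ (fun u => B * gkerprod a m.+4 t * gker a m.+4 u)).
  + exact: mD.
  + move=> u; have -> : B * gkerprod a m.+4 t * gker a m.+4 u = B * G [tuple of u :: t].
      by rewrite /G gkerprod_cons; ring.
    rewrite DintE /B mulrDl; apply: (le_trans (ler_normD _ _)); apply: lerD.
      by apply: iDsym_bound; rewrite (ltW e0).
    apply: (le_trans (ler_norm_sum _ _ _)); rewrite mulr_suml; apply: ler_sum => j _.
    by rewrite normrM ger0_norm ?ler0n// -mulrA ler_wpM2l ?ler0n// Ej_bound.
  + exact: (@integrableZl _ TR R mu setT measurableT _ _ (integrable_gker m.+4 a_gt0)).
- move=> u; apply: (@le_trans _ _ (G [tuple of u :: t])).
    rewrite /F normrM GE; apply: (@le_trans _ _ (wprod [tuple of u :: t] * gkerprod a m [tuple of u :: t])).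
      apply: ler_pM => //; last by apply: wb; rewrite (ltW e0).
      by rewrite -(ME u) ger0_norm; [exact: tailmon_le|exact: tailmon_ge0].
    by rewrite mulrC ler_wpM2l ?gkerprod_ge0// -{1}(expr1 (wprod _)) wp_le.
  by rewrite /G gkerprod_cons [leRHS]mulrAC ler_wpM2r.
Qed.

Let Dsym0 (e : R) : 0 < e <= 1 -> (\int[leb n.+1]_t (Dsym e t)%:E = 0)%E.
Proof.
move=> e01; have := Dint0 e01.
have iS : (leb n.+1).-integrable setT (fun t => (\sum_(j < n) (beta%:R * Ej e j t)%:E)%E).
  by apply: (integrable_sum measurableT) => j _; exact: iEj.
under eq_integral do rewrite DintE EFinD -sumEFin.
rewrite integralD//; last exact: iDsym.
rewrite integral_sum//; last by move=> j; exact: iEj.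
rewrite big1; last by move=> j _; exact: Ej0.
by rewrite adde0.
Qed.

(* As e tends to 0, each of the n - k symmetrised terms tends to 1 / 2 times
   the weight, also on the diagonal, where the weight vanishes. *)
Let Dsym_cvg t : Dsym (harmonic p) t @[p --> \oo] --> tailmon t *
  ((a - x0 t) * w 0 a y th t - y * w 0 a y (th - pi / 2) t
   + beta%:R * ((n - k)%:R / 2) * w 0 a y th t).
Proof.
have cw th' : w (harmonic p) a y th' t @[p --> \oo] --> w 0 a y th' t.
  apply: cvgM; last exact: cvg_cst.
  apply: cvgM; first exact: cvg_cst.
  rewrite /pairprod; apply: (cvg_big (@mul_continuous R)) => i _.
  apply: (cvg_big (@mul_continuous R)) => j _; rewrite /vdm_factor.
  apply: cvg_expr.
  apply: continuous_cvg; first exact: sqrt_continuous.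
  by apply: cvgD; [exact: cvg_cst|exact: cvg_harmonic].
apply: cvgM; first exact: cvg_cst.
apply: cvgD; first by apply: cvgB; (apply: cvgM; [exact: cvg_cst|exact: cw]).
(* The terms with j < k are zero; each of the n - k others contributes 1 / 2. *)
have -> : (n - k)%:R / 2 = \sum_(j < n) (if (j < k)%N then 0 else 1 / 2) :> R.
  rewrite (eq_bigr (fun j : 'I_n => if (k <= j)%N then 1 / 2 else 0)); last first.
    by move=> j _; rewrite ltnNge; case: (k <= j)%N.
  rewrite -big_mkcond/= -(big_geq_mkord k n predT (fun=> 1 / 2)) sumr_const_nat.
  by rewrite mul1r -[RHS]mulr_natl.
under eq_fun do rewrite mulr_sumr mulr_suml.
rewrite mulr_sumr mulr_suml; apply: (cvg_big (@add_continuous R)) => j _.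
rewrite /Sj; case: ifP => jk; first by under eq_fun do rewrite mulr0 mul0r; rewrite mulr0 mul0r; exact: cvg_cst.
have [xx|xx] := eqVneq (x0 t) (x t j).
  have -> : w 0 a y th t = 0.
    rewrite /swt /pairprod (bigD1 ord0)//= (bigD1 (lift ord0 j))//=.
    rewrite {1}/vdm_factor -/(x0 t) -/(x t j) xx subrr expr0n addr0 sqrtr0 expr0n.
    by rewrite (gtn_eqF beta_gt0) !mul0r mulr0 mul0r.
  by under eq_fun do rewrite /q xx subrr expr0n !mul0r mulr0 mul0r; rewrite mulr0; exact: cvg_cst.
apply: cvgM; last exact: cw.
apply: cvgM; first exact: cvg_cst.
apply: cvgM; last exact: cvg_cst.
have z0 : (x0 t - x t j) ^+ 2 != 0 by rewrite sqrf_eq0 subr_eq0.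
rewrite -[X in _ --> X](divff z0) /q; apply: cvgM; first exact: cvg_cst.
apply: cvgV => //; rewrite -[X in _ --> X]addr0; apply: cvgD; first exact: cvg_cst.
exact: cvg_harmonic.
Qed.

(* Integration by parts in the head variable, first for the smoothed weight,
   which is differentiable also when beta = 1. *)
Lemma aomoto_step :
  (\int[leb n.+1]_t (tailmon t *
  ((a - expR (tnth t ord0)) * w 0 a y th t - y * w 0 a y (th - pi / 2) t
   + beta%:R * ((n - k)%:R / 2) * w 0 a y th t))%:E = 0)%E.
Proof.
have h p : 0 < (harmonic p : R) <= 1.
  by rewrite /harmonic/= invr_gt0 ltr0n/= invf_le1 ?ler1n.
have H : (\int[leb n.+1]_t (Dsym (harmonic p) t)%:E)%E @[p --> \oo] -->
  (\int[leb n.+1]_t (tailmon t *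
  ((a - expR (tnth t ord0)) * w 0 a y th t - y * w 0 a y (th - pi / 2) t
   + beta%:R * ((n - k)%:R / 2) * w 0 a y th t))%:E)%E.
  apply: (@dominated_convergenceT _ _ R (leb n.+1) (fun p t => Dsym (harmonic p) t) _
    (fun t => (a + 1 + `|y| + beta%:R * n%:R) * G t)).
  - by move=> p; apply: mDsym; case/andP : (h p).
  - apply: measurable_funM; first exact: mtailmon.
    apply: measurable_funD; first apply: measurable_funB.
    + by apply: measurable_funM; [apply: measurable_funB => //; exact: mtnth|exact: mw].
    + by apply: measurable_funM => //; exact: mw.
    + by apply: measurable_funM; [exact: measurable_cst|exact: mw].
  - exact: Dsym_cvg.
  - by move=> p t; apply: iDsym_bound; case/andP : (h p) => /ltW -> ->.
  - exact: (integrableZl measurableT _ (integrable_gkerprod m.+4 n.+1 a_gt0)).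
have E0 : (fun p => (\int[leb n.+1]_t (Dsym (harmonic p) t)%:E)%E) = cst 0%E.
  by apply/funext => p; exact: Dsym0.
by rewrite E0 in H; rewrite -(cvg_lim (@ereal_hausdorff R) H) lim_cst.
Qed.

End Aomoto.

(** * Elementary estimates for the cosine *)

Section CosineBounds.
Context {R : realType}.

Lemma dist_cos_le (u v : R) : `|cos u - cos v| <= `|u - v|.
Proof.
wlog uv : u v / u <= v => [h|].
  by have [/h//|/ltW/h] := leP u v; rewrite distrC [leRHS]distrC.
have [x _ e] := @MVT_segment R (@cos R) (fun x => - sin x) u v uv
   (fun x _ => is_derive_cos x) (continuous_subspaceT (@continuous_cos R)).
rewrite distrC e normrM normrN distrC ler_piMl//.
by rewrite ler_norml sin_le1 sin_geN1.
Qed.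

(** Let E be the absolute value of e ^ l - 1. As e ^ (a l) lies between 1 and e ^ l, replacing it by
    1 costs at most E. The cosine moves by at most |y l| <= 2 |y| E if l >= -1, and otherwise by at
    most 2 <= 4 E. *)
Lemma dist_expR_cos_le (a y th l : R) : 0 < a <= 1 ->
  `|expR (a * l) * cos (y * l + th) - cos th| <= (2 * `|y| + 5) * `|expR l - 1|.
Proof.
move=> /andP[a0 a1]; pose E := `|expR l - 1|.
have h1 : `|expR (a * l) - 1| <= E.
  rewrite /E; have [l0|l0] := leP 0 l.
    have al : expR (a * l) <= expR l by rewrite ler_expR ler_piMl.
    have al1 : 1 <= expR (a * l) by rewrite -expR0 ler_expR mulr_ge0// ltW.
    by rewrite !ger0_norm; lra.
  have al : expR l <= expR (a * l) by rewrite ler_expR; nra.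
  have al1 : expR (a * l) <= 1 by rewrite expR_le1 mulr_ge0_le0 ?ltW.
  by rewrite !ler0_norm; lra.
have h2 : `|cos (y * l + th) - cos th| <= (2 * `|y| + 4) * E.
  have y0 := normr_ge0 y; have E0 : 0 <= E by exact: normr_ge0.
  have [l1|l1] := leP (-1) l.
    apply: (le_trans (dist_cos_le _ _)); rewrite addrK normrM.
    have lE : `|l| <= 2 * E.
      have e1 := expR_ge1Dx l; have e2 := expR_ge1Dx (- l); have e3 := expR_gt0 l.
      have e4 := expRxMexpNx_1 l; rewrite /E.
      have [l0|l0] := leP 0 l.
        by rewrite !ger0_norm//; lra.
      rewrite ltr0_norm// ler0_norm ?subr_le0 ?expR_le1 ?(ltW l0)//.
      have : expR l * (1 - l) <= 1.
        by rewrite -e4 ler_wpM2l ?expR_ge0//; lra.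
      move: (expR l) e1 e3 => p e1 e3; nra.
    have := ler_wpM2l y0 lE; nra.
  have : `|cos (y * l + th) - cos th| <= 2.
    apply: (le_trans (ler_normB _ _)).
    have c1 (x : R) : `|cos x| <= 1 by rewrite ler_norml cos_le1 cos_geN1.
    by have := c1 (y * l + th); have := c1 th; lra.
  have : 1 / 2 <= E.
    have e2 := expR_ge1Dx (- l); have e3 := expR_gt0 l; have e4 := expRxMexpNx_1 l.
    rewrite /E ler0_norm; last by rewrite subr_le0 expR_le1; lra.
    have : expR l * 2 <= 1 by rewrite -e4 ler_wpM2l ?expR_ge0//; lra.
    lra.
  nra.
have -> : expR (a * l) * cos (y * l + th) - cos th =
   (expR (a * l) - 1) * cos (y * l + th) + (cos (y * l + th) - cos th) by ring.
apply: (le_trans (ler_normD _ _)); rewrite normrM.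
have c1 : `|cos (y * l + th)| <= 1 by rewrite ler_norml cos_le1 cos_geN1.
have : `|expR (a * l) - 1| * `|cos (y * l + th)| <= E * 1 by apply: ler_pM.
rewrite -/E; lra.
Qed.

End CosineBounds.

(** * Exponential moments of a positive weight and their asymptotics *)

Section Moments.
Context d (T : measurableType d) (R : realType) (mm : {measure set T -> \bar R}).
Variables (s W : T -> R).
Hypotheses (ms : measurable_fun setT s) (mW : measurable_fun setT W).
Hypothesis W0 : forall x, 0 <= W x.
Hypothesis iW : forall a : R, 0 < a -> mm.-integrable setT (fun x => (expR (a * s x) * W x)%:E).

(** At th = 0 and th = - pi / 2 these are the real and imaginary parts of the integral of e ^ ((a +
    i y) s) W; every other phase is a combination of the two. *)
Definition mom (a y th : R) : R := \int[mm]_x (expR (a * s x) * W x * cos (y * s x + th)).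

Definition rmom (a : R) : R := \int[mm]_x (expR (a * s x) * W x).

Lemma measurable_exp_mom a : measurable_fun setT (fun x => expR (a * s x) * W x).
Proof.
apply: measurable_funM => //; apply: (measurableT_comp (@measurable_expR R)).
exact: measurable_funM.
Qed.

Lemma integrable_mom a y th : 0 < a ->
  mm.-integrable setT (fun x => (expR (a * s x) * W x * cos (y * s x + th))%:E).
Proof.
move=> a0; apply: (le_integrableT _ _ (iW a0)).
  apply: measurable_funM; first exact: measurable_exp_mom.
  apply: (measurableT_comp (f := @cos R)).
    by apply: continuous_measurable_fun; exact: continuous_cos.
  by apply: measurable_funD => //; exact: measurable_funM.
move=> x; rewrite normrM ger0_norm ?mulr_ge0 ?expR_ge0//.
by rewrite ler_piMr ?mulr_ge0 ?expR_ge0// ler_norml cos_le1 cos_geN1.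
Qed.

Lemma mom_phase a y th : 0 < a ->
  mom a y th = cos th * mom a y 0 - sin th * mom a y (- pi / 2).
Proof.
move=> a0; rewrite /mom.
rewrite -(@RintegralZl _ T R mm setT _ (cos th) measurableT (integrable_mom y 0 a0)).
rewrite -(@RintegralZl _ T R mm setT _ (sin th) measurableT (integrable_mom y (- pi / 2) a0)).
rewrite -RintegralB//; last 2 first.
- exact: (integrableZl measurableT (cos th) (integrable_mom y 0 a0)).
- exact: (integrableZl measurableT (sin th) (integrable_mom y (- pi / 2) a0)).
apply: eq_Rintegral => x _.
have -> : cos (y * s x + - pi / 2) = sin (y * s x).
  by rewrite mulNr cosB cos_pihalf sin_pihalf mulr0 mulr1 add0r.
by rewrite addr0 cosD; ring.
Qed.

(* For large n the weight e ^ (n s) concentrates where e ^ s is close to e ^ c;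
   the right-hand side is an AM-GM form of Chebyshev's inequality. *)
Lemma mom_bound (a y th n c dl : R) : 0 < a <= 1 -> 0 < n -> 0 < dl ->
  `|expR (- (a * c)) * mom (a + n) y (th - y * c) - cos th * rmom n| <=
  (2 * `|y| + 5) / 2 * (dl * rmom n +
   (expR (- (2 * c)) * rmom (n + 2) - 2 * expR (- c) * rmom (n + 1) + rmom n) / dl).
Proof.
move=> a01 n0 d0; have a0 : 0 < a by case/andP : a01.
have an0 : 0 < a + n by rewrite addr_gt0.
have n1 : 0 < n + 1 by rewrite addr_gt0.
have n2 : 0 < n + 2 by rewrite addr_gt0.
pose C := (2 * `|y| + 5) / 2; have C0 : 0 <= C by rewrite divr_ge0// addr_ge0// mulr_ge0.
(* The coefficients of C (dl + (e ^ (s - c) - 1) ^ 2 / dl), expanded in powers of e ^ s. *)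
pose k0 := C * (dl + dl^-1); pose k1 := - (C / dl * 2 * expR (- c)); pose k2 := C / dl * expR (- (2 * c)).
pose g x := k2 * (expR ((n + 2) * s x) * W x) + (k1 * (expR ((n + 1) * s x) * W x) + k0 * (expR (n * s x) * W x)).
have i0 := integrableZl measurableT k0 (iW n0).
have i1 := integrableZl measurableT k1 (iW n1).
have i2 := integrableZl measurableT k2 (iW n2).
have i01 : mm.-integrable setT (fun x => (k1 * (expR ((n + 1) * s x) * W x) + k0 * (expR (n * s x) * W x))%:E).
  exact: (integrableD measurableT i1 i0).
have ig : mm.-integrable setT (fun x => (g x)%:E) by exact: (integrableD measurableT i2 i01).
have -> : (2 * `|y| + 5) / 2 * (dl * rmom n +
   (expR (- (2 * c)) * rmom (n + 2) - 2 * expR (- c) * rmom (n + 1) + rmom n) / dl) = \int[mm]_x g x.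
  rewrite /g RintegralD// RintegralD// !RintegralZl//; try exact: iW.
  rewrite -!/(rmom _) -/C /k0 /k1 /k2.
  move: (C) (rmom n) (rmom (n + 1)) (rmom (n + 2)) (expR (- c)) (expR (- (2 * c))) => A f0 f1 f2 e1 e2.
  by field; rewrite gt_eqF.
have im := integrableZl measurableT (expR (- (a * c))) (integrable_mom y (th - y * c) an0).
have ic := integrableZl measurableT (cos th) (iW n0).
rewrite /mom /rmom -RintegralZl//; last exact: integrable_mom.
rewrite -RintegralZl//; last exact: iW.
rewrite -RintegralB//.
have ib := integrableB measurableT im ic.
apply: (le_trans (le_normr_Rintegral measurableT ib)).
apply: le_Rintegral => //; first exact: (integrable_abse ib).
move=> x _; pose l := s x - c.
have -> : expR (- (a * c)) * (expR ((a + n) * s x) * W x * cos (y * s x + (th - y * c))) -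
   cos th * (expR (n * s x) * W x) =
   (expR (n * s x) * W x) * (expR (a * l) * cos (y * l + th) - cos th).
  have -> : (a + n) * s x = a * c + a * l + n * s x by rewrite /l; ring.
  have -> : y * s x + (th - y * c) = y * l + th by rewrite /l; ring.
  rewrite !expRD; have := expRxMexpNx_1 (a * c).
  move: (expR (a * c)) (expR (- (a * c))) => p q pq; ring: pq.
have w0 : 0 <= expR (n * s x) * W x by rewrite mulr_ge0 ?expR_ge0.
rewrite normrM (ger0_norm w0).
apply: (@le_trans _ _ ((expR (n * s x) * W x) * (C * (dl + (expR l - 1) ^+ 2 / dl)))).
  rewrite ler_wpM2l//; apply: (le_trans (dist_expR_cos_le y th l a01)).
  have -> : (2 * `|y| + 5) * `|expR l - 1| = C * (2 * `|expR l - 1|) by rewrite /C; field.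
  rewrite ler_wpM2l// -(real_normK (num_real (expR l - 1))).
  move: `|expR l - 1| => z; rewrite -subr_ge0.
  have -> : dl + z ^+ 2 / dl - 2 * z = (dl - z) ^+ 2 / dl by field; rewrite gt_eqF.
  by rewrite divr_ge0 ?sqr_ge0// ltW.
rewrite le_eqVlt; apply/orP; left; apply/eqP; rewrite /g /k0 /k1 /k2.
have E2 : expR ((n + 2) * s x) = expR (n * s x) * expR (2 * c) * (expR l * expR l).
  by rewrite -!expRD; congr expR; rewrite /l; ring.
have E1 : expR ((n + 1) * s x) = expR (n * s x) * expR c * expR l.
  by rewrite -!expRD; congr expR; rewrite /l; ring.
rewrite E1 E2; have := expRxMexpNx_1 (2 * c); have := expRxMexpNx_1 c.
move: (expR c) (expR (- c)) (expR (2 * c)) (expR (- (2 * c))) (expR l) (expR (n * s x)) (W x) => p q p2 q2 e f w pq pq2.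
have -> : C / dl * q2 * (f * p2 * (e * e) * w) = C / dl * (p2 * q2) * (f * e * e * w) by ring.
have -> : - (C / dl * 2 * q) * (f * p * e * w) = - (C / dl * 2 * (p * q)) * (f * e * w) by ring.
rewrite pq pq2; ring.
Qed.

Variables (m : nat) (b : nat -> R).
Hypothesis rmomS : forall a : R, 0 < a -> rmom (a + 1) = (\prod_(j < m) (a + b j)) * rmom a.
Hypothesis rmom_gt0 : forall n, 0 < rmom n.+1%:R.

Lemma prod_shift_cvg (k : R) :
  \prod_(j < m) ((n.+1%:R + k + b j) / n.+1%:R) @[n --> \oo] --> (1 : R).
Proof.
have p1 : (1 : R) = \prod_(j < m) 1 by rewrite big1.
rewrite [X in _ --> X]p1.
apply: (cvg_big (@mul_continuous R)) => j _.
have -> : (fun n : nat => (n.+1%:R + k + b j) / n.+1%:R) = (fun n : nat => 1 + (k + b j) * harmonic n :> R).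
  apply/funext => n; rewrite /harmonic/=; have n1 : n.+1%:R != 0 :> R by rewrite pnatr_eq0.
  by move: (n.+1%:R) n1 => N N0; field.
rewrite -[X in _ --> X]addr0; apply: cvgD; first exact: cvg_cst.
rewrite -[X in _ --> X](mulr0 (k + b j)); apply: cvgM; first exact: cvg_cst.
exact: cvg_harmonic.
Qed.

(** By the recurrence, raising the exponent n by 1 multiplies the moment by about n ^ m, so the
    weight concentrates where e ^ s is close to n ^ m, whence the centre c = m ln (n + 1). Its
    relative mean square deviation, the mean of (e ^ (s - c) - 1) ^ 2, is [v n]; it tends to 0
    because only ratios of consecutive moments enter. *)
Lemma mom_limit (a y th : R) : 0 < a <= 1 ->
  expR (- (a * (m%:R * ln n.+1%:R))) * mom (a + n.+1%:R) y (th - y * (m%:R * ln n.+1%:R))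
    / rmom n.+1%:R @[n --> \oo] --> cos th.
Proof.
move=> a01.
pose pr (k : R) (n : nat) : R := \prod_(j < m) ((n.+1%:R + k + b j) / n.+1%:R).
pose v n := pr 1 n * pr 0 n - 2 * pr 0 n + 1.
have v0 : v n @[n --> \oo] --> (0 : R).
  have -> : (0 : R) = 1 * 1 - 2 * 1 + 1 by ring.
  apply: cvgD; last exact: cvg_cst.
  apply: cvgB; first by apply: cvgM; exact: prod_shift_cvg.
  by apply: cvgM; [exact: cvg_cst|exact: prod_shift_cvg].
have vE n : let c := m%:R * ln n.+1%:R in
  expR (- (2 * c)) * rmom (n.+1%:R + 2) - 2 * expR (- c) * rmom (n.+1%:R + 1) + rmom n.+1%:R = v n * rmom n.+1%:R.
  move=> c; have n0 : 0 < n.+1%:R :> R by rewrite ltr0n.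
  pose P := \prod_(j < m) n.+1%:R^-1 : R.
  have Ec : expR (- c) = P.
    by rewrite /c -mulrN expRM_natl expRN lnK ?posrE// /P prodr_const card_ord.
  have E2 : expR (- (2 * c)) = P * P.
    by rewrite -Ec -expRD; congr expR; ring.
  have -> : n.+1%:R + 2 = n.+1%:R + 1 + 1 :> R by ring.
  have n1 : 0 < n.+1%:R + 1 :> R by rewrite addr_gt0.
  rewrite (rmomS n1) (rmomS n0) E2 Ec /v /pr !big_split/= -/P.
  rewrite (eq_bigr (fun j : 'I_m => n.+1%:R + b j) (F1 := fun j : 'I_m => n.+1%:R + 0 + b j)); last first.
    by move=> j _; rewrite addr0.
  ring.
pose C := 2 * `|y| + 5; have C0 : 0 < C by rewrite ltr_wpDl ?mulr_ge0.
(* With v n <= dl ^ 2 both terms of [mom_bound] are at most C dl / 2 = eps / 2, relative to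
   [rmom]. *)
apply/cvgrPdist_le => eps e0; pose dl := eps / C; have d0 : 0 < dl by rewrite divr_gt0.
have d2 : 0 < dl ^+ 2 by rewrite exprn_gt0.
move/cvgrPdist_le : v0 => /(_ _ d2); apply: filterS => n; rewrite sub0r normrN => vn.
have n0 : 0 < n.+1%:R :> R by rewrite ltr0n.
have r0 := rmom_gt0 n.
have := mom_bound y th (m%:R * ln n.+1%:R) a01 n0 d0.
rewrite vE -/C; set A := expR _ * mom _ _ _ => AB.
have -> : cos th - A / rmom n.+1%:R = - (A - cos th * rmom n.+1%:R) / rmom n.+1%:R.
  by field; rewrite gt_eqF.
rewrite normrM normrN normfV (gtr0_norm r0) ler_pdivrMr//.
apply: (le_trans AB).
have -> : eps = C * dl by rewrite /dl; field; rewrite gt_eqF.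
have -> : C / 2 * (dl * rmom n.+1%:R + v n * rmom n.+1%:R / dl) =
   C * ((dl + v n / dl) / 2) * rmom n.+1%:R by field; rewrite gt_eqF.
rewrite ler_pM2r// ler_pM2l// ler_pdivrMr//.
have : v n / dl <= dl by rewrite ler_pdivrMr// -expr2 (le_trans (ler_norm _)).
lra.
Qed.

End Moments.

Import ComplexField.Normc.

(** * Complex limits expressed through real ones *)

Section NormC.
Context {R : realType}.
Local Open Scope complex_scope.

Lemma normc_le (x y : R) : normc (x +i* y) <= `|x| + `|y|.
Proof.
rewrite /normc -[leRHS]ger0_norm ?addr_ge0// -sqrtr_sqr ler_wsqrtr//.
rewrite -[X in X + _ <= _](real_normK (num_real x)) -[X in _ + X <= _](real_normK (num_real y)).
by have := normr_ge0 x; have := normr_ge0 y; nra.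
Qed.

Lemma normc_cvg0 (u v : nat -> R) (x y : R) :
  u n @[n --> \oo] --> x -> v n @[n --> \oo] --> y ->
  normc ((x +i* y) - (u n +i* v n)) @[n --> \oo] --> (0 : R).
Proof.
move=> ux vy; apply: (@squeeze_cvgr _ _ _ _ (cst 0) (fun n => `|x - u n| + `|y - v n|)).
- by apply: nearW => n; rewrite /cst/= sqrtr_ge0/= normc_le.
- exact: cvg_cst.
- rewrite -[X in _ --> X]addr0 -(normr0 R); apply: cvgD; apply: cvg_norm.
    by rewrite -(subrr x); apply: cvgB => //; exact: cvg_cst.
  by rewrite -(subrr y); apply: cvgB => //; exact: cvg_cst.
Qed.

Lemma normc_ge0 (z : R[i]) : 0 <= normc z.
Proof. by case: z => x y; exact: sqrtr_ge0. Qed.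

(** Convergence to 1 is stated through the distance to 1, so that all limits are taken in R. *)
Lemma normc_cvg1_mul (e f : nat -> R[i]) :
  normc (1 - e n) @[n --> \oo] --> (0 : R) -> normc (1 - f n) @[n --> \oo] --> (0 : R) ->
  normc (1 - e n * f n) @[n --> \oo] --> (0 : R).
Proof.
move=> e1 f1.
apply: (@squeeze_cvgr _ _ _ _ (cst 0) (fun n => normc (1 - e n) + (1 + normc (1 - e n)) * normc (1 - f n))).
- apply: nearW => n; rewrite /cst/= normc_ge0/=.
  have -> : 1 - e n * f n = (1 - e n) + (1 - (1 - e n)) * (1 - f n) by ring.
  apply: (le_trans (le_normcD _ _)); rewrite lerD2l normcM ler_wpM2r ?normc_ge0//.
  by apply: (le_trans (le_normcD _ _)); rewrite normcN normc1.
- exact: cvg_cst.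
- have -> : (0 : R) = 0 + (1 + 0) * 0 by ring.
  by apply: cvgD => //; apply: cvgM => //; apply: cvgD => //; exact: cvg_cst.
Qed.

Lemma normc_cvg1_prod (N : nat) (e : 'I_N -> nat -> R[i]) :
  (forall j, normc (1 - e j n) @[n --> \oo] --> (0 : R)) ->
  normc (1 - \prod_(j < N) e j n) @[n --> \oo] --> (0 : R).
Proof.
elim: N e => [|N IH] e eh.
  under eq_fun do rewrite big_ord0 subrr normc0; exact: cvg_cst.
under eq_fun do rewrite big_ord_recl.
by apply: normc_cvg1_mul => //; exact: IH.
Qed.

End NormC.

(** * Complex moments *)

Section ComplexMoments.
Context d (T : measurableType d) (R : realType) (mm : {measure set T -> \bar R}).
Variables (s W : T -> R).
Hypotheses (ms : measurable_fun setT s) (mW : measurable_fun setT W).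
Hypothesis W0 : forall x, 0 <= W x.
Hypothesis iW : forall a : R, 0 < a -> mm.-integrable setT (fun x => (expR (a * s x) * W x)%:E).
Local Open Scope complex_scope.

Local Notation mom := (mom mm s W).
Local Notation rmom := (rmom mm s W).

Definition cmom (z : R[i]) : R[i] :=
  mom (complex.Re z) (complex.Im z) 0 +i* mom (complex.Re z) (complex.Im z) (- pi / 2).

Lemma cmomE a y : cmom (a +i* y) = mom a y 0 +i* mom a y (- pi / 2).
Proof. by []. Qed.

Lemma cmom_real a : cmom a%:C = (rmom a)%:C.
Proof.
rewrite cmomE /mom /rmom; congr (_ +i* _).
  by apply: eq_Rintegral => x _; rewrite mul0r addr0 cos0 mulr1.
transitivity (\int[mm]_x (cst 0 x)); last by rewrite /cst Rintegral_cst// mul0r.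
by apply: eq_Rintegral => x _; rewrite mul0r add0r mulNr cosN cos_pihalf mulr0.
Qed.

(** Multiplication by e ^ (i ph) only shifts the phase of both parts by ph. *)
Lemma cmom_rot (a y ph : R) : 0 < a ->
  cmom (a +i* y) * (cos ph +i* sin ph) = mom a y ph +i* mom a y (ph - pi / 2).
Proof.
move=> a0; rewrite cmomE (mom_phase ms mW W0 iW y ph a0) (mom_phase ms mW W0 iW y (ph - pi / 2) a0).
rewrite cosB sinB cos_pihalf sin_pihalf.
apply/eqP; rewrite eq_complex/=; apply/andP; split; apply/eqP; ring.
Qed.

Variables (m : nat) (b : nat -> R).
Hypothesis rmomS : forall a : R, 0 < a -> rmom (a + 1) = (\prod_(j < m) (a + b j)) * rmom a.
Hypothesis rmom_gt0 : forall n, 0 < rmom n.+1%:R.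

(* n.+1 ^ (- m z) *)
Definition cnorm (z : R[i]) (n : nat) : R[i] :=
  let c := m%:R * ln n.+1%:R in
  (expR (- (complex.Re z * c)))%:C * (cos (- (complex.Im z * c)) +i* sin (- (complex.Im z * c))).

(** For the Gamma weight this is Gauss's limit Gamma (z + n) ~ n ^ z Gamma (n). The restriction to
    real part at most 1 comes from [dist_expR_cos_le]. *)
Lemma cmom_limit (z : R[i]) : 0 < complex.Re z <= 1 ->
  normc (1 - cmom (z + n.+1%:R%:C) * cnorm z n * ((rmom n.+1%:R)^-1)%:C) @[n --> \oo] --> (0 : R).
Proof.
case: z => a y a01; have {}a01 : 0 < a <= 1 by []; have a0 : 0 < a by case/andP : a01.
have h1 := @mom_limit _ _ _ _ _ _ ms mW W0 iW _ _ rmomS rmom_gt0 a y 0 a01.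
have h2 := @mom_limit _ _ _ _ _ _ ms mW W0 iW _ _ rmomS rmom_gt0 a y (- pi / 2) a01.
have := normc_cvg0 h1 h2; rewrite cos0 mulNr cosN cos_pihalf; apply: cvg_trans.
apply: near_eq_cvg; apply: nearW => n.
congr (normc (1 - _)); rewrite /cnorm/=.
have an : 0 < a + n.+1%:R by rewrite addr_gt0.
have -> : (a +i* y) + n.+1%:R%:C = (a + n.+1%:R) +i* y.
  by apply/eqP; rewrite eq_complex/= addr0 !eqxx.
rewrite (mulrCA (cmom _)) cmom_rot// add0r [- (pi / 2) - _]addrC.
apply/eqP; rewrite eq_complex/=; apply/andP; split; apply/eqP; ring.
Qed.

End ComplexMoments.

(** * Absorbing a real shift of the exponent into the weight *)

Section MomShift.
Context d (T : measurableType d) (R : realType) (mm : {measure set T -> \bar R}).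
Variables (s W : T -> R).

Lemma mom_shift (b a y th : R) :
  mom mm s (fun x => expR (b * s x) * W x) a y th = mom mm s W (a + b) y th.
Proof.
by apply: eq_Rintegral => x _; rewrite mulrDl expRD; congr (_ * _); ring.
Qed.

Lemma rmom_shift (b a : R) :
  rmom mm s (fun x => expR (b * s x) * W x) a = rmom mm s W (a + b).
Proof. by apply: eq_Rintegral => x _; rewrite mulrDl expRD; ring. Qed.

Lemma cmom_shift (b : R) (z : R[i]) :
  cmom mm s (fun x => expR (b * s x) * W x) z = cmom mm s W (z + (b%:C)%C).
Proof.
case: z => a y; rewrite /cmom !mom_shift/=.
by rewrite addr0.
Qed.

End MomShift.

(** * The recurrence of the Selberg integral *)

Section Selberg.
Context {R : realType}.
Notation mu := (@lebesgue_measure R).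
Notation TR := (measurableTypeR R).
Notation leb := (@lebesgue_tuple R).
Variable beta : nat.
Hypothesis beta_gt0 : (0 < beta)%N.

Local Notation w := (swt beta).
Local Notation g := (beta%:R / 2 : R).

Definition sweight n (t : n.-tuple R) : R :=
  expR (- texp t) * pairprod (vdm_factor beta 0) t.

Definition selb n (z : R[i]) : R[i] := cmom (leb n) (@tsum R n) (@sweight n) z.
Definition rselb n (a : R) : R := rmom (leb n) (@tsum R n) (@sweight n) a.

Lemma swtE a y th n (t : n.-tuple R) :
  w 0 a y th t = expR (a * tsum t) * sweight t * cos (y * tsum t + th).
Proof. by rewrite /swt /sweight; ring. Qed.

Lemma sweight_ge0 n (t : n.-tuple R) : 0 <= sweight t.
Proof. by rewrite mulr_ge0 ?expR_ge0// pairprod_ge0//; exact: vdm_factor_ge0. Qed.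

Lemma measurable_tsumT n : measurable_fun setT (fun t : n.-tuple TR => tsum t).
Proof. by apply: measurable_sum => i; exact: measurable_tnth. Qed.

Lemma measurable_sweight n : measurable_fun setT (fun t : n.-tuple TR => sweight t).
Proof.
apply: measurable_funM.
  apply: (measurableT_comp (@measurable_expR R)); apply: measurableT_comp => //.
  by apply: measurable_tsum; exact: measurable_expR.
by apply: measurable_pairprod; exact: measurable_vdm_factor.
Qed.

Lemma exp_sweightE n a (t : n.-tuple R) : expR (a * tsum t) * sweight t = w 0 a 0 0 t.
Proof. by rewrite swtE mul0r addr0 cos0 mulr1. Qed.

Lemma integrable_sweight n a : 0 < a ->
  (leb n).-integrable setT (fun t => (expR (a * tsum t) * sweight t)%:E).
Proof.
move=> a0; under eq_fun do rewrite exp_sweightE.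
apply: (@integrable_swt_bound R a (beta * n) n _ 1) => //.
  exact: measurable_swt.
by move=> t; rewrite mul1r; apply: swt_bound; rewrite lexx ler01.
Qed.

Definition headmon n k (t : n.-tuple R) : R := \prod_(i < n | (i < k)%N) expR (tnth t i).

Lemma headmon_ge0 n k (t : n.-tuple R) : 0 <= headmon k t.
Proof. by apply: prodr_ge0 => i _; exact: expR_ge0. Qed.

Lemma headmon_le n k (t : n.-tuple R) : headmon k t <= wprod t.
Proof.
rewrite /headmon big_mkcond; apply: ler_prod => i _.
by have := expR_gt0 (tnth t i); case: ifP => _; lra.
Qed.

Lemma measurable_headmon n k : measurable_fun setT (fun t : n.-tuple TR => headmon k t).
Proof.
rewrite (_ : (fun _ => _) = fun t : n.-tuple TR => \prod_(i < n) if (i < k)%N then expR (tnth t i) else 1).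
  apply: measurable_prod => i _; case: (i < k)%N; last exact: measurable_cst.
  by apply: measurableT_comp; [exact: measurable_expR|exact: measurable_tnth].
by apply/funext => t; rewrite /headmon big_mkcond.
Qed.

Lemma integrable_headmon n k a y th : 0 < a ->
  (leb n).-integrable setT (fun t => (headmon k t * w 0 a y th t)%:E).
Proof.
move=> a0; apply: (@integrable_swt_bound R a (beta * n).+1 n _ 1) => //.
  by apply: measurable_funM; [exact: measurable_headmon|exact: measurable_swt].
move=> t; rewrite mul1r gkerprodS normrM mulrC; apply: ler_pM => //.
  by apply: swt_bound; rewrite lexx ler01.
by rewrite ger0_norm ?headmon_ge0// headmon_le.
Qed.

Definition Amon n k a y th : R := \int[leb n]_t (headmon k t * w 0 a y th t).

(** Exchanging x_0 and x_k turns x_0 ... x_(k-1) into x_k x_1 ... x_(k-1), the monomial of the tail;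
    for k = 0 both products are empty. *)
Lemma tailmon_swap n k : (k <= n)%N -> exists K : 'I_n.+1,
  forall t : n.+1.-tuple R, tailmon k t = headmon k (swap_tuple ord0 K t).
Proof.
case: k => [|k] kn.
  by exists ord0 => t; rewrite /tailmon /headmon !big_pred0.
pose j : 'I_n := Ordinal kn; exists (lift ord0 j) => t.
rewrite /tailmon /headmon [RHS]big_mkcond big_ord_recl/= tnth_swap tpermL.
rewrite (bigD1 j)//=; congr (_ * _).
rewrite -big_mkcond/=; apply: eq_big => i.
  by rewrite -[i == j]/(nat_of_ord i == k) ltnS [RHS]ltn_neqAle andbC.
move=> /andP[_ ij]; rewrite tnth_swap tpermD// (inj_eq lift_inj) eq_sym//.
Qed.

(** [aomoto_step] with x_0 [tailmon k] read as [headmon k.+1], and [tailmon k] exchanged for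
    [headmon k] by the symmetry of the weight. Taken at th = 0 and th = - pi / 2, the right-hand
    side is multiplication by z + (n - k) g with z = a + i y. *)
Lemma aomoto_rec n k a y th : (k <= n)%N -> 0 < a ->
  Amon n.+1 k.+1 a y th =
  (a + (n - k)%:R * g) * Amon n.+1 k a y th - y * Amon n.+1 k a y (th - pi / 2).
Proof.
move=> kn a0.
have tE (t : n.+1.-tuple R) : headmon k.+1 t = expR (tnth t ord0) * tailmon k t.
  rewrite /headmon big_mkcond big_ord_recl/= -big_mkcond; congr (_ * _).
have TA th' : (leb n.+1).-integrable setT (fun t => (tailmon k t * w 0 a y th' t)%:E) /\
    \int[leb n.+1]_t (tailmon k t * w 0 a y th' t) = Amon n.+1 k a y th'.
  have [K hK] := tailmon_swap kn.
  have E t : tailmon k t * w 0 a y th' t = headmon k (swap_tuple ord0 K t) * w 0 a y th' (swap_tuple ord0 K t).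
    by rewrite hK swt_swap.
  have iH := integrable_headmon n.+1 k y th' a0.
  split.
    under eq_fun do rewrite E.
    exact: (integrable_swap ord0 K iH).
  rewrite /Amon /Rintegral; congr fine.
  under eq_integral do rewrite E.
  by apply: (integral_swap ord0 K (f := fun t => (headmon k t * w 0 a y th' t)%:E)); case/integrableP : iH.
have [i1 e1] := TA th; have [i2 e2] := TA (th - pi / 2).
have i3 := integrable_headmon n.+1 k.+1 y th a0.
have c1 := integrableZl measurableT (a + (n - k)%:R * g) i1.
have c2 := integrableZl measurableT y i2.
have c12 := integrableB measurableT c1 c2.
have := aomoto_step beta_gt0 y th n k a0.
have -> : (\int[leb n.+1]_t (tailmon k t *
     ((a - expR (tnth t ord0)) * w 0 a y th t - y * w 0 a y (th - pi / 2) t +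
      beta%:R * ((n - k)%:R / 2) * w 0 a y th t))%:E =
   \int[leb n.+1]_t (((a + (n - k)%:R * g) * (tailmon k t * w 0 a y th t) -
      y * (tailmon k t * w 0 a y (th - pi / 2) t)) - headmon k.+1 t * w 0 a y th t)%:E)%E.
  apply: eq_integral => t _; rewrite tE; congr EFin; by field.
move=> /(congr1 fine); rewrite -/(Rintegral _ _ _) RintegralB// RintegralB// !RintegralZl//.
rewrite e1 e2 -/(Amon _ _ _ _ _) /=; lra.
Qed.

Local Open Scope complex_scope.

Lemma AmonNpi n k a y th : 0 < a -> Amon n k a y (th - pi) = - Amon n k a y th.
Proof.
move=> a0; rewrite -[RHS]mulN1r /Amon -RintegralZl//; last exact: integrable_headmon.
apply: eq_Rintegral => t _; rewrite !swtE.
have -> : y * tsum t + (th - pi) = y * tsum t + th - pi by ring.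
by rewrite cosB cospi sinpi; ring.
Qed.

Lemma selbE n (a y : R) : selb n (a +i* y) = Amon n 0 a y 0 +i* Amon n 0 a y (- pi / 2).
Proof.
by congr (_ +i* _); apply: eq_Rintegral => t _; rewrite /headmon big_pred0// mul1r swtE.
Qed.

Lemma headmon_full n a y th (t : n.-tuple R) :
  headmon n t * w 0 a y th t = w 0 (a + 1) y th t.
Proof.
rewrite /headmon (eq_bigl predT); last by move=> i; rewrite ltn_ord.
by rewrite -expR_sum !swtE mulrDl mul1r expRD; ring.
Qed.

(** [aomoto_rec] is iterated from the empty monomial to the product of all the variables, which
    raises the exponent by 1. The factors come out in decreasing order of j, hence the reversal of
    the index. *)
Lemma selbS n (z : R[i]) : 0 < complex.Re z ->
  selb n (z + 1) = (\prod_(j < n) (z + (j%:R * g)%:C)) * selb n z.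
Proof.
case: z => a y /= a0.
have -> : (a +i* y) + 1 = (a + 1) +i* y by apply/eqP; rewrite eq_complex/= addr0 !eqxx.
case: n => [|n].
  have A0 th : Amon 0 0 (a + 1) y th = Amon 0 0 a y th.
    by apply: eq_Rintegral => t _; rewrite !swtE /tsum big_ord0 !mulr0.
  by rewrite big_ord0 mul1r !selbE !A0.
pose Ac k := Amon n.+1 k a y 0 +i* Amon n.+1 k a y (- pi / 2).
have AcS k : (k <= n)%N -> Ac k.+1 = ((a +i* y) + ((n - k)%:R * g)%:C) * Ac k.
  move=> kn; rewrite /Ac !aomoto_rec//.
  have -> : - pi / 2 - pi / 2 = 0 - pi :> R by field.
  rewrite AmonNpi// sub0r mulNr; apply/eqP; rewrite eq_complex/=; apply/andP; split; apply/eqP; ring.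
have AcE k : (k <= n.+1)%N -> Ac k = (\prod_(i < k) ((a +i* y) + ((n - i)%:R * g)%:C)) * Ac 0.
  elim: k => [|k IH] kn; first by rewrite big_ord0 mul1r.
  by rewrite AcS// IH 1?ltnW// big_ord_recr/= mulrCA mulrA.
have AE th : Amon n.+1 0 (a + 1) y th = Amon n.+1 n.+1 a y th.
  by apply: eq_Rintegral => t _; rewrite headmon_full /headmon big_pred0// mul1r.
rewrite !selbE !AE -/(Ac n.+1) -/(Ac 0) AcE//; congr (_ * _).
rewrite (reindex_inj rev_ord_inj)/=; apply: eq_bigr => i _.
by rewrite subSS subKn// -ltnS.
Qed.

End Selberg.

(** * The Selberg integral as a constant times a product of Gamma functions *)

Section SelbergGamma.
Context {R : realType}.
Notation mu := (@lebesgue_measure R).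
Notation TR := (measurableTypeR R).
Notation leb := (@lebesgue_tuple R).
Variable beta : nat.
Hypothesis beta_gt0 : (0 < beta)%N.
Local Notation g := (beta%:R / 2 : R).
Local Notation selb := (selb beta).
Local Notation rselb := (@rselb R beta).
Local Open Scope complex_scope.

Lemma selb_real n (a : R) : selb n a%:C = (rselb n a)%:C.
Proof. exact: cmom_real. Qed.

Lemma rselbS n a : 0 < a -> rselb n (a + 1) = (\prod_(j < n) (a + j%:R * g)) * rselb n a.
Proof.
move=> a0; apply: (@complexI R); rewrite -selb_real rmorphD rmorph1 selbS// selb_real rmorphM rmorph_prod.
by congr (_ * _); apply: eq_bigr => j _; rewrite rmorphD.
Qed.

Lemma rselb_nat_gt0 n : 0 < rselb n 1 -> forall k, 0 < rselb n k.+1%:R.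
Proof.
move=> h; elim=> [|k IH]; first by rewrite mulr1n.
rewrite -natr1 rselbS ?ltr0n// mulr_gt0//; apply: prodr_gt0 => j _.
by rewrite ltr_wpDr ?ltr0n// mulr_ge0// divr_ge0.
Qed.

Lemma rselb_ge0 n a : 0 <= rselb n a.
Proof. by apply: Rintegral_ge0 => t _; rewrite mulr_ge0 ?expR_ge0// sweight_ge0. Qed.

Lemma gamS (z : R[i]) : 0 < complex.Re z -> selb 1 (z + 1) = z * selb 1 z.
Proof. by move=> z0; rewrite selbS// big_ord1 mul0r rmorph0 addr0. Qed.

Lemma integral_expexp (k : R) : 0 < k ->
  (\int[mu]_u (expR u * expR (- (k * expR u)))%:E = (k^-1)%:E)%E.
Proof.
move=> k0; rewrite -(integral_expRN_cy k0) -integral_itv_obnd_cbnd; last first.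
  apply/measurable_EFinP; apply: measurable_funTS.
  by apply: (measurableT_comp (@measurable_expR R)); apply: measurableT_comp => //.
rewrite (ge0_integral_expR (g := fun x => (expR (- (k * x)))%:E)).
- by apply: eq_integral => u _; rewrite EFinM.
- apply/measurable_EFinP; apply: (measurableT_comp (@measurable_expR R)); apply: measurableT_comp => //.
- by move=> x; rewrite lee_fin expR_ge0.
Qed.

Lemma rgam1 : rselb 1 1 = 1.
Proof.
rewrite /rselb /rmom /Rintegral.
rewrite ge0_integral_cons; last 2 first.
- apply/measurable_EFinP; apply: measurable_exp_mom; [exact: measurable_tsumT|exact: measurable_sweight].
- by move=> t; rewrite lee_fin mulr_ge0 ?expR_ge0// sweight_ge0.
rewrite (eq_integral (fun u : TR => (expR u * expR (- (1 * expR u)))%:E)); last first.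
  move=> u _; rewrite integral_tuple0 /sweight /tsum /texp /pairprod !big_ord1 big_pred0; last first.
    by move=> j; rewrite ltnNge leq_ord.
  by rewrite !mul1r mulr1.
by rewrite integral_expexp// invr1.
Qed.

Lemma rselb1_0 : 0 < rselb 1 1. Proof. by rewrite rgam1. Qed.

(** A zero at x would propagate by the recurrence to every x + k, against the asymptotics of
    [cmom_limit], where the normalised value tends to 1. *)
Lemma gam_neq0 (z : R[i]) : 0 < complex.Re z -> selb 1 z != 0.
Proof.
have base (x : R[i]) : 0 < complex.Re x <= 1 -> selb 1 x != 0.
  move=> x01; have x0 : 0 < complex.Re x by case/andP : x01.
  apply/eqP => Gx0.
  have Gn k : selb 1 (x + k%:R%:C) = 0.
    elim: k => [|k IH]; first by rewrite rmorph0 addr0.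
    rewrite -natr1 rmorphD rmorph1 addrA gamS ?IH ?mulr0//.
    by case: x x0 {x01 Gx0 IH} => a y /= a0; rewrite ltr_pwDl.
  have := @cmom_limit _ _ R (leb 1) (@tsum R 1) (@sweight R beta 1) (@measurable_tsumT R 1)
    (@measurable_sweight R beta 1) (@sweight_ge0 R beta 1) (@integrable_sweight R beta 1)
    1 (fun j => j%:R * g) (@rselbS 1) (rselb_nat_gt0 rselb1_0) x x01.
  rewrite (_ : (fun n => _) = cst 1); last first.
    by apply/funext => k; rewrite -/(selb 1 _) Gn !mul0r subr0 normc1.
  move=> /(cvg_lim (@Rhausdorff R)); rewrite lim_cst; last exact: Rhausdorff.
  by move/eqP; rewrite oner_eq0.
have ext k (x : R[i]) : 0 < complex.Re x <= k.+1%:R -> selb 1 x != 0.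
  elim: k x => [|k IH] x; first exact: base.
  have [x1 /andP[x0 _]|x1] := leP (complex.Re x) 1; first by apply: base; rewrite x0.
  move=> /andP[x0 xk].
  have xE : x = (x - 1) + 1 by rewrite subrK.
  have y0 : 0 < complex.Re (x - 1).
    by case: x x1 {x0 xk xE} => a y /=; lra.
  rewrite xE gamS// mulf_neq0//; last first.
    by apply: IH; rewrite y0/=; case: x xk {x1 x0 xE y0} => a y /=; rewrite -natr1; lra.
  by apply: contraTneq y0 => ->; rewrite /= ltxx.
move=> z0; apply: (ext (Num.truncn (complex.Re z))); rewrite z0/=.
by rewrite ltW// truncnS_gt.
Qed.

Lemma rgam_gt0 a : 0 < a -> 0 < rselb 1 a.
Proof.
move=> a0; rewrite lt_neqAle rselb_ge0 andbT eq_sym.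
have := gam_neq0 (z := a%:C) a0; rewrite selb_real; apply: contra => /eqP ->.
by rewrite rmorph0.
Qed.

(** The shift b is absorbed into the weight, whose recurrence factor becomes a + b; z itself stays
    in the strip where [cmom_limit] applies. *)
Lemma gam_limit (b : R) (z : R[i]) : 0 <= b -> 0 < complex.Re z <= 1 ->
  normc (1 - selb 1 (z + n.+1%:R%:C + b%:C) * cnorm 1 z n * ((rselb 1 (n.+1%:R + b))^-1)%:C)
    @[n --> \oo] --> (0 : R).
Proof.
move=> b0 z01.
pose W' (t : 1.-tuple R) := expR (b * tsum t) * sweight beta t.
have mW' : measurable_fun setT (W' : 1.-tuple TR -> R).
  by apply: measurable_exp_mom; [exact: measurable_tsumT|exact: measurable_sweight].
have W'0 t : 0 <= W' t by rewrite mulr_ge0 ?expR_ge0// sweight_ge0.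
have iW' a : 0 < a -> (leb 1).-integrable setT (fun t => (expR (a * tsum t) * W' t)%:E).
  move=> a0; have ab : 0 < a + b by rewrite ltr_pwDl.
  have -> : (fun t : 1.-tuple TR => (expR (a * tsum t) * W' t)%:E) =
     (fun t => (expR ((a + b) * tsum t) * sweight beta t)%:E).
    by apply/funext => t; rewrite /W' mulrDl expRD mulrA.
  exact: integrable_sweight.
have S a : 0 < a -> rmom (leb 1) (@tsum R 1) W' (a + 1) = (\prod_(j < 1) (a + b)) * rmom (leb 1) (@tsum R 1) W' a.
  move=> a0; have ab : 0 < a + b by rewrite ltr_pwDl.
  have h := rselbS 1 ab; rewrite big_ord1 mul0r addr0 in h.
  have E c : rmom (leb 1) (@tsum R 1) W' c = rselb 1 (c + b) by exact: rmom_shift.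
  by rewrite big_ord1 !E addrAC.
have P n : 0 < rmom (leb 1) (@tsum R 1) W' n.+1%:R.
  by rewrite rmom_shift; apply: rgam_gt0; rewrite ltr_pwDl.
have := @cmom_limit _ _ R (leb 1) (@tsum R 1) W' (@measurable_tsumT R 1) mW' W'0 iW' 1 (fun=> b) S P z z01.
apply: cvg_trans; apply: near_eq_cvg; apply: nearW => n.
by rewrite cmom_shift rmom_shift.
Qed.

Lemma cnormX n (z : R[i]) k : cnorm n z k = cnorm 1 z k ^+ n.
Proof.
elim: n => [|n IH].
  rewrite expr0 /cnorm mul0r !mulr0 oppr0 expR0 cos0 sin0.
  by apply/eqP; rewrite eq_complex/=; apply/andP; split; apply/eqP; ring.
rewrite exprS -IH /cnorm -[n.+1%:R]natr1 mul1r.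
case: z {IH} => a y /=; set l := ln _.
have -> : - (a * ((n%:R + 1) * l)) = - (a * l) - a * (n%:R * l) by ring.
have -> : - (y * ((n%:R + 1) * l)) = - (y * l) - y * (n%:R * l) by ring.
rewrite expRD cosD sinD.
by apply/eqP; rewrite eq_complex/=; apply/andP; split; apply/eqP; ring.
Qed.

Definition gamprod n (z : R[i]) : R[i] := \prod_(j < n) selb 1 (z + (j%:R * g)%:C).
Definition rgamprod n (a : R) : R := \prod_(j < n) rselb 1 (a + j%:R * g).

Lemma gamprod_real n a : gamprod n a%:C = (rgamprod n a)%:C.
Proof.
by rewrite rmorph_prod; apply: eq_bigr => j _; rewrite -rmorphD selb_real.
Qed.

Lemma jg_ge0 j : 0 <= j%:R * g. Proof. by rewrite mulr_ge0// divr_ge0. Qed.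

Lemma Re_addC (z : R[i]) (b : R) : complex.Re (z + b%:C) = complex.Re z + b.
Proof. by case: z. Qed.

Lemma gamprodS n z : 0 < complex.Re z ->
  gamprod n (z + 1) = (\prod_(j < n) (z + (j%:R * g)%:C)) * gamprod n z.
Proof.
move=> z0; rewrite /gamprod -big_split; apply: eq_bigr => j _ /=.
by rewrite addrAC gamS// Re_addC ltr_pwDl// jg_ge0.
Qed.

Lemma rgamprodS n a : 0 < a ->
  rgamprod n (a + 1) = (\prod_(j < n) (a + j%:R * g)) * rgamprod n a.
Proof.
move=> a0; rewrite /rgamprod -big_split; apply: eq_bigr => j _ /=.
by rewrite addrAC rselbS ?big_ord1 ?mul0r ?addr0// ltr_pwDl// jg_ge0.
Qed.

Lemma rgamprod_gt0 n a : 0 < a -> 0 < rgamprod n a.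
Proof.
by move=> a0; apply: prodr_gt0 => j _; apply: rgam_gt0; rewrite ltr_pwDl// jg_ge0.
Qed.

Lemma gamprod_limit n (z : R[i]) : 0 < complex.Re z <= 1 ->
  normc (1 - gamprod n (z + k.+1%:R%:C) * cnorm n z k * ((rgamprod n k.+1%:R)^-1)%:C)
    @[k --> \oo] --> (0 : R).
Proof.
move=> z01.
have := normc_cvg1_prod (fun j : 'I_n => gam_limit (jg_ge0 j) z01).
apply: cvg_trans; apply: near_eq_cvg; apply: nearW => k.
congr (normc (1 - _)); rewrite (cnormX n) 2!big_split/= prodr_const card_ord.
by rewrite /gamprod /rgamprod -prodfV rmorph_prod.
Qed.

(** Two proportions combined: f1 / f2 = f1' / f2' will come from the recurrence started at z, p / q
    = p' / q' from the recurrence started at 1. *)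
Lemma cross_ratio (F : fieldType) (p q p' q' f1 f2 f1' f2' c : F) :
  p != 0 -> q != 0 -> f1 * f2' = f2 * f1' -> p * q' = q * p' ->
  f1 * c * p^-1 * (p' * f2') = f2 * c * q^-1 * (f1' * q').
Proof.
move=> p0 q0 hf hr; apply: (mulfI p0); apply: (mulfI q0).
have -> : q * (p * (f1 * c * p^-1 * (p' * f2'))) = (f1 * f2') * c * (q * p') by field.
by rewrite hf -hr; field.
Qed.

(* Both sides satisfy the same recurrence under z |-> z + 1 and the same
   asymptotics as z |-> z + k tends to infinity. *)
Lemma selb_gamprod n (z : R[i]) : 0 < rselb n 1 -> 0 < complex.Re z ->
  selb n z * (rgamprod n 1)%:C = (rselb n 1)%:C * gamprod n z.
Proof.
move=> r1.
have base (x : R[i]) : 0 < complex.Re x <= 1 ->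
    selb n x * (rgamprod n 1)%:C = (rselb n 1)%:C * gamprod n x.
  move=> x01; have x0 : 0 < complex.Re x by case/andP : x01.
  have xk k : 0 < complex.Re (x + k%:R%:C) by rewrite Re_addC ltr_pwDl.
  have l1 := @cmom_limit _ _ R (leb n) (@tsum R n) (@sweight R beta n) (@measurable_tsumT R n)
    (@measurable_sweight R beta n) (@sweight_ge0 R beta n) (@integrable_sweight R beta n)
    n (fun j => j%:R * g) (@rselbS n) (rselb_nat_gt0 r1) x x01.
  have l2 := gamprod_limit n x01.
  have F k : selb n (x + k%:R%:C) * gamprod n x = gamprod n (x + k%:R%:C) * selb n x.
    elim: k => [|k IH]; first by rewrite rmorph0 !addr0 mulrC.
    have xS : x + k.+1%:R%:C = (x + k%:R%:C) + 1 by rewrite -natr1 rmorphD rmorph1 addrA.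
    by rewrite !xS (selbS beta_gt0 n (xk k)) (gamprodS n (xk k)) -!mulrA IH.
  have r k : rselb n k.+1%:R * rgamprod n 1 = rgamprod n k.+1%:R * rselb n 1.
    elim: k => [|k IH]; first by rewrite mulr1n mulrC.
    by rewrite -[k.+2%:R]natr1 (rselbS n (ltr0Sn _ k)) (rgamprodS n (ltr0Sn _ k)) -!mulrA IH.
  set A := selb n x * _; set B := _ * gamprod n x.
  pose e1 k := selb n (x + k.+1%:R%:C) * cnorm n x k * ((rselb n k.+1%:R)^-1)%:C.
  pose e2 k := gamprod n (x + k.+1%:R%:C) * cnorm n x k * ((rgamprod n k.+1%:R)^-1)%:C.
  (* As [e1] and [e2] both tend to 1, the limit of this identity is A = B. *)
  have E k : e1 k * B = e2 k * A.
    have p0 := rselb_nat_gt0 r1 k; have q0 : 0 < rgamprod n k.+1%:R by exact: rgamprod_gt0.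
    have p1 : (rselb n k.+1%:R)%:C != 0 by rewrite eq_complex/= eqxx andbT gt_eqF.
    have q1 : (rgamprod n k.+1%:R)%:C != 0 by rewrite eq_complex/= eqxx andbT gt_eqF.
    have inv (u : R) : (u^-1)%:C = (u%:C)^-1 by exact: fmorphV.
    have hr : (rselb n k.+1%:R)%:C * (rgamprod n 1)%:C = (rgamprod n k.+1%:R)%:C * (rselb n 1)%:C.
      by have := congr1 (fun u => u%:C) (r k); rewrite /= !rmorphM.
    rewrite /e1 /e2 /A /B !inv.
    exact: (cross_ratio _ p1 q1 (F k.+1) hr).
  apply/eqP; rewrite -subr_eq0; apply/eqP; apply: eq0_normc.
  have b k : normc (A - B) <= normc A * normc (1 - e2 k) + normc B * normc (1 - e1 k).
    have -> : A - B = A * (1 - e2 k) + - (B * (1 - e1 k)).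
      by rewrite !mulrBr !mulr1 [A * e2 k]mulrC -E; ring.
    by apply: (le_trans (le_normcD _ _)); rewrite normcN !normcM.
  apply/eqP; rewrite eq_le normc_ge0 andbT.
  have L : (normc A * normc (1 - e2 k) + normc B * normc (1 - e1 k)) @[k --> \oo] --> (normc A * 0 + normc B * 0 : R).
    by apply: cvgD; apply: cvgM => //; exact: cvg_cst.
  rewrite !mulr0 addr0 in L.
  rewrite -(cvg_lim (@Rhausdorff R) L); apply: limr_ge; first exact: cvgP L.
  exact: nearW.
(* The common recurrence carries the identity from the strip to the half-plane, one unit at a
   time. *)
have ext k (x : R[i]) : 0 < complex.Re x <= k.+1%:R ->
    selb n x * (rgamprod n 1)%:C = (rselb n 1)%:C * gamprod n x.
  elim: k x => [|k IH] x; first exact: base.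
  have [x1 /andP[x0 _]|x1] := leP (complex.Re x) 1; first by apply: base; rewrite x0.
  move=> /andP[x0 xk].
  have xE : x = (x - 1) + 1 by rewrite subrK.
  have y0 : 0 < complex.Re (x - 1).
    by case: x x1 {x0 xk xE} => a y /=; lra.
  rewrite xE selbS// gamprodS// -mulrA IH; first by rewrite mulrCA.
  by rewrite y0/=; case: x xk {x1 x0 xE y0} => a y /=; rewrite -natr1; lra.
move=> z0; apply: (ext (Num.truncn (complex.Re z))); rewrite z0/=.
by rewrite ltW// truncnS_gt.
Qed.

End SelbergGamma.

(** * The constant factor of the Selberg integral *)

Section SelbergConstant.
Context {R : realType}.
Notation mu := (@lebesgue_measure R).
Notation TR := (measurableTypeR R).
Notation leb := (@lebesgue_tuple R).
Variable beta : nat.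
Hypothesis beta_gt0 : (0 < beta)%N.
Local Notation g := (beta%:R / 2 : R).
Local Notation selb := (selb beta).
Local Notation rselb := (@rselb R beta).
Local Open Scope complex_scope.

(** The substitution e ^ x = c + e ^ v, which is the translation by c on the positive half-line. *)
Lemma ln_addexp_subst (c : R) (h : R -> \bar R) : 0 <= c ->
  measurable_fun [set: R] h -> (forall x, 0 <= h x)%E ->
  (\int[mu]_x (((c < expR x)%R%:R * expR x)%:E * h x) =
   \int[mu]_v ((expR v)%:E * h (ln (c + expR v)%R)))%E.
Proof.
move=> c0 mh h0.
have mc : measurable_fun [set: R] (fun s : R => (c < s)%R%:R : R).
  rewrite (_ : (fun _ => _) = \1_(`]c, +oo[ : set R)); first exact: measurable_indic.
  by apply/funext => s; rewrite indicE mem_setE in_itv/= andbT.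
have ml : measurable_fun [set: R] (fun s : R => h (ln s)).
  by apply: measurableT_comp => //; exact: measurable_ln.
have p0 (b : bool) : (0 <= (b%:R : R)%:E)%E by rewrite lee_fin.
pose G (s : R) := ((c < s)%R%:R%:E * h (ln s))%E.
have mG : measurable_fun [set: R] G by apply: emeasurable_funM => //; apply/measurable_EFinP.
have G0 s : (0 <= G s)%E by apply: mule_ge0.
transitivity (\int[mu]_(s in `]0%R, +oo[) G s)%E.
  rewrite ge0_integral_expR//; apply: eq_integral => x _.
  by rewrite /G expRK muleA mulrC EFinM.
transitivity (\int[mu]_s G s)%E.
  rewrite integral_indicE//; apply: eq_integral => s _; rewrite mem_setE in_itv/= andbT /G.
  have [|s0] := ltP 0 s; first by rewrite mul1e.
  by rewrite ltNge (le_trans s0 c0) !mul0e.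
rewrite -(ge0_integral_translate c mG G0).
transitivity (\int[mu]_(s in `]0%R, +oo[) h (ln (c + s)%R))%E.
  rewrite [RHS]integral_indicE//; apply: eq_integral => s _.
  by rewrite mem_setE in_itv/= andbT /G ltrDr [s + c]addrC.
rewrite (ge0_integral_expR (g := fun s => h (ln (c + s)%R)))//.
apply: (measurableT_comp (f := fun s : R => h (ln s))) => //.
exact: measurable_funD.
Qed.

Definition strict_argmin n (i : 'I_n) (t : n.-tuple R) : bool :=
  [forall j, (j != i) ==> (tnth t i < tnth t j)].

Lemma strict_argmin_swap n (i : 'I_n.+1) (t : n.+1.-tuple R) :
  strict_argmin i t = strict_argmin ord0 (swap_tuple ord0 i t).
Proof.
apply/forallP/forallP => H j; apply/implyP => ji.
  rewrite !tnth_swap tpermL; move/implyP : (H (tperm ord0 i j)); apply.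
  by apply: contra ji => /eqP; rewrite -{2}(tpermL ord0 i) => /perm_inj ->.
move/implyP : (H (tperm ord0 i j)); rewrite !tnth_swap tpermL tpermK; apply.
by apply: contra ji => /eqP; rewrite -{2}(tpermR ord0 i) => /perm_inj ->.
Qed.

Lemma strict_argmin_cons n (u : R) (t : n.-tuple R) :
  (strict_argmin ord0 [tuple of u :: t])%:R = \prod_(j < n) (expR u < expR (tnth t j))%R%:R :> R.
Proof.
transitivity ([forall j : 'I_n, u < tnth t j]%:R : R).
  congr (nat_of_bool _)%:R; apply/forallP/forallP => H j.
    by move/implyP : (H (lift ord0 j)); rewrite tnth0 tnthS; apply.
  apply/implyP; case: (unliftP ord0 j) => [k ->|->]; last by rewrite eqxx.
  by rewrite tnth0 tnthS.
have [/forallP H|] := boolP [forall j : 'I_n, u < tnth t j].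
  by rewrite big1// => j _; rewrite ltr_expR H.
rewrite negb_forall => /existsP[j /negbTE H].
by rewrite (bigD1 j)//= ltr_expR H mul0r.
Qed.

Lemma measurable_strict_argmin n :
  measurable_fun setT (fun t : n.+1.-tuple TR => (strict_argmin ord0 t)%:R : R).
Proof.
have -> : (fun t : n.+1.-tuple TR => (strict_argmin ord0 t)%:R : R) =
    fun t => \prod_(j < n) (0 < tnth t (lift ord0 j) - tnth t ord0)%R%:R.
  apply/funext => t; have -> : t = [tuple of tnth t ord0 :: [tuple of behead t]].
    by apply: val_inj; case: t => -[].
  rewrite strict_argmin_cons; apply: eq_bigr => j _.
  by rewrite ltr_expR tnth0 tnthS subr_gt0.
have mc : measurable_fun [set: R] (fun s : R => (0 < s)%R%:R : R).
  rewrite (_ : (fun _ => _) = \1_(`]0, +oo[ : set R)); first exact: measurable_indic.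
  by apply/funext => s; rewrite indicE mem_setE in_itv/= andbT.
apply: measurable_prod => j _; apply: (measurableT_comp mc).
by apply: measurable_funB; exact: measurable_tnth.
Qed.

Lemma pairprod_tie n (i j : 'I_n) (t : n.-tuple R) : i != j -> tnth t i = tnth t j ->
  pairprod (vdm_factor beta 0) t = 0.
Proof.
have z0 (x : R) : vdm_factor beta 0 x x = 0.
  by rewrite /vdm_factor subrr expr0n addr0 sqrtr0 expr0n eqn0Ngt beta_gt0.
wlog ij : i j / (i < j)%N => [H|_ tij].
  move=> ij; move: (ij); rewrite -(inj_eq val_inj) neq_ltn => /orP[l|l] e.
    exact: (H i j l ij e).
  by apply: (H j i l _ (esym e)); rewrite eq_sym.
by rewrite /pairprod (bigD1 i)//= (bigD1 j)//= tij z0 !mul0r.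
Qed.

(** If the minimum is attained once, exactly one indicator is 1; if it is attained twice, the weight
    vanishes. The decomposition thus holds at every point. *)
Lemma sweight_argmin n (t : n.+1.-tuple R) :
  sweight beta t = \sum_(i < n.+1) (strict_argmin i t)%:R * sweight beta t.
Proof.
have [i _ imin] := arg_minP (fun i => tnth t i) (isT : predT (ord0 : 'I_n.+1)).
have [mi|] := boolP (strict_argmin i t).
  rewrite (bigD1 i)//= mi mul1r big1 ?addr0// => j ji.
  have [/forallP/(_ i)|_] := boolP (strict_argmin j t); last by rewrite mul0r.
  by rewrite eq_sym ji/= ltNge imin.
rewrite negb_forall => /existsP[j]; rewrite negb_imply => /andP[ji].
rewrite -leNgt => tji; have tij : tnth t j = tnth t i.
  by apply/eqP; rewrite eq_le tji imin.
have -> : sweight beta t = 0 by rewrite /sweight (pairprod_tie ji tij) mulr0.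
by rewrite big1// => k _; rewrite mulr0.
Qed.

Let F a n (t : n.-tuple R) : R := expR (a * tsum t) * sweight beta t.

Let mF a n : measurable_fun setT (fun t : n.-tuple TR => (F a t)%:E).
Proof.
by apply/measurable_EFinP; apply: measurable_exp_mom;
  [exact: measurable_tsumT|exact: measurable_sweight].
Qed.

Let F0 a n (t : n.-tuple R) : 0 <= F a t.
Proof. by rewrite mulr_ge0 ?expR_ge0// sweight_ge0. Qed.

Let F_swap a n (i j : 'I_n) t : F a (swap_tuple i j t) = F a t.
Proof. by rewrite /F !exp_sweightE swt_swap. Qed.

(** The exchange of coordinates 0 and i carries the region where i is the minimum to the one where 0
    is. *)
Lemma integral_argmin n :
  (\int[leb n.+1]_t (F 1 t)%:E =
   n.+1%:R%:E * \int[leb n.+1]_t ((strict_argmin ord0 t)%:R * F 1 t)%:E)%E.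
Proof.
pose h (t : n.+1.-tuple TR) := ((strict_argmin ord0 t)%:R * F 1 t)%:E.
have mh : measurable_fun setT h.
  apply/measurable_EFinP; apply: measurable_funM; first exact: measurable_strict_argmin.
  by apply/measurable_EFinP; exact: mF.
have h0 t : (0 <= h t)%E by rewrite lee_fin mulr_ge0.
have E t : (F 1 t)%:E = (\sum_(i < n.+1) h (swap_tuple ord0 i t))%E.
  rewrite /F sweight_argmin mulr_sumr -sumEFin; apply: eq_bigr => i _.
  by rewrite /h F_swap -strict_argmin_swap /F mulrCA.
under eq_integral do rewrite E.
rewrite ge0_integral_sum//; last by move=> i; exact: measurable_swap_comp.
rewrite (eq_bigr (fun=> (\int[leb n.+1]_t h t)%E)); last first.
  by move=> i _; rewrite ge0_integral_swap.
by rewrite sumr_const card_ord mule_natl.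
Qed.

(** Put x_j = x_0 + y_j in the tail. Differences within the tail are unchanged, the pair factors
    with the head become y_j ^ beta, which raises the exponent from 1 to 1 + beta, and the
    exponential becomes e ^ (- (n + 1) x_0) times that of the y_j. *)
Lemma integral_argmin_cons n (u : R) :
  (\int[leb n]_t ((strict_argmin ord0 [tuple of u :: t])%:R * F 1 [tuple of u :: t])%:E =
   (expR u * expR (- (n.+1%:R * expR u)))%:E * \int[leb n]_t (F (1 + beta%:R) t)%:E)%E.
Proof.
pose w1 (x : R) : R := (expR u < expR x)%R%:R * expR x.
pose phi (v : R) : R := ln (expR u + expR v).
pose H (t : n.-tuple TR) : \bar R := (expR u * expR (- (expR u + texp t)) *
   ((\prod_(j < n) vdm_factor beta 0 u (tnth t j)) * pairprod (vdm_factor beta 0) t))%:E.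
have phiE v : expR (phi v) = expR u + expR v by rewrite lnK// posrE addr_gt0 ?expR_gt0.
have mu1 : measurable_fun [set: R] (fun x => (expR u < expR x)%R%:R : R).
  rewrite (_ : (fun _ => _) = \1_(`]u, +oo[ : set R)); first exact: measurable_indic.
  by apply/funext => s; rewrite indicE mem_setE in_itv/= andbT ltr_expR.
have mw1 : measurable_fun [set: R] w1 by apply: measurable_funM => //; exact: measurable_expR.
have mphi : measurable_fun [set: R] phi.
  by apply: (measurableT_comp (@measurable_ln R)); apply: measurable_funD.
have mtexp : measurable_fun setT (fun t : n.-tuple TR => texp t).
  by apply: measurable_tsum; exact: measurable_expR.
have mH : measurable_fun setT H.
  apply/measurable_EFinP; apply: measurable_funM; [apply: measurable_funM => //|apply: measurable_funM].
  - apply: (measurableT_comp (@measurable_expR R)); apply: measurableT_comp => //.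
    exact: measurable_funD.
  - apply: (@measurable_prod_tuple _ n (vdm_factor beta 0 u)).
    by have := measurableT_comp (@measurable_vdm_factor R beta 0) (measurable_pair1 u); exact.
  - by apply: measurable_pairprod; exact: measurable_vdm_factor.
have H0 t : (0 <= H t)%E.
  rewrite lee_fin; apply: mulr_ge0; first by rewrite mulr_ge0// expR_ge0.
  by apply: mulr_ge0; [apply: prodr_ge0 => j _|apply: pairprod_ge0 => x y];
    exact: vdm_factor_ge0.
have w10 x : 0 <= w1 x by rewrite mulr_ge0// expR_ge0.
have S (q : R -> \bar R) : measurable_fun [set: R] q -> (forall x, 0 <= q x)%E ->
    (\int[mu]_x ((w1 x)%:E * q x) = \int[mu]_x ((expR x)%:E * q (phi x)))%E.
  by move=> mq q0; apply: ln_addexp_subst => //; exact: expR_ge0.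
have := ge0_integral_map_tuple mphi mw1 (@measurable_expR R) w10 (@expR_ge0 R) S mH H0.
rewrite (_ : (\int[leb n]_t _)%E =
    (\int[leb n]_t ((strict_argmin ord0 [tuple of u :: t])%:R * F 1 [tuple of u :: t])%:E)%E); last first.
  apply: eq_integral => t _; rewrite -EFinM strict_argmin_cons /w1 big_split/=.
  congr (_%:E); rewrite -[LHS]mulrA; congr (_ * _); rewrite /F exp_sweightE swt_cons mul0r addr0 cos0 mulr1 !mul1r.
  by rewrite expRD -expR_sum; ring.
move=> ->; clear S H0 mH; rewrite -ge0_integralZl; last first.
- by rewrite lee_fin; apply: mulr_ge0; exact: expR_ge0.
- by move=> t _; rewrite lee_fin; exact: F0.
- exact: mF.
- exact: measurableT.
apply: eq_integral => t _; rewrite -!EFinM; congr (_%:E).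
have texpE : texp [tuple of map phi t] = n%:R * expR u + texp t.
  rewrite /texp; under eq_bigr do rewrite tnth_map phiE.
  by rewrite big_split/= sumr_const card_ord mulr_natl.
have vE v w : vdm_factor beta 0 (phi v) (phi w) = vdm_factor beta 0 v w.
  by rewrite /vdm_factor !phiE; congr (Num.sqrt (_ ^+ 2 + _) ^+ _); ring.
have pE : pairprod (vdm_factor beta 0) [tuple of map phi t] = pairprod (vdm_factor beta 0) t.
  by apply: eq_bigr => i _; apply: eq_bigr => j _; rewrite !tnth_map vE.
have uE : \prod_(j < n) vdm_factor beta 0 u (tnth [tuple of map phi t] j) = expR (beta%:R * tsum t).
  rewrite expRM_natl /tsum expR_sum -prodrXl; apply: eq_bigr => j _.
  rewrite tnth_map /vdm_factor phiE addr0 sqrtr_sqr; congr (_ ^+ _).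
  by rewrite opprD addrA subrr sub0r normrN ger0_norm ?expR_ge0.
rewrite texpE pE uE -expR_sum /F /sweight mulrDl mul1r -natr1 mulrDl mul1r.
rewrite (_ : - (expR u + (n%:R * expR u + texp t)) = - (n%:R * expR u + expR u) + - texp t); last by ring.
by rewrite !expRD /tsum; ring.
Qed.

(* On the region where the head x_0 is the smallest x_j, the substitution
   x_j = x_0 + y_j separates x_0 from the y_j. *)
Lemma rselb_constS n : rselb n.+1 1 = rselb n (1 + beta%:R).
Proof.
rewrite /rselb /rmom /Rintegral; congr (fine _).
rewrite [LHS]integral_argmin ge0_integral_cons; last 2 first.
- apply/measurable_EFinP; apply: measurable_funM; first exact: measurable_strict_argmin.
  by apply/measurable_EFinP; exact: mF.
- by move=> t; rewrite lee_fin mulr_ge0.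
rewrite (eq_integral (fun u : TR => (expR u * expR (- (n.+1%:R * expR u)))%:E *
  \int[leb n]_t (F (1 + beta%:R) t)%:E)%E); last first.
  by move=> u _; exact: integral_argmin_cons.
rewrite ge0_integralZr//.
(* The integral over x_0 is 1 / (n + 1), which cancels the number of regions. *)
- by rewrite integral_expexp ?ltr0n// muleA -EFinM divff ?mul1e// pnatr_eq0.
- apply/measurable_EFinP; apply: measurable_funM => //.
  by apply: (measurableT_comp (@measurable_expR R)); apply: measurableT_comp => //;
    apply: measurable_funM.
- by apply: integral_ge0 => t _; rewrite lee_fin.
Qed.

Definition selberg_constant n : R :=
  \prod_(j < n) (rselb 1 (1 + j.+1%:R * g) / rselb 1 (1 + g)).

(** [rselb_constS] expresses the constant for n + 1 variables by the value at 1 + beta for n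
    variables, which [selb_gamprod] evaluates. That lemma requires positivity, which is itself read
    off the formula, so both are proved together. *)
Lemma rselb_base n : 0 < rselb n 1 /\ rselb n 1 = selberg_constant n * rgamprod beta n 1.
Proof.
have g0 : 0 < g by rewrite divr_gt0 ?ltr0n.
have gg : g + g = beta%:R by rewrite -splitr.
have p0 j : 0 < rselb 1 (1 + j%:R * g) by apply: rgam_gt0 => //; rewrite ltr_pwDl// mulr_ge0// ltW.
have p1 : 0 < rselb 1 (1 + g) by have := p0 1%N; rewrite mul1r.
have c0 n' : 0 < selberg_constant n' by apply: prodr_gt0 => j _; rewrite divr_gt0.
suff E : rselb n 1 = selberg_constant n * rgamprod beta n 1.
  by rewrite E; split=> //; rewrite mulr_gt0// rgamprod_gt0.
elim: n => [|n IH].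
  rewrite /selberg_constant /rgamprod !big_ord0 mulr1 /rselb /rmom /Rintegral integral_tuple0/=.
  by rewrite /sweight /tsum /texp /pairprod !big_ord0 mulr0 oppr0 expR0 !mulr1.
have rn : 0 < rselb n 1 by rewrite IH mulr_gt0// rgamprod_gt0.
have b0 : 0 < complex.Re (1 + beta%:R : R)%:C by rewrite /= ltr_pwDl.
have := selb_gamprod beta_gt0 rn b0; rewrite selb_real gamprod_real -!rmorphM/= => /complexI.
rewrite -rselb_constS => H.
have q0 : rgamprod beta n (1 : R) != 0 by rewrite gt_eqF// rgamprod_gt0.
apply: (mulIf q0); rewrite H IH mulrAC; congr (_ * _).
rewrite /selberg_constant big_ord_recr/= -!mulrA; congr (_ * _).
(* As beta = 2 g, raising the argument by beta moves the product by two factors; those missing at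
   the start are Gamma (1) = 1 and Gamma (1 + g). *)
have X : (rselb 1 1 * rselb 1 (1 + g)) * rgamprod beta n (1 + beta%:R) = rgamprod beta n.+2 1.
  rewrite /rgamprod !big_ord_recl/= !mul0r !addr0 mul1r mulrA; congr (_ * _ * _).
  by apply: eq_bigr => j _; congr (rselb 1 _); rewrite /bump/= !add1n -!natr1; field.
have Y : rgamprod beta n.+2 1 = rgamprod beta n.+1 1 * rselb 1 (1 + n.+1%:R * g).
  by rewrite /rgamprod big_ord_recr.
apply: (mulfI (lt0r_neq0 p1)); move: X; rewrite Y rgam1 mul1r => ->.
by field; exact: lt0r_neq0.
Qed.

Lemma selbE_gamprod n (z : R[i]) : 0 < complex.Re z ->
  selb n z = (selberg_constant n)%:C * gamprod beta n z.
Proof.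
move=> z0; have [r0 rE] := rselb_base n.
have q0 : (rgamprod beta n (1 : R))%:C != 0.
  by rewrite eq_complex/= eqxx andbT gt_eqF// rgamprod_gt0.
by apply: (mulIf q0); rewrite selb_gamprod// rE rmorphM/= mulrAC.
Qed.

End SelbergConstant.

(** * Euler's integral as the Selberg integral in one variable *)

Section EulerGamma.
Context {R : realType}.
Notation mu := (@lebesgue_measure R).
Notation TR := (measurableTypeR R).
Notation leb := (@lebesgue_tuple R).
Variable beta : nat.
Local Open Scope complex_scope.

Lemma integral_expR_tuple1 (f : R -> R) : measurable_fun [set: R] f ->
  (\int[mu]_(x in `]0%R, +oo[) (f x)%:E =
   \int[leb 1]_t (expR (tsum t) * f (expR (tsum t)))%:E)%E.
Proof.
move=> mf.
have mexp : measurable_fun setT (fun t : 1.-tuple TR => expR (tsum t)).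
  by apply: (measurableT_comp (@measurable_expR R)); exact: measurable_tsumT.
have P (h : R -> R) : measurable_fun [set: R] h -> (forall x, 0 <= h x) ->
    (\int[mu]_(x in `]0%R, +oo[) (h x)%:E =
     \int[leb 1]_t (expR (tsum t) * h (expR (tsum t)))%:E)%E.
  move=> mh h0; rewrite (ge0_integral_expR (g := EFin \o h)); last 2 first.
  - by apply/measurable_EFinP.
  - by move=> x; rewrite lee_fin.
  rewrite ge0_integral_cons; last 2 first.
  - apply/measurable_EFinP; apply: measurable_funM => //.
    exact: (measurableT_comp mh).
  - by move=> t; rewrite lee_fin mulr_ge0// expR_ge0.
  apply: eq_integral => u _; rewrite integral_tuple0 EFinM.
  by rewrite /tsum big_ord1.
have mE D : measurable_fun D (EFin \o f) by apply/measurable_EFinP; exact: measurable_funTS.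
rewrite [LHS]integralE [RHS]integralE.
pose fp x := Num.max (f x) 0; pose fn x := Num.max (- f x) 0.
have mfp : measurable_fun [set: R] fp by apply: measurable_maxr.
have mfn : measurable_fun [set: R] fn by apply: measurable_maxr => //; exact: measurable_funN.
congr (_ - _)%E.
- transitivity (\int[mu]_(x in `]0%R, +oo[) (fp x)%:E)%E.
    by apply: eq_integral => x _; rewrite /fp funeposE -EFin_max.
  rewrite P//; last by move=> x; rewrite /fp le_max lexx orbT.
  apply: eq_integral => t _; rewrite /fp funeposE -EFin_max.
  by rewrite maxr_pMr ?expR_ge0// mulr0.
- transitivity (\int[mu]_(x in `]0%R, +oo[) (fn x)%:E)%E.
    by apply: eq_integral => x _; rewrite /fn funenegE -EFin_max.
  rewrite P//; last by move=> x; rewrite /fn le_max lexx orbT.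
  apply: eq_integral => t _; rewrite /fn funenegE -EFin_max -mulrN.
  by rewrite maxr_pMr ?expR_ge0// mulr0.
Qed.

(** The substitution t = e ^ u. A single variable forms no pair, so the equality holds for every
    beta. *)
Lemma cGammaE (z : R[i]) : cGamma z = selb beta 1 z.
Proof.
have mln : measurable_fun [set: R] (@ln R) by exact: measurable_ln.
have mcos (y : R) : measurable_fun [set: R] (fun x : R => cos (y * ln x)).
  by apply: measurableT_comp; [apply: continuous_measurable_fun; exact: continuous_cos|exact: measurable_funM].
have msin (y : R) : measurable_fun [set: R] (fun x : R => sin (y * ln x)).
  by apply: measurableT_comp; [apply: continuous_measurable_fun; exact: continuous_sin|exact: measurable_funM].
have me (a : R) : measurable_fun [set: R] (fun x : R => expR (- x) * expR (a * ln x)).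
  apply: measurable_funM; apply: (measurableT_comp (@measurable_expR R)) => //.
  exact: measurable_funM.
have W (t : 1.-tuple R) : sweight beta t = expR (- expR (tsum t)).
  rewrite /sweight /tsum /texp /pairprod !big_ord1 big_pred0 ?mulr1//.
  by move=> j; rewrite ltnNge leq_ord.
case: z => a y; rewrite /cGamma /cintegral /selb cmomE.
congr (_ +i* _); rewrite /Rintegral; congr (fine _).
- transitivity (\int[mu]_(x in `]0%R, +oo[)
      (expR (- x) * expR ((a - 1) * ln x) * cos (y * ln x))%:E)%E.
    by apply: eq_integral => x _; rewrite /cpow/= subr0 !(mul0r, mulr0) !subr0 mulrA.
  rewrite (integral_expR_tuple1 (f := fun x => _ * _ * _)); last exact: measurable_funM.
  apply: eq_integral => t _; rewrite expRK W addr0 mulrBl mul1r expRB; congr (_%:E).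
  by field; rewrite gt_eqF// expR_gt0.
- transitivity (\int[mu]_(x in `]0%R, +oo[)
      (expR (- x) * expR ((a - 1) * ln x) * sin (y * ln x))%:E)%E.
    by apply: eq_integral => x _; rewrite /cpow/= subr0 !(mul0r, mulr0) !(addr0, add0r) mulrA.
  rewrite (integral_expR_tuple1 (f := fun x => _ * _ * _)); last exact: measurable_funM.
  apply: eq_integral => t _; rewrite expRK W mulrBl mul1r expRB; congr (_%:E).
  rewrite (_ : - pi / 2 = - (pi / 2)) ?mulNr// cosB cos_pihalf sin_pihalf mulr0 add0r mulr1.
  by field; rewrite gt_eqF// expR_gt0.
Qed.

End EulerGamma.

(** * Slicing by the product of the variables *)

Section Slice.
Context {R : realType}.
Notation mu := (@lebesgue_measure R).
Notation TR := (measurableTypeR R).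
Notation leb := (@lebesgue_tuple R).
Variable beta : nat.
Local Notation g := (beta%:R / 2 : R).

Definition shift_tuple n (s : R) (t : n.-tuple R) : n.-tuple R :=
  [tuple of map (fun x => x + s) t].

Lemma tsum_shift n s (t : n.-tuple R) : tsum (shift_tuple s t) = tsum t + n%:R * s.
Proof.
rewrite /tsum; under eq_bigr do rewrite tnth_map.
by rewrite big_split/= sumr_const card_ord mulr_natl.
Qed.

Lemma texp_shift n s (t : n.-tuple R) : texp (shift_tuple s t) = expR s * texp t.
Proof.
rewrite /texp mulr_sumr; apply: eq_bigr => i _.
by rewrite tnth_map expRD mulrC.
Qed.

Lemma vdm_factor_shift (s u v : R) :
  vdm_factor beta 0 (u + s) (v + s) = expR (beta%:R * s) * vdm_factor beta 0 u v.
Proof.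
rewrite /vdm_factor !addr0 !sqrtr_sqr !expRD -mulrBl normrM exprMn.
by rewrite (ger0_norm (expR_ge0 s)) -expRM_natl mulrC.
Qed.

(** Each of the n (n - 1) / 2 pair factors contributes e ^ (beta s). *)
Lemma pairprod_shift n s (t : n.-tuple R) :
  pairprod (vdm_factor beta 0) (shift_tuple s t) =
  expR (g * (n%:R * (n%:R - 1)) * s) * pairprod (vdm_factor beta 0) t.
Proof.
elim: n t => [|n IH] t; first by rewrite /pairprod !big_ord0 mul0r mulr0 mul0r expR0 mul1r.
have [x [t' ->]] : exists x (t' : n.-tuple R), t = [tuple of x :: t']
  by exists (thead t), [tuple of behead t]; apply: val_inj; case: t => -[].
have -> : shift_tuple s [tuple of x :: t'] = [tuple of x + s :: shift_tuple s t'] by apply: val_inj.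
rewrite !pairprod_cons IH; under eq_bigr do rewrite tnth_map vdm_factor_shift.
rewrite big_split/= prodr_const card_ord -expRM_natl.
have -> : g * (n.+1%:R * (n.+1%:R - 1)) * s = n%:R * (beta%:R * s) + g * (n%:R * (n%:R - 1)) * s.
  by rewrite -natr1; field.
by rewrite expRD; ring.
Qed.

(** In the variables x = e ^ u this parametrises the hypersurface where the product of the x_j is
    1. *)
Definition zcons n (t : n.-tuple R) : n.+1.-tuple R := [tuple of - tsum t :: t].

Lemma measurable_zcons n : measurable_fun setT (@zcons n : n.-tuple TR -> n.+1.-tuple TR).
Proof.
apply: (measurable_cons (f := fun t : n.-tuple TR => - tsum t : TR) (g := id)) => //.
by apply: measurable_funN; exact: measurable_tsumT.
Qed.

Lemma measurable_add (s : R) : measurable_fun [set: R] (fun x : R => x + s).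
Proof. exact: measurable_funD. Qed.

Lemma ge0_integral_shift_tuple n (s : R) (F : n.-tuple TR -> \bar R) :
  measurable_fun setT F -> (forall t, 0 <= F t)%E ->
  (\int[leb n]_t F (shift_tuple s t) = \int[leb n]_t F t)%E.
Proof.
move=> mF F0.
have P1 m (t : m.-tuple TR) : (\prod_(i < m) cst 1 (tnth t i))%:E = 1%E :> \bar R by rewrite big1.
have E := @ge0_integral_map_tuple R _ (cst 1) (cst 1) (measurable_add s)
  (measurable_cst _) (measurable_cst _) (fun _ => ler01) (fun _ => ler01) _ n F mF F0.
transitivity (\int[leb n]_t ((\prod_(i < n) cst 1%R (tnth t i))%:E * F [tuple of map (fun x => x + s)%R t]))%E.
  by apply: eq_integral => t _; rewrite P1 mul1e.
rewrite -E; first by apply: eq_integral => t _; rewrite P1 mul1e.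
move=> h mh h0; transitivity (\int[mu]_x h x)%E.
  by apply: eq_integral => x _; rewrite mul1e.
rewrite -(ge0_integral_translate s mh h0).
by apply: eq_integral => x _; rewrite mul1e.
Qed.

(* The tuple is written as s + u with u of sum zero; the first entry of u is
   determined by the others. *)
Lemma ge0_integral_slice n (F : n.+1.-tuple TR -> \bar R) :
  measurable_fun setT F -> (forall t, 0 <= F t)%E ->
  (\int[leb n.+1]_t F t =
   n.+1%:R%:E * \int[mu]_s \int[leb n]_t F (shift_tuple s (zcons t)))%E.
Proof.
move=> mF F0.
(* The map (s, t) |-> s + [zcons] t is composed of three steps: scaling the head by n + 1, which
   gives the Jacobian; translating the tail by s; and this shear, which preserves the measure. *)
pose sub (t : n.+1.-tuple TR) : n.+1.-tuple TR :=
  [tuple of (thead t - tsum [tuple of behead t]) :: [tuple of behead t]].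
have msub : measurable_fun setT sub.
  apply: (measurable_cons (f := fun t : n.+1.-tuple TR => (thead t - tsum [tuple of behead t]) : TR)
     (g := fun t : n.+1.-tuple TR => [tuple of behead t])); last exact: measurable_behead.
  apply: measurable_funB; first exact: measurable_tnth.
  apply: (measurableT_comp (f := fun t : n.-tuple TR => tsum t)
    (g := fun t : n.+1.-tuple TR => [tuple of behead t])).
    exact: measurable_tsumT.
  exact: measurable_behead.
have subE (x : R) (t : n.-tuple TR) : sub [tuple of x :: t] = [tuple of x - tsum t :: t].
  rewrite /sub theadE; apply: val_inj => /=; congr (_ - _ :: _).
  by congr tsum; apply: val_inj.
have mFs : measurable_fun setT (fun t => F (sub t)) by exact: measurableT_comp.
have Fs0 t : (0 <= F (sub t))%E by exact: F0.
transitivity (\int[leb n.+1]_t F (sub t))%E.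
  rewrite (ge0_integral_cons2 mF F0) (ge0_integral_cons2 mFs Fs0); apply: eq_integral => t _.
  under [RHS]eq_integral do rewrite subE.
  rewrite (ge0_integral_translate (- tsum t) (g := fun x => F [tuple of x :: t]))//.
  by apply: (measurableT_comp mF); exact: measurable_cons2.
rewrite (ge0_integral_cons mFs Fs0).
rewrite (ge0_integral_scale (ltr0Sn R n) (measurable_fun_cons_integral mFs Fs0)); last first.
  by move=> x; apply: integral_ge0 => t _; exact: Fs0.
congr (_ * _)%E; apply: eq_integral => s _.
rewrite -(ge0_integral_shift_tuple s); last 2 first.
- exact: (measurable_cons_comp _ mFs).
- by [].
apply: eq_integral => t _; rewrite subE; congr (F _).
apply: val_inj; rewrite /= tsum_shift; congr (_ :: _).
by rewrite -natr1; ring.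
Qed.

Definition slice_weight n (t : n.-tuple R) : R := pairprod (vdm_factor beta 0) (zcons t).

Lemma slice_weight_ge0 n (t : n.-tuple R) : 0 <= slice_weight t.
Proof. by apply: pairprod_ge0; exact: vdm_factor_ge0. Qed.

Lemma measurable_slice_weight n :
  measurable_fun setT (fun t : n.-tuple TR => slice_weight t).
Proof.
apply: (measurableT_comp (f := fun t : n.+1.-tuple TR => pairprod (vdm_factor beta 0) t)).
  by apply: measurable_pairprod; exact: measurable_vdm_factor.
exact: measurable_zcons.
Qed.

Lemma measurable_texp_zcons n :
  measurable_fun setT (fun t : n.-tuple TR => texp (zcons t)).
Proof.
apply: (measurableT_comp (f := fun t : n.+1.-tuple TR => texp t)).
  by apply: measurable_tsum; exact: measurable_expR.
exact: measurable_zcons.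
Qed.

Lemma texp_ge0 n (t : n.-tuple R) : 0 <= texp t.
Proof. by apply: sumr_ge0 => i _; exact: expR_ge0. Qed.

(* Up to the substitution sigma = expR (t / 2), the distribution function of
   the sum of squares on the hypersurface of unit product. *)
Definition slice_distr n (x : R) : \bar R :=
  (\int[leb n]_t (slice_weight t * (texp (zcons t) <= expR x)%R%:R)%:E)%E.

Lemma measurable_le_fun d (T : measurableType d) (f h : T -> R) :
  measurable_fun setT f -> measurable_fun setT h ->
  measurable_fun setT (fun x => (f x <= h x)%R%:R : R).
Proof.
move=> mf mh.
rewrite (_ : (fun _ => _) = (fun x : R => (0 <= x)%R%:R : R) \o (fun x => h x - f x)); last first.
  by apply/funext => x /=; rewrite subr_ge0.
apply: measurableT_comp; last exact: measurable_funB.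
rewrite (_ : (fun _ => _) = \1_(`[0, +oo[ : set R)); first exact: measurable_indic.
by apply/funext => s; rewrite indicE mem_setE in_itv/= andbT.
Qed.

Lemma slice_distr_ge0 n x : (0 <= slice_distr n x)%E.
Proof. by apply: integral_ge0 => t _; rewrite lee_fin mulr_ge0// slice_weight_ge0. Qed.

Lemma slice_distr_le n x y : x <= y -> (slice_distr n x <= slice_distr n y)%E.
Proof.
move=> xy; apply: ge0_le_integral => //.
- by move=> t _; rewrite lee_fin mulr_ge0// slice_weight_ge0.
- apply/measurable_EFinP; apply: measurable_funM; first exact: measurable_slice_weight.
  by apply: measurable_le_fun => //; exact: measurable_texp_zcons.
- apply/measurable_EFinP; apply: measurable_funM; first exact: measurable_slice_weight.
  by apply: measurable_le_fun => //; exact: measurable_texp_zcons.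
- move=> t _; rewrite lee_fin ler_wpM2l ?slice_weight_ge0//.
  case: (leP (texp (zcons t)) (expR x)) => // tx.
  by rewrite (le_trans tx)// ler_expR.
Qed.

(** Writes the exponential as an average of indicator functions, which is how [slice_distr] arises
    from the weight. *)
Lemma integral_exp_tail (c : R) : 0 <= c ->
  (\int[mu]_s (expR s * expR (- expR s) * (c <= expR s)%R%:R)%:E = (expR (- c))%:E)%E.
Proof.
move=> c0.
have mc (a : R) : measurable_fun [set: R] (fun x : R => (a <= x)%R%:R : R).
  by apply: measurable_le_fun.
have me : measurable_fun [set: R] (fun x : R => expR (- x)).
  by apply: (measurableT_comp (@measurable_expR R)).
pose G (x : R) : \bar R := (expR (- x) * (c <= x)%R%:R)%:E.
have mG : measurable_fun [set: R] G by apply/measurable_EFinP; exact: measurable_funM.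
have G0 x : (0 <= G x)%E by rewrite lee_fin mulr_ge0// expR_ge0.
transitivity (\int[mu]_(x in `]0%R, +oo[) G x)%E.
  by rewrite ge0_integral_expR//; apply: eq_integral => s _; rewrite -EFinM mulrA.
rewrite integral_itv_obnd_cbnd; last exact: measurable_funTS.
transitivity (\int[mu]_x G x)%E.
  rewrite integral_indicE//; apply: eq_integral => s _; rewrite mem_setE in_itv/= andbT /G.
  have [|s0] := leP 0 s; first by rewrite mul1e.
  by rewrite leNgt (lt_le_trans s0 c0) mulr0 mule0.
rewrite -(ge0_integral_translate c mG G0).
transitivity ((expR (- c))%:E * \int[mu]_(x in `[0%R, +oo[) (expR (- (1 * x)))%:E)%E.
  rewrite [X in (_ * X)%E]integral_indicE; last exact: measurable_itv.
  rewrite -ge0_integralZl; last first.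
  - by rewrite lee_fin expR_ge0.
  - by move=> x _; rewrite mule_ge0// lee_fin expR_ge0.
  - apply: emeasurable_funM.
      apply/measurable_EFinP; rewrite (_ : (fun _ => _) = \1_(`[0, +oo[ : set R)); first exact: measurable_indic.
      by apply/funext => s; rewrite indicE.
    apply/measurable_EFinP; apply: (measurableT_comp (@measurable_expR R)).
    by apply: measurableT_comp => //; exact: measurable_funM.
  - exact: measurableT.
  apply: eq_integral => x _; rewrite mem_setE in_itv/= andbT /G lerDr -!EFinM mul1r.
  by rewrite opprD expRD; congr (_%:E); ring.
by rewrite integral_expRN_cy// invr1 mule1.
Qed.

End Slice.

(** * The Selberg integral as a convolution *)

Section SliceTransform.
Context {R : realType}.
Notation mu := (@lebesgue_measure R).
Notation TR := (measurableTypeR R).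
Notation leb := (@lebesgue_tuple R).
Variable beta : nat.
Local Notation g := (beta%:R / 2 : R).
Local Notation slice_distr := (@slice_distr R beta).
Local Notation slice_weight := (@slice_weight R beta _).

Lemma measurable_slice_integrand n (f : R -> R) d (T : measurableType d) (h : T -> R) :
  measurable_fun setT h ->
  measurable_fun setT (fun z : T * n.-tuple TR =>
    slice_weight z.2 * (texp (zcons z.2) <= expR (h z.1))%R%:R).
Proof.
move=> mh; apply: measurable_funM.
  apply: (measurableT_comp (f := fun t : n.-tuple TR => slice_weight t)); last exact: measurable_snd.
  exact: measurable_slice_weight.
apply: measurable_le_fun.
  apply: (measurableT_comp (f := fun t : n.-tuple TR => texp (zcons t))); last exact: measurable_snd.
  exact: measurable_texp_zcons.
apply: (measurableT_comp (@measurable_expR R)).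
exact: (measurableT_comp mh).
Qed.

Lemma measurable_slice_distr n : measurable_fun setT (slice_distr n : TR -> \bar R).
Proof.
apply: (@measurable_fun_fubini_tonelli_F _ _ _ _ R (leb n) (fun z : TR * n.-tuple TR =>
    (slice_weight z.2 * (texp (zcons z.2) <= expR z.1)%R%:R)%:E)).
  apply/measurable_EFinP; apply: (@measurable_slice_integrand n id _ TR id).
  exact: measurable_id.
by move=> z; rewrite lee_fin mulr_ge0// slice_weight_ge0.
Qed.

(** [integral_exp_tail] at c = e ^ s T under the integral sign, then Tonelli's theorem; the
    condition e ^ s T <= e ^ x is T <= e ^ (x - s). *)
Lemma slice_laplace n (s : R) :
  (\int[leb n]_t (slice_weight t * expR (- (expR s * texp (zcons t))))%:E =
   \int[mu]_x ((expR x * expR (- expR x))%:E * slice_distr n (x - s)))%E.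
Proof.
pose f (z : TR * n.-tuple TR) : \bar R := ((expR z.1 * expR (- expR z.1))%:E *
  (slice_weight z.2 * (texp (zcons z.2) <= expR (z.1 - s))%R%:R)%:E)%E.
have mA : measurable_fun [set: R] (fun x : R => expR x * expR (- expR x)).
  apply: measurable_funM => //; apply: (measurableT_comp (@measurable_expR R)).
  exact: measurableT_comp.
have mf : measurable_fun setT f.
  apply: emeasurable_funM; apply/measurable_EFinP.
    apply: (measurableT_comp (f := fun x : R => expR x * expR (- expR x))) => //.
  by apply: (@measurable_slice_integrand n id _ TR (fun x => x - s)); exact: measurable_add.
have A0 (x : R) : 0 <= expR x * expR (- expR x) by rewrite mulr_ge0// expR_ge0.
have f0 z : (0 <= f z)%E.
  by apply: mule_ge0; rewrite lee_fin// mulr_ge0// slice_weight_ge0.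
transitivity (\int[leb n]_t \int[mu]_x f (x, t))%E.
  apply: eq_integral => t _.
  transitivity ((slice_weight t)%:E * \int[mu]_x
     (expR x * expR (- expR x) * (expR s * texp (zcons t) <= expR x)%R%:R)%:E)%E.
    by rewrite integral_exp_tail ?mulr_ge0 ?expR_ge0 ?texp_ge0.
  rewrite -ge0_integralZl; last first.
  - by rewrite lee_fin slice_weight_ge0.
  - by move=> x _; rewrite lee_fin mulr_ge0.
  - apply/measurable_EFinP; apply: measurable_funM => //.
    by apply: measurable_le_fun.
  - exact: measurableT.
  apply: eq_integral => x _; rewrite /f /= -!EFinM (expRB x s) ler_pdivlMr ?expR_gt0//.
  by rewrite [texp _ * _]mulrC; congr (_%:E); ring.
rewrite -(fubini_tonelli (m1 := mu) (m2 := leb n) f mf f0).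
apply: eq_integral => x _; rewrite /f /= ge0_integralZl; first by [].
- exact: measurableT.
- apply/measurable_EFinP; apply: measurable_funM; first exact: measurable_slice_weight.
  by apply: measurable_le_fun => //; exact: measurable_texp_zcons.
- by move=> t _; rewrite lee_fin mulr_ge0// slice_weight_ge0.
- by rewrite lee_fin.
Qed.

Lemma tsum_zcons n (t : n.-tuple R) : tsum (zcons t) = 0.
Proof.
rewrite /tsum big_ord_recl /zcons tnth0; under eq_bigr do rewrite tnthS.
by rewrite addNr.
Qed.

(** The degree of homogeneity of the Vandermonde product to the power beta in n + 1 variables. *)
Definition slice_exponent n : R := g * (n.+1%:R * n%:R).

(* The factor e ^ (- e ^ s T) is e ^ x e ^ (- e ^ x) integrated over
   e ^ x >= e ^ s T: the left-hand side is a convolution. *)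
Lemma integral_slice_tsum n (phi : R -> \bar R) : measurable_fun [set: R] phi ->
  (forall x, 0 <= phi x)%E ->
  (\int[leb n.+1]_t (phi (tsum t) * (sweight beta t)%:E) =
   n.+1%:R%:E * \int[mu]_x \int[mu]_u
     (phi (n.+1%:R * (x + u))%R *
      ((expR (slice_exponent n * (x + u)) * (expR x * expR (- expR x)))%:E *
       slice_distr n (- u)%R)))%E.
Proof.
move=> mphi phi0; set e := slice_exponent n.
have mA : measurable_fun [set: R] (fun x : R => expR x * expR (- expR x)).
  apply: measurable_funM => //; apply: (measurableT_comp (@measurable_expR R)).
  exact: measurableT_comp.
have A0 (x : R) : 0 <= expR x * expR (- expR x) by rewrite mulr_ge0// expR_ge0.
have K0 x : (0 <= slice_distr n x)%E by exact: slice_distr_ge0.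
have mphiN : measurable_fun [set: R] (fun s : R => phi (n.+1%:R * s)).
  by apply: (measurableT_comp mphi); exact: measurable_funM.
have me : measurable_fun [set: R] (fun s : R => expR (e * s)).
  by apply: (measurableT_comp (@measurable_expR R)); exact: measurable_funM.
rewrite ge0_integral_slice; last 2 first.
- apply: emeasurable_funM; first by apply: (measurableT_comp mphi); exact: measurable_tsumT.
  by apply/measurable_EFinP; exact: measurable_sweight.
- by move=> t; rewrite mule_ge0// lee_fin sweight_ge0.
congr (_ * _)%E.
pose G (z : TR * TR) : \bar R := (phi (n.+1%:R * z.1)%R *
   ((expR (e * z.1) * (expR z.2 * expR (- expR z.2)))%:E * slice_distr n (z.2 - z.1)%R))%E.
have mG : measurable_fun setT G.
  apply: emeasurable_funM; first by apply: (measurableT_comp mphiN); exact: measurable_fst.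
  apply: emeasurable_funM.
    apply/measurable_EFinP; apply: measurable_funM.
      by apply: (measurableT_comp me); exact: measurable_fst.
    by apply: (measurableT_comp mA); exact: measurable_snd.
  apply: (measurableT_comp (@measurable_slice_distr n)).
  by apply: measurable_funB; [exact: measurable_snd|exact: measurable_fst].
have G0 z : (0 <= G z)%E.
  apply: mule_ge0; first exact: phi0.
  by apply: mule_ge0; [rewrite lee_fin mulr_ge0// expR_ge0|exact: K0].
transitivity (\int[mu]_s \int[mu]_x G (s, x))%E.
  apply: eq_integral => s _.
  transitivity (phi (n.+1%:R * s)%R * ((expR (e * s))%:E *
    \int[leb n]_t (slice_weight t * expR (- (expR s * texp (zcons t))))%:E))%E.
    have mI : measurable_fun setT (fun t : n.-tuple TR =>
        (slice_weight t * expR (- (expR s * texp (zcons t))))%:E).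
      apply/measurable_EFinP; apply: measurable_funM; first exact: measurable_slice_weight.
      apply: (measurableT_comp (@measurable_expR R)); apply: measurableT_comp => //.
      by apply: measurable_funM => //; exact: measurable_texp_zcons.
    have I0 (t : n.-tuple TR) : (0 <= (slice_weight t * expR (- (expR s * texp (zcons t))))%:E)%E.
      by rewrite lee_fin mulr_ge0 ?slice_weight_ge0 ?expR_ge0.
    rewrite muleA -ge0_integralZl; last first.
    - by rewrite mule_ge0// lee_fin expR_ge0.
    - by move=> t _; exact: I0.
    - exact: mI.
    - exact: measurableT.
    apply: eq_integral => t _.
    rewrite tsum_shift tsum_zcons add0r -muleA -EFinM; congr (_ * _%:E)%E.
    rewrite /sweight texp_shift pairprod_shift /e /slice_exponent.
    have -> : n.+1%:R * (n.+1%:R - 1) = n.+1%:R * n%:R :> R by rewrite -natr1 addrK.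
    by rewrite /slice_weight; ring.
  rewrite slice_laplace /G /= muleA -ge0_integralZl; last first.
  - by rewrite mule_ge0// lee_fin expR_ge0.
  - by move=> x _; rewrite mule_ge0// lee_fin.
  - apply: emeasurable_funM; first exact/measurable_EFinP.
    by apply: (measurableT_comp (@measurable_slice_distr n)); exact: measurable_add.
  - exact: measurableT.
  by apply: eq_integral => x _; rewrite (EFinM (expR (e * s))) !muleA.
transitivity (\int[mu]_x \int[mu]_s G (s, x))%E.
  exact: (@fubini_tonelli _ _ _ _ R mu mu G mG G0).
apply: eq_integral => x _.
(* With s = u + x the distribution is evaluated at - u, independently of x. *)
rewrite -(ge0_integral_translate x (g := fun s => G (s, x))); last 2 first.
- apply: (@measurableT_comp _ _ _ _ _ _ G _ (fun s : TR => (s, x)) mG).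
  exact: measurable_pair2.
- by move=> s; exact: G0.
apply: eq_integral => u _; rewrite /G /= [u + x]addrC; congr (_ * (_ * slice_distr n _))%E.
by ring.
Qed.

End SliceTransform.

(** * Finiteness and local regularity of the slice distribution *)

Section SliceRegularity.
Context {R : realType}.
Notation mu := (@lebesgue_measure R).
Notation TR := (measurableTypeR R).
Notation leb := (@lebesgue_tuple R).
Variable beta : nat.
Local Notation slice_distr := (@slice_distr R beta).
Local Notation slice_weight := (@slice_weight R beta _).

Lemma zcons_le n (m : R) (t : n.-tuple R) i : texp (zcons t) <= expR m -> tnth (zcons t) i <= m.
Proof.
move=> h; rewrite -ler_expR; apply: le_trans h.
by rewrite /texp (bigD1 i)//= lerDl sumr_ge0// => j _; exact: expR_ge0.
Qed.

(** The entries have sum zero, and each of the n others is at most m. *)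
Lemma zcons_ge n (m : R) (t : n.-tuple R) i : texp (zcons t) <= expR m ->
  - (n%:R * m) <= tnth (zcons t) i.
Proof.
move=> h; have := tsum_zcons t; rewrite /tsum (bigD1 i)//= => /eqP; rewrite addr_eq0 => /eqP ->.
rewrite lerN2; apply: (@le_trans _ _ (\sum_(j < n.+1 | j != i) m)).
  by apply: ler_sum => j _; exact: zcons_le.
by rewrite sumr_const cardC1 card_ord/= mulr_natl.
Qed.

Definition slice_bound n (m : R) : R :=
  \prod_(i < n.+1) \prod_(j < n.+1 | (i < j)%N) expR m ^+ beta.

Lemma slice_bound_ge0 n m : 0 <= slice_bound n m.
Proof. by apply: prodr_ge0 => i _; apply: prodr_ge0 => j _; rewrite exprn_ge0 ?expR_ge0. Qed.

Lemma slice_weight_le n (m : R) (t : n.-tuple R) : texp (zcons t) <= expR m ->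
  slice_weight t <= slice_bound n m.
Proof.
move=> h; apply: ler_prod => i _; rewrite prodr_ge0 => [|j _]; last exact: vdm_factor_ge0.
apply: ler_prod => j _; rewrite vdm_factor_ge0 /vdm_factor addr0 sqrtr_sqr.
apply: lerXn2r; rewrite ?nnegrE ?expR_ge0// ler_norml.
have ub k : expR (tnth (zcons t) k) <= expR m by rewrite ler_expR zcons_le.
have := ub i; have := ub j.
have := expR_gt0 (tnth (zcons t) i); have := expR_gt0 (tnth (zcons t) j).
by move=> *; apply/andP; split; lra.
Qed.

Definition box (c x : R) : R := (- c <= x <= c)%R%:R.

Lemma box_ge0 c x : 0 <= box c x. Proof. exact: ler0n. Qed.

Lemma measurable_box c : measurable_fun [set: R] (box c).
Proof.
rewrite (_ : box c = \1_(`[- c, c] : set R)); first exact: measurable_indic.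
by apply/funext => s; rewrite indicE mem_setE in_itv.
Qed.

Lemma integral_box c : 0 <= c -> (\int[mu]_x (box c x)%:E = (2 * c)%:E)%E.
Proof.
move=> c0; transitivity (\int[mu]_x (\1_(`[- c, c] : set R) x)%:E)%E.
  by apply: eq_integral => x _; rewrite indicE mem_setE in_itv.
transitivity (mu (`[- c, c]%classic : set R)).
  by rewrite integral_indic// setIT.
rewrite lebesgue_measure_itv/= lte_fin.
case: ltP => h; rewrite ?EFinN ?oppeK -?EFinD; congr (_%:E); lra.
Qed.

Lemma integrable_box c : 0 <= c -> mu.-integrable setT (EFin \o box c).
Proof.
move=> c0; apply/integrableP; split; first by apply/measurable_EFinP; exact: measurable_box.
under eq_integral do rewrite /= ger0_norm ?box_ge0//.
by rewrite integral_box// ltry.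
Qed.

Lemma slice_box n (m : R) (t : n.-tuple R) : 0 <= m -> texp (zcons t) <= expR m ->
  \prod_(i < n) box (n.+1%:R * m) (tnth t i) = 1.
Proof.
move=> m0 h; rewrite big1// => i _; rewrite /box.
have nm : 0 <= n%:R * m by rewrite mulr_ge0.
have := zcons_le (lift ord0 i) h; have := zcons_ge (lift ord0 i) h.
rewrite tnthS -natr1 => h1 h2; rewrite (_ : (_ <= _ <= _) = true)//.
by apply/andP; split; lra.
Qed.

(** For x >= 0 the integrand is bounded and supported in a box; monotonicity reduces to this
    case. *)
Lemma slice_distr_lty n x : (slice_distr n x < +oo)%E.
Proof.
wlog x0 : x / 0 <= x.
  move=> H; apply: (@le_lt_trans _ _ (slice_distr n (Num.max x 0))).
    by apply: slice_distr_le; rewrite le_max lexx.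
  by apply: H; rewrite le_max lexx orbT.
have c0 : 0 <= n.+1%:R * x by rewrite mulr_ge0.
apply: (@le_lt_trans _ _ (\int[leb n]_t ((slice_bound n x)%:E *
    (\prod_(i < n) box (n.+1%:R * x) (tnth t i))%:E))%E).
  apply: ge0_le_integral => //.
  - by move=> t _; rewrite lee_fin mulr_ge0// slice_weight_ge0.
  - apply/measurable_EFinP; apply: measurable_funM; first exact: measurable_slice_weight.
    by apply: measurable_le_fun => //; exact: measurable_texp_zcons.
  - apply: emeasurable_funM => //; apply/measurable_EFinP.
    by apply: measurable_prod_tuple; exact: measurable_box.
  - move=> t _; rewrite -EFinM lee_fin; case: (leP (texp (zcons t)) (expR x)) => h.
      by rewrite slice_box// !mulr1 slice_weight_le.
    by rewrite mulr0 mulr_ge0 ?slice_bound_ge0// prodr_ge0// => i _; exact: box_ge0.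
rewrite ge0_integralZl; last first.
- by rewrite lee_fin slice_bound_ge0.
- by move=> t _; rewrite lee_fin prodr_ge0// => i _; exact: box_ge0.
- by apply/measurable_EFinP; apply: measurable_prod_tuple; exact: measurable_box.
- exact: measurableT.
rewrite integral_prod_tuple; [|exact: measurable_box|exact: box_ge0|exact: integrable_box].
by rewrite -EFinM ltry.
Qed.

Definition rslice n (x : R) : R := fine (slice_distr n x).

Lemma rsliceE n x : slice_distr n x = (rslice n x)%:E.
Proof.
by rewrite /rslice fineK// ge0_fin_numE ?slice_distr_lty// slice_distr_ge0.
Qed.

Lemma rslice_ge0 n x : 0 <= rslice n x.
Proof. by rewrite fine_ge0// slice_distr_ge0. Qed.

Lemma rslice_le n x y : x <= y -> rslice n x <= rslice n y.
Proof. by move=> /(slice_distr_le beta n); rewrite !rsliceE lee_fin. Qed.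

Lemma measurable_rslice n : measurable_fun [set: R] (rslice n).
Proof.
apply/measurable_EFinP; have -> : EFin \o rslice n = slice_distr n.
  by apply/funext => x /=; rewrite rsliceE.
exact: measurable_slice_distr.
Qed.

(** The function e ^ x + e ^ (s - x) is 2 e ^ (s / 2) cosh (x - s / 2), hence of quadratic growth
    away from s / 2. The constant 1 / 4 comes from e ^ d >= (1 + d / 2) ^ 2. *)
Lemma cosh_gap (x y s : R) : s / 2 <= y -> y <= x ->
  expR (s / 2) * (x - y) ^+ 2 / 4 <= expR x + expR (s - x) - (expR y + expR (s - y)).
Proof.
move=> sy yx; set d := x - y; have d0 : 0 <= d by rewrite subr_ge0.
have -> : x = y + d by rewrite /d; ring.
have -> : expR (s - (y + d)) = expR (s - y) * expR (- d) by rewrite -expRD; congr expR; ring.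
rewrite expRD; set Y := expR y; set Z := expR (s - y).
have Z0 : 0 < Z by exact: expR_gt0.
have ZY : Z <= Y by rewrite /Z /Y ler_expR; lra.
have sY : expR (s / 2) <= Y by rewrite /Y ler_expR.
have E0 : 0 < expR (s / 2) by exact: expR_gt0.
have q1 : 1 + d + d ^+ 2 / 4 <= expR d.
  have -> : expR d = expR (d / 2) * expR (d / 2) by rewrite -expRD -splitr.
  by have := expR_ge1Dx (d / 2); nra.
have q2 := expR_ge1Dx (- d).
have q3 : expR (- d) <= 1 by rewrite -expR0 ler_expR; lra.
have -> : Y * expR d + Z * expR (- d) - (Y + Z) = Y * (expR d - 1) - Z * (1 - expR (- d)) by ring.
apply: (@le_trans _ _ (Y * (expR d - 1) - Y * (1 - expR (- d)))); last first.
  by rewrite lerD2l lerN2 ler_wpM2r//; lra.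
have -> : Y * (expR d - 1) - Y * (1 - expR (- d)) = Y * (expR d + expR (- d) - 2) by ring.
apply: (@le_trans _ _ (Y * (d ^+ 2 / 4))); last first.
  by apply: ler_wpM2l; [exact: expR_ge0|lra].
by rewrite -mulrA ler_wpM2r// divr_ge0// sqr_ge0.
Qed.

(** Such a set lies in the interval of radius e around any of its points. *)
Lemma lebesgue_diam (A : set R) (e : R) : measurable A -> 0 <= e ->
  (forall x y, A x -> A y -> x <= y -> y - x <= e) -> (mu A <= (2 * e)%:E)%E.
Proof.
move=> mA e0 Ae; have [->|/set0P[x Ax]] := eqVneq A set0.
  by rewrite measure0 lee_fin mulr_ge0.
apply: (@le_trans _ _ (mu `[x - e, x + e])).
  apply: le_measure; [by rewrite inE|by rewrite inE; exact: measurable_itv|].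
  move=> y Ay /=; rewrite in_itv/=.
  have [xy|/ltW yx] := leP x y.
    by have := Ae _ _ Ax Ay xy; move=> h; apply/andP; split; lra.
  by have := Ae _ _ Ay Ax yx; move=> h; apply/andP; split; lra.
rewrite lebesgue_measure_itv/= lte_fin.
case: ltP => h; rewrite -?EFinN -?EFinD lee_fin; lra.
Qed.

(** On each side of s / 2 two points of the band are at distance at most e by [cosh_gap]; the
    reflection x |-> s - x exchanges the two sides. *)
Lemma lebesgue_cosh_band (s a b e : R) : 0 <= e -> b - a <= expR (s / 2) * e ^+ 2 / 4 ->
  (\int[mu]_x ((a < expR x + expR (s - x) <= b)%R%:R)%:E <= (4 * e)%:E)%E.
Proof.
move=> e0 ab; pose f x := expR x + expR (s - x).
have mf : measurable_fun [set: R] f.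
  apply: measurable_funD => //; apply: (measurableT_comp (@measurable_expR R)).
  by apply: measurable_funB.
have mB : measurable [set x | a < f x <= b].
  rewrite (_ : [set x | _] = f @^-1` `]a, b]); last by apply/seteqP; split => x /=; rewrite in_itv.
  by rewrite -[X in measurable X]setTI; exact: mf.
pose A1 : set R := [set x | a < f x <= b] `&` `[s / 2, +oo[.
pose A2 : set R := [set x | a < f x <= b] `&` `]-oo, s / 2].
have mA1 : measurable A1 by apply: measurableI.
have mA2 : measurable A2 by apply: measurableI.
have gap x y : s / 2 <= y -> y <= x -> f x - f y <= b - a -> x - y <= e.
  move=> sy yx h; have := cosh_gap sy yx; rewrite -/(f x) -/(f y) => h2.
  have E0 : 0 < expR (s / 2) by exact: expR_gt0.
  have h3 : (x - y) ^+ 2 <= e ^+ 2.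
    rewrite -(ler_pM2l E0); lra.
  by rewrite -(ler_pXn2r (ltn0Sn 1)) ?nnegrE// subr_ge0.
have d1 : (mu A1 <= (2 * e)%:E)%E.
  apply: lebesgue_diam => // x y [/= /andP[fx1 fx2]]; rewrite in_itv/= andbT => sx.
  by move=> [/= /andP[fy1 fy2] _] xy; apply: gap => //; lra.
have d2 : (mu A2 <= (2 * e)%:E)%E.
  apply: lebesgue_diam => // x y [/= /andP[fx1 fx2] _] [/= /andP[fy1 fy2]].
  rewrite in_itv/= => ys xy.
  have fS z : f (s - z) = f z by rewrite /f addrC; congr (expR _ + expR _); ring.
  have := @gap (s - x) (s - y); rewrite !fS => G.
  have -> : y - x = s - x - (s - y) by ring.
  by apply: G; lra.
apply: (@le_trans _ _ (mu (A1 `|` A2))).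
  pose B : set R := [set x | a < f x <= b].
  have -> : (\int[mu]_x ((a < expR x + expR (s - x) <= b)%R%:R)%:E = mu B)%E.
    transitivity (\int[mu]_x (\1_B x)%:E)%E; last by rewrite integral_indic// setIT.
    by apply: eq_integral => x _; rewrite indicE mem_setE.
  apply: le_measure; [by rewrite inE|by rewrite inE; exact: measurableU|].
  move=> x Bx; have [sx|/ltW sx] := leP (s / 2) x; [left|right];
    by split => //=; rewrite in_itv/= ?sx.
apply: (@le_trans _ _ (mu A1 + mu A2)%E); first exact: measureU2.
have -> : 4 * e = 2 * e + 2 * e by ring.
by rewrite EFinD leeD.
Qed.

Lemma prod_box_tsum n c (t : n.-tuple R) :
  \prod_(i < n) box c (tnth t i) = 0 \/ \prod_(i < n) box c (tnth t i) = 1 /\ `|tsum t| <= n%:R * c.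
Proof.
have [/forallP h|] := boolP [forall i, - c <= tnth t i <= c].
  right; split; first by rewrite big1// => i _; rewrite /box h.
  apply: (le_trans (ler_norm_sum _ _ _)); apply: (@le_trans _ _ (\sum_(i < n) c)).
    by apply: ler_sum => i _; rewrite ler_norml h.
  by rewrite sumr_const card_ord mulr_natl.
rewrite negb_forall => /existsP[i /negbTE hi]; left.
by rewrite (bigD1 i)//= /box hi mul0r.
Qed.

Lemma texp_zcons_cons n v (w : n.-tuple R) :
  texp (zcons [tuple of v :: w]) = expR v + expR (- tsum w - v) + texp w.
Proof.
have tE : tsum [tuple of v :: w] = v + tsum w.
  by rewrite /tsum big_ord_recl; congr (_ + _); apply: eq_bigr => i _; rewrite tnthS.
rewrite /texp !big_ord_recl /zcons tnth0 !tnthS tnth0 tE opprD.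
rewrite addrA [expR (_ - _) + _]addrC [- v - _]addrC; congr (_ + _).
by apply: eq_bigr => i _; rewrite !tnthS.
Qed.

Lemma expR_lip (M x y : R) : x <= y -> y <= M -> expR y - expR x <= expR M * (y - x).
Proof.
move=> xy yM; have -> : expR x = expR y * expR (x - y) by rewrite -expRD; congr expR; ring.
have h := expR_ge1Dx (x - y); have y0 := expR_gt0 y.
have yM' : expR y <= expR M by rewrite ler_expR.
by nra.
Qed.

(* With u_0 + u_1 and the other coordinates fixed, the sum of the e ^ u_i is a
   hyperbolic cosine, of quadratic growth away from its minimum: hence the
   exponent 1/2. *)
Lemma rslice_holder n (M : R) : 0 <= M ->
  exists2 C, 0 <= C & forall x y, x <= y -> y <= M ->
    rslice n.+1 y - rslice n.+1 x <= C * Num.sqrt (y - x).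
Proof.
(* Where the sum of the e ^ u_i is at most e ^ M, the entries of the tuple lie in [- c, c], so S
   bounds the sum of n of them. *)
move=> M0; pose c := n.+2%:R * M; have c0 : 0 <= c by rewrite mulr_ge0.
pose S := n%:R * c; have S0 : 0 <= S by rewrite mulr_ge0.
(* Chosen so that q ^ 2 e ^ (- S / 2) = e ^ M: the width e = 2 q sqrt (y - x) then meets the
   condition of [lebesgue_cosh_band] for every tail in the box. *)
pose q := expR ((M + S / 2) / 2); have q0 : 0 <= q by exact: expR_ge0.
have qq : expR (- S / 2) * (q * q) = expR M.
  by rewrite -!expRD; congr expR; field.
exists (slice_bound n.+1 M * (4 * (2 * q)) * (2 * c) ^+ n).
  by rewrite !mulr_ge0 ?slice_bound_ge0// exprn_ge0// mulr_ge0.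
move=> x y xy yM; pose e := 2 * q * Num.sqrt (y - x).
have e0 : 0 <= e by rewrite !mulr_ge0.
have e2 : e ^+ 2 = 4 * (q * q) * (y - x).
  by rewrite /e exprMn sqr_sqrtr ?subr_ge0// expr2; ring.
pose I (t : n.+1.-tuple R) : R := (expR x < texp (zcons t) <= expR y)%R%:R.
have mI : measurable_fun setT (I : n.+1.-tuple TR -> R).
  have mle (a b : R) : measurable_fun [set: R] (fun s : R => (a < s <= b)%R%:R : R).
    rewrite (_ : (fun _ => _) = \1_(`]a, b] : set R)); first exact: measurable_indic.
    by apply/funext => s; rewrite indicE mem_setE in_itv.
  by apply: (measurableT_comp (mle _ _)); exact: measurable_texp_zcons.
have I0 t : 0 <= I t by exact: ler0n.
have msw := @measurable_slice_weight R beta n.+1.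
have mle z : measurable_fun setT (fun t : n.+1.-tuple TR => (slice_weight t * (texp (zcons t) <= expR z)%R%:R)%:E).
  apply/measurable_EFinP; apply: measurable_funM => //.
  by apply: measurable_le_fun => //; exact: measurable_texp_zcons.
(* The head is left without a box, since the band alone bounds its integral. *)
pose J (t : n.+1.-tuple R) : \bar R := ((\prod_(i < n) box c (tnth t (lift ord0 i))) * I t)%:E.
have mJ : measurable_fun setT (J : n.+1.-tuple TR -> \bar R).
  apply/measurable_EFinP; apply: measurable_funM => //; apply: measurable_prod => i _.
  by apply: (measurableT_comp (@measurable_box c)); exact: measurable_tnth.
have P0 m (t : m.-tuple R) : 0 <= \prod_(i < m) box c (tnth t i).
  by apply: prodr_ge0 => i _; exact: box_ge0.
have J0 t : (0 <= J t)%E.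
  by rewrite lee_fin mulr_ge0// prodr_ge0// => i _; exact: box_ge0.
have split : (slice_distr n.+1 y = slice_distr n.+1 x + \int[leb n.+1]_t (slice_weight t * I t)%:E)%E.
  rewrite -ge0_integralD//; last 3 first.
  - by move=> t _; rewrite lee_fin mulr_ge0// slice_weight_ge0.
  - by move=> t _; rewrite lee_fin mulr_ge0// slice_weight_ge0.
  - by apply/measurable_EFinP; exact: measurable_funM.
  apply: eq_integral => t _; rewrite -EFinD -mulrDr; congr (_ * _)%:E; rewrite /I.
  have ey : expR x <= expR y by rewrite ler_expR.
  case: (leP (texp (zcons t)) (expR x)) => h /=; last by rewrite add0r.
  by rewrite (le_trans h ey) addr0.
have JB : (\int[leb n.+1]_t J t <= ((4 * e) * (2 * c) ^+ n)%:E)%E.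
  rewrite ge0_integral_cons2//.
  apply: (@le_trans _ _ (\int[leb n]_w ((4 * e)%:E * (\prod_(i < n) box c (tnth w i))%:E))%E); last first.
    rewrite ge0_integralZl; last first.
    - by rewrite lee_fin mulr_ge0.
    - by move=> t _; rewrite lee_fin.
    - by apply/measurable_EFinP; apply: measurable_prod_tuple; exact: measurable_box.
    - exact: measurableT.
    rewrite integral_prod_tuple; [|exact: measurable_box|exact: box_ge0|exact: integrable_box].
    by rewrite /Rintegral integral_box.
  apply: ge0_le_integral => //.
  - by move=> w _; apply: integral_ge0 => v _; exact: J0.
  - exact: measurable_fun_cons_integral2.
  - apply: emeasurable_funM => //; apply/measurable_EFinP.
    by apply: measurable_prod_tuple; exact: measurable_box.
  move=> w _; rewrite /J; under eq_integral do under eq_bigr do rewrite tnthS.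
  have [->|[-> sw]] := prod_box_tsum c w.
    by under eq_integral do rewrite mul0r; rewrite integral0 mule0.
  under eq_integral do rewrite mul1r /I texp_zcons_cons -ltrBlDr -lerBrDr.
  rewrite mule1; apply: lebesgue_cosh_band => //.
  have -> : expR y - texp w - (expR x - texp w) = expR y - expR x by ring.
  apply: (le_trans (expR_lip xy yM)).
  have -> : expR (- tsum w / 2) * e ^+ 2 / 4 = expR (- tsum w / 2) * (q * q) * (y - x).
    by rewrite e2; field.
  rewrite -qq ler_wpM2r ?subr_ge0// ler_wpM2r ?mulr_ge0// ler_expR.
  by move: sw; rewrite ler_norml -/S => /andP[]; lra.
have : (slice_distr n.+1 y <= slice_distr n.+1 x + (slice_bound n.+1 M * ((4 * e) * (2 * c) ^+ n))%:E)%E.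
  rewrite split leeD2l// EFinM.
  apply: (@le_trans _ _ ((slice_bound n.+1 M)%:E * \int[leb n.+1]_t J t)%E); last first.
    by apply: lee_wpmul2l; [rewrite lee_fin slice_bound_ge0|exact: JB].
  rewrite -ge0_integralZl//; last by rewrite lee_fin slice_bound_ge0.
  apply: ge0_le_integral => //.
  - by move=> t _; rewrite lee_fin mulr_ge0// slice_weight_ge0.
  - by apply/measurable_EFinP; exact: measurable_funM.
  - exact: emeasurable_funM.
  move=> t _; rewrite -EFinM lee_fin /I; case: (boolP (_ < _ <= _)) => [/andP[_ h]|_]; last by rewrite !mulr0.
  have hM : texp (zcons t) <= expR M by rewrite (le_trans h)// ler_expR.
  have := slice_box M0 hM; rewrite big_ord_recl/= => bE.
  have [b1|b1] := eqVneq (\prod_(i < n) box c (tnth t (lift ord0 i))) 1.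
    by rewrite b1 !mulr1 slice_weight_le.
  move: bE b1; rewrite /c; move: (\prod_(i < n) _) => Q; rewrite /box.
  case: (_ <= _ <= _); first by rewrite mul1r => ->; rewrite eqxx.
  by rewrite mul0r => /esym/eqP; rewrite oner_eq0.
rewrite !rsliceE -EFinD lee_fin => h; rewrite lerBlDl; apply: (le_trans h).
by rewrite lerD2l /e le_eqVlt; apply/orP; left; apply/eqP; ring.
Qed.

End SliceRegularity.

(** * The Selberg integral as a Gamma factor times a Laplace transform *)

Section SliceMoments.
Context {R : realType}.
Notation mu := (@lebesgue_measure R).
Notation TR := (measurableTypeR R).
Notation leb := (@lebesgue_tuple R).
Variable beta : nat.
Hypothesis beta_gt0 : (0 < beta)%N.
Variable n : nat.
Local Notation N := (n.+1%:R : R).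
Local Notation e := (slice_exponent beta n : R).
Local Open Scope complex_scope.

(** Its moment at z is Gamma (z + e + 1). *)
Definition gamma_weight (x : R) : R := expR (e * x) * (expR x * expR (- expR x)).
(** With u = - tau, its moment at z is the Laplace transform of [rslice] at z + e. *)
Definition rslice_weight (u : R) : R := expR (e * u) * rslice beta n (- u).

Local Notation W1 := gamma_weight.
Local Notation W2 := rslice_weight.

Let mid : measurable_fun setT (id : TR -> TR). Proof. exact: measurable_id. Qed.

Lemma gamma_weight_ge0 x : 0 <= W1 x.
Proof. by rewrite !mulr_ge0// expR_ge0. Qed.

Lemma rslice_weight_ge0 u : 0 <= W2 u.
Proof. by rewrite mulr_ge0 ?expR_ge0// rslice_ge0. Qed.

Lemma measurable_expRl (a : R) : measurable_fun [set: R] (fun x : R => expR (a * x)).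
Proof. by apply: (measurableT_comp (@measurable_expR R)); exact: measurable_funM. Qed.

Lemma measurable_gamma_weight : measurable_fun [set: R] W1.
Proof.
apply: measurable_funM; first exact: measurable_expRl.
apply: measurable_funM => //; apply: (measurableT_comp (@measurable_expR R)).
exact: measurableT_comp.
Qed.

Lemma measurable_rslice_weight : measurable_fun [set: R] W2.
Proof.
apply: measurable_funM; first exact: measurable_expRl.
apply: (measurableT_comp (f := rslice beta n) (g := @GRing.opp R)) => //.
exact: measurable_rslice.
Qed.

Lemma slice_exponent_ge0 : 0 <= e.
Proof. by rewrite !mulr_ge0// divr_ge0. Qed.

Lemma integrable_gamma_weight (a : R) : 0 < a ->
  mu.-integrable setT (fun x => (expR (a * x) * W1 x)%:E).
Proof.
move=> a0; have p : 0 < a + e + 1 by rewrite addr_gt0// ltr_wpDr// slice_exponent_ge0.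
have := integrable_gker 0 p; congr (mu.-integrable setT _).
apply/funext => x /=; rewrite /gker expr0 mulr1 !mulrDl mul1r !expRD /gamma_weight.
by congr (_%:E); ring.
Qed.

(* Adding 1 to the cosine keeps the integrand nonnegative, so that Tonelli's
   theorem suffices. *)
Lemma slice_cos_identity (a c y th : R) : 0 <= c <= 1 ->
  (\int[leb n.+1]_t (expR (a * tsum t) * sweight beta t * (1 + c * cos (y * tsum t + th)))%:E =
   N%:E * \int[mu]_x \int[mu]_u (expR (a * N * x) * W1 x *
      (expR (a * N * u) * W2 u * (1 + c * cos (y * N * u + (y * N * x + th)))))%:E)%E.
Proof.
move=> /andP[c0 c1].
pose phi (x : R) : \bar R := (expR (a * x) * (1 + c * cos (y * x + th)))%:E.
have p0 x : 0 <= 1 + c * cos x by have := cos_geN1 x; nra.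
have mphi : measurable_fun [set: R] phi.
  apply/measurable_EFinP; apply: measurable_funM; first exact: measurable_expRl.
  apply: measurable_funD => //; apply: measurable_funM => //.
  apply: (measurableT_comp (f := @cos R)).
    by apply: continuous_measurable_fun; exact: continuous_cos.
  by apply: measurable_funD => //; exact: measurable_funM.
have phi0 x : (0 <= phi x)%E by rewrite lee_fin mulr_ge0 ?expR_ge0.
transitivity (\int[leb n.+1]_t (phi (tsum t) * (sweight beta t)%:E))%E.
  by apply: eq_integral => t _; rewrite /phi -EFinM mulrAC.
rewrite integral_slice_tsum//; congr (_ * _)%E.
apply: eq_integral => x _; apply: eq_integral => u _.
rewrite /phi rsliceE -!EFinM; congr (_%:E).
have -> : y * (N * (x + u)) + th = y * N * u + (y * N * x + th) by ring.
have -> : a * (N * (x + u)) = a * N * x + a * N * u by ring.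
have -> : e * (x + u) = e * x + e * u by ring.
by rewrite !expRD /gamma_weight /rslice_weight; ring.
Qed.

Lemma rmom_gamma_gt0 a : 0 < a -> 0 < rmom mu id W1 a.
Proof.
move=> a0; have p : 0 < a + e + 1 by rewrite addr_gt0// ltr_wpDr// slice_exponent_ge0.
have -> : rmom mu id W1 a = rselb beta 1 (a + e + 1).
  rewrite /rselb /rmom /Rintegral; congr (fine _).
  rewrite ge0_integral_cons; last 2 first.
  - by apply/measurable_EFinP; apply: measurable_exp_mom; [exact: measurable_tsumT|exact: measurable_sweight].
  - by move=> t; rewrite lee_fin mulr_ge0 ?expR_ge0// sweight_ge0.
  apply: eq_integral => x _; rewrite integral_tuple0 /sweight /tsum /texp /pairprod !big_ord1 big_pred0; last first.
    by move=> j; rewrite ltnNge leq_ord.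
  by rewrite mulr1 tnth0 !mulrDl mul1r !expRD /gamma_weight; congr (_%:E); ring.
exact: rgam_gt0.
Qed.

(** By the identity at c = 0, a finite Selberg moment is this integral times a positive number. *)
Lemma integrable_rslice_weight a : 0 < a ->
  mu.-integrable setT (fun u => (expR (a * u) * W2 u)%:E).
Proof.
move=> a0; pose b := a / N.
have bN : b * N = a by rewrite /b divfK.
have b0 : 0 < b by rewrite divr_gt0.
have c01 : 0 <= (0 : R) <= 1 by rewrite lexx ler01.
have mE (w : R -> R) : measurable_fun [set: R] w -> measurable_fun setT (fun x : TR => (expR (a * x) * w x)%:E).
  by move=> mw; apply/measurable_EFinP; apply: measurable_funM => //; exact: measurable_expRl.
have m1 := mE _ measurable_gamma_weight; have m2 := mE _ measurable_rslice_weight.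
have := slice_cos_identity b 0 0 c01.
under eq_integral do rewrite mul0r addr0 mulr1.
rewrite (_ : (\int[mu]_x _)%E = ((rmom mu id W1 a)%:E * \int[mu]_u (expR (a * u) * W2 u)%:E)%E); last first.
  transitivity (\int[mu]_x ((expR (a * x) * W1 x)%:E * \int[mu]_u (expR (a * u) * W2 u)%:E))%E.
    apply: eq_integral => x _; rewrite -ge0_integralZl; last first.
    - by rewrite lee_fin mulr_ge0 ?expR_ge0 ?gamma_weight_ge0.
    - by move=> u _; rewrite lee_fin mulr_ge0 ?expR_ge0 ?rslice_weight_ge0.
    - exact: m2.
    - exact: measurableT.
    by apply: eq_integral => u _; rewrite mul0r addr0 mulr1 bN.
  rewrite ge0_integralZr; last first.
  - by apply: integral_ge0 => u _; rewrite lee_fin mulr_ge0 ?expR_ge0 ?rslice_weight_ge0.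
  - by move=> u _; rewrite lee_fin mulr_ge0 ?expR_ge0 ?gamma_weight_ge0.
  - exact: m1.
  - exact: measurableT.
  congr (_ * _)%E; rewrite /rmom /Rintegral fineK//.
  by have := integrable_gamma_weight a0; exact: integrable_fin_num.
have [_ ifin] := integrableP _ _ _ (integrable_sweight beta n.+1 b0).
move=> H; apply/integrableP; split; first exact: m2.
have -> : (\int[mu]_x `|(expR (a * x) * W2 x)%:E| = \int[mu]_x (expR (a * x) * W2 x)%:E)%E.
  by apply: eq_integral => x _; rewrite gee0_abs// lee_fin mulr_ge0 ?expR_ge0 ?rslice_weight_ge0.
have Hlt : (N%:E * ((rmom mu id W1 a)%:E * \int[mu]_u (expR (a * u) * W2 u)%:E) < +oo)%E.
  rewrite -H (eq_integral (fun t : n.+1.-tuple TR => `|(expR (b * tsum t) * sweight beta t)%:E|%E)); first exact: ifin.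
  by move=> t _; rewrite gee0_abs// lee_fin mulr_ge0 ?expR_ge0// sweight_ge0.
rewrite ltNge; apply/negP; rewrite leye_eq => /eqP I.
by move: Hlt; rewrite I !gt0_muley ?ltxx// lte_fin ?rmom_gamma_gt0.
Qed.

(** The difference between the cases c = 1 and c = 0 of [slice_cos_identity], with the cosine of the
    sum expanded: the parts of a product of two complex moments appear. *)
Lemma mom_slice (a y th : R) : 0 < a ->
  mom (leb n.+1) (@tsum R n.+1) (sweight beta (n := n.+1)) a y th =
  N * (mom mu id W1 (a * N) (y * N) th * mom mu id W2 (a * N) (y * N) 0 -
       mom mu id W1 (a * N) (y * N) (th - pi / 2) * mom mu id W2 (a * N) (y * N) (- pi / 2)).
Proof.
move=> a0; have aN : 0 < a * N by rewrite mulr_gt0.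
have i1 := integrable_gamma_weight; have i2 := integrable_rslice_weight.
have I1 v t := integrable_mom (mm := mu) mid measurable_gamma_weight gamma_weight_ge0 i1 v t aN.
have I2 v t := integrable_mom (mm := mu) mid measurable_rslice_weight rslice_weight_ge0 i2 v t aN.
have I v t := integrable_mom (mm := leb n.+1) (@measurable_tsumT R n.+1) (@measurable_sweight R beta n.+1)
  (@sweight_ge0 R beta n.+1) (fun b b0 => integrable_sweight beta n.+1 b0) v t a0.
pose B := rmom mu id W2 (a * N); pose A := rmom mu id W1 (a * N).
pose c2 := mom mu id W2 (a * N) (y * N) 0; pose s2 := mom mu id W2 (a * N) (y * N) (- pi / 2).
pose c1 := mom mu id W1 (a * N) (y * N) th; pose s1 := mom mu id W1 (a * N) (y * N) (th - pi / 2).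
have E (c : R) : 0 <= c <= 1 ->
    rmom (leb n.+1) (@tsum R n.+1) (sweight beta (n := n.+1)) a +
    c * mom (leb n.+1) (@tsum R n.+1) (sweight beta (n := n.+1)) a y th =
    N * (A * B + c * (c1 * c2 - s1 * s2)).
  move=> c01; apply: EFin_inj.
  transitivity (\int[leb n.+1]_t (expR (a * tsum t) * sweight beta t * (1 + c * cos (y * tsum t + th)))%:E)%E.
    rewrite /rmom /mom EFinD EFinM /Rintegral !fineK; last 2 first.
    - exact: integrable_fin_num (I y th).
    - exact: integrable_fin_num (integrable_sweight beta n.+1 a0).
    rewrite -(integralZl measurableT (I y th)).
    rewrite -integralD//; last 2 first.
    - exact: integrable_sweight.
    - by apply: integrableZl => //; exact: I.
    by apply: eq_integral => t _; rewrite -EFinM -EFinD; congr (_%:E); ring.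
  rewrite slice_cos_identity// [RHS]EFinM; congr (_ * _)%E.
  transitivity (\int[mu]_x ((B%:E * (expR (a * N * x) * W1 x)%:E) +
      ((c * c2)%:E * (expR (a * N * x) * W1 x * cos (y * N * x + th))%:E +
       (- (c * s2))%:E * (expR (a * N * x) * W1 x * cos (y * N * x + (th - pi / 2)))%:E)))%E.
    apply: eq_integral => x _.
    transitivity (\int[mu]_u ((expR (a * N * x) * W1 x)%:E * (expR (a * N * u) * W2 u)%:E +
        (expR (a * N * x) * W1 x * c)%:E *
        (expR (a * N * u) * W2 u * cos (y * N * u + (y * N * x + th)))%:E))%E.
      by apply: eq_integral => u _; rewrite -!EFinM -EFinD; congr (_%:E); ring.
    rewrite integralD//; last 2 first.
    - by apply: integrableZl => //; exact: i2.
    - by apply: integrableZl => //; exact: I2.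
    rewrite (integralZl measurableT (i2 _ aN)) (integralZl measurableT (I2 _ _)).
    have <- : (B%:E = \int[mu]_u (expR (a * N * u) * W2 u)%:E)%E.
      by rewrite /B /rmom /Rintegral fineK//; exact: integrable_fin_num (i2 _ aN).
    have <- : ((mom mu id W2 (a * N) (y * N) (y * N * x + th))%:E =
       \int[mu]_u (expR (a * N * u) * W2 u * cos (y * N * u + (y * N * x + th)))%:E)%E.
      by rewrite /mom /Rintegral fineK//; exact: integrable_fin_num (I2 _ _).
    rewrite (mom_phase mid measurable_rslice_weight rslice_weight_ge0 i2)// -/c2 -/s2.
    rewrite [y * N * x + (th - _)]addrA cosBpihalf -!EFinM -!EFinD; congr (_%:E); ring.
  rewrite integralD//; last 2 first.
  - by apply: integrableZl => //; exact: i1.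
  - by apply: integrableD => //; apply: integrableZl => //; exact: I1.
  rewrite integralD//; last 2 first.
  - by apply: integrableZl => //; exact: I1.
  - by apply: integrableZl => //; exact: I1.
  rewrite (integralZl measurableT (i1 _ aN)) !(integralZl measurableT (I1 _ _)).
  have <- : (A%:E = \int[mu]_u (expR (a * N * u) * W1 u)%:E)%E.
    by rewrite /A /rmom /Rintegral fineK//; exact: integrable_fin_num (i1 _ aN).
  have M t : ((mom mu id W1 (a * N) (y * N) t)%:E =
     \int[mu]_u (expR (a * N * u) * W1 u * cos (y * N * u + t))%:E)%E.
    by rewrite /mom /Rintegral fineK//; exact: integrable_fin_num (I1 _ _).
  rewrite -!M -/c1 -/s1 -!EFinM -!EFinD; congr (_%:E); ring.
have E0 : 0 <= (0 : R) <= 1 by rewrite lexx ler01.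
have E1 : 0 <= (1 : R) <= 1 by rewrite lexx ler01.
have := E _ E1; have := E _ E0; rewrite !mul0r !addr0 !mul1r mulrDr => ->.
by move/addrI.
Qed.

Lemma selb_slice (z : R[i]) : 0 < complex.Re z ->
  selb beta n.+1 z = N%:C * cmom mu id W1 (z * N%:C) * cmom mu id W2 (z * N%:C).
Proof.
case: z => a y /= a0; have aN : 0 < a * N by rewrite mulr_gt0.
have -> : (a +i* y) * N%:C = (a * N) +i* (y * N).
  by apply/eqP; rewrite eq_complex/= !mulr0 subr0 add0r !eqxx.
rewrite /selb !cmomE !mom_slice//.
have -> : mom mu id W1 (a * N) (y * N) (- pi / 2 - pi / 2) = - mom mu id W1 (a * N) (y * N) 0.
  rewrite (mom_phase mid measurable_gamma_weight gamma_weight_ge0 integrable_gamma_weight)//.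
  have -> : - pi / 2 - pi / 2 = - pi :> R by field.
  by rewrite cosN sinN cospi sinpi oppr0 mul0r subr0 mulN1r.
have -> : 0 - pi / 2 = - pi / 2 :> R by ring.
apply/eqP; rewrite eq_complex/=; apply/andP; split; apply/eqP; ring.
Qed.

Lemma integral_tuple1 (F : R -> R) : measurable_fun [set: R] F ->
  (\int[leb 1]_t (F (tsum t))%:E = \int[mu]_x (F x)%:E)%E.
Proof.
move=> mF.
have P (h : R -> \bar R) : measurable_fun [set: R] h -> (forall x, 0 <= h x)%E ->
    (\int[leb 1]_t h (tsum t) = \int[mu]_x h x)%E.
  move=> mh h0; rewrite ge0_integral_cons//; last first.
    by apply: (measurableT_comp mh); exact: measurable_tsumT.
  by apply: eq_integral => x _; rewrite integral_tuple0 /tsum big_ord1.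
have mE : measurable_fun [set: R] (EFin \o F) by apply/measurable_EFinP.
rewrite [LHS]integralE [RHS]integralE -(P _ (measurable_funepos mE)); last by move=> x; exact: funepos_ge0.
rewrite -(P _ (measurable_funeneg mE)); last by move=> x; exact: funeneg_ge0.
by congr (_ - _)%E; apply: eq_integral => t _; rewrite ?funeposE ?funenegE.
Qed.

Lemma cmom_gamma_weight (z : R[i]) : cmom mu id W1 z = cGamma (z + (e + 1)%:C).
Proof.
rewrite (cGammaE beta) /selb -cmom_shift; case: z => a y; rewrite !cmomE.
have Q th : mom mu id W1 a y th =
   mom (leb 1) (@tsum R 1) (fun t => expR ((e + 1) * tsum t) * sweight beta t) a y th.
  rewrite /mom /Rintegral; congr (fine _).
  pose F x := expR (a * x) * W1 x * cos (y * x + th).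
  have mF : measurable_fun [set: R] F.
    apply: measurable_funM.
      by apply: measurable_funM; [exact: measurable_expRl|exact: measurable_gamma_weight].
    apply: (measurableT_comp (f := @cos R)).
      by apply: continuous_measurable_fun; exact: continuous_cos.
    by apply: measurable_funD => //; exact: measurable_funM.
  rewrite -[LHS](integral_tuple1 mF); apply: eq_integral => t _.
  rewrite /F /gamma_weight /sweight /tsum /texp /pairprod !big_ord1 big_pred0; last first.
    by move=> j; rewrite ltnNge leq_ord.
  by rewrite mulrDl mul1r !expRD mulr1; congr (_%:E); ring.
by rewrite !Q.
Qed.

End SliceMoments.

(** * The Riemann-Lebesgue lemma and integrability of the inverse square root at 0 *)

Section RiemannLebesgue.
Context {R : realType}.
Notation mu := (@lebesgue_measure R).
Notation TR := (measurableTypeR R).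

Lemma integral_translate (q : R) (f : R -> R) : measurable_fun [set: R] f ->
  (\int[mu]_x (f (x + q))%:E = \int[mu]_x (f x)%:E)%E.
Proof.
move=> mf; have mE : measurable_fun [set: R] (EFin \o f) by apply/measurable_EFinP.
rewrite [LHS]integralE [RHS]integralE.
rewrite -(ge0_integral_translate q (measurable_funepos mE)); last by move=> x; exact: funepos_ge0.
rewrite -(ge0_integral_translate q (measurable_funeneg mE)); last by move=> x; exact: funeneg_ge0.
by congr (_ - _)%E; apply: eq_integral => t _; rewrite ?funeposE ?funenegE.
Qed.

Lemma measurable_cos_lin (y th : R) : measurable_fun [set: R] (fun t : R => cos (y * t + th)).
Proof.
apply: (measurableT_comp (f := @cos R)).
  by apply: continuous_measurable_fun; exact: continuous_cos.
by apply: measurable_funD => //; exact: measurable_funM.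
Qed.

Lemma normr_cos_le1 (x : R) : `|cos x| <= 1.
Proof. by rewrite ler_norml cos_le1 cos_geN1. Qed.

Lemma integrable_mul_cos (k : R -> R) y th : mu.-integrable setT (EFin \o k) ->
  mu.-integrable setT (fun t => (k t * cos (y * t + th))%:E).
Proof.
move=> ik; have mk : measurable_fun [set: R] k by case/integrableP : ik => /measurable_EFinP.
apply: (@le_integrableT _ _ _ mu (fun t => k t * cos (y * t + th)) (fun t => `|k t|)).
- by apply: measurable_funM => //; exact: measurable_cos_lin.
- by move=> t; rewrite normrM ler_piMr// normr_cos_le1.
- exact: (integrable_abse ik).
Qed.

Lemma le_norm_integral_cos (k : R -> R) y th : mu.-integrable setT (EFin \o k) ->
  `|\int[mu]_t (k t * cos (y * t + th))| <= \int[mu]_t `|k t|.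
Proof.
move=> ik; apply: (le_trans (le_normr_Rintegral measurableT (integrable_mul_cos y th ik))).
apply: le_Rintegral => //.
- exact: (integrable_abse (integrable_mul_cos y th ik)).
- exact: (integrable_abse ik).
- by move=> t _; rewrite normrM ler_piMr// normr_cos_le1.
Qed.

Lemma compact_support_bounded (G : R -> R) M : continuous G -> 0 <= M ->
  (forall t, M < `|t| -> G t = 0) -> exists2 B, 0 <= B & forall t, `|G t| <= B.
Proof.
move=> cG M0 GM; have MM : - M <= M by lra.
have cn : {within `[- M, M], continuous (fun t => `|G t|)}.
  by apply: continuous_subspaceT => x; apply: (@continuous_comp _ _ _ G Num.norm);
    [exact: cG|exact: norm_continuous].
have [c _ cmax] := EVT_max MM cn.
exists (`|G c|) => // t; have [|tM] := ltP M `|t|; first by move/GM ->; rewrite normr0.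
by apply: cmax; rewrite in_itv/= -ler_norml.
Qed.

Lemma half_le (a b : R) : 0 <= b -> a <= b -> 2^-1 * a <= b.
Proof. by move=> b0 ab; lra. Qed.

(* Translating by half a period changes the sign of the cosine. *)
Lemma riemann_lebesgue_compact (G : R -> R) M (th : R) (u : nat -> R) :
  continuous G -> 0 <= M -> (forall t, M < `|t| -> G t = 0) ->
  (forall n, pi <= u n) -> u n @[n --> \oo] --> +oo ->
  \int[mu]_t (G t * cos (u n * t + th)) @[n --> \oo] --> (0 : R).
Proof.
move=> cG M0 GM upi uoo; have [B B0 GB] := compact_support_bounded cG M0 GM.
have mG : measurable_fun [set: R] G by exact: continuous_measurable_fun.
have u0 n : 0 < u n by exact: lt_le_trans (pi_gt0 R) (upi n).
(* Half a period. The condition u n >= pi makes it at most 1, so G and its translate both vanish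
   outside [- (M + 1), M + 1]. *)
pose s n := pi / u n.
have s01 n : 0 <= s n <= 1.
  by rewrite divr_ge0 ?pi_ge0 ?(ltW (u0 n))//= ler_pdivrMr ?mul1r.
have scvg : s n @[n --> \oo] --> (0 : R).
  rewrite -(mulr0 pi); apply: cvgM; first exact: cvg_cst.
  by apply/gtr0_cvgV0; first exact: nearW.
pose bnd t : R := 2 * B * box (M + 1) t.
have M1 : 0 <= M + 1 by lra.
have ibnd : mu.-integrable setT (fun t : TR => (bnd t)%:E).
  have := integrableZl measurableT (2 * B) (integrable_box M1).
  by congr (mu.-integrable setT _); apply/funext => t.
have Gb n t : `|G t - G (t + s n)| <= bnd t.
  rewrite /bnd /box; case: (boolP (_ <= _ <= _)) => h.
    rewrite mulr1; apply: (le_trans (ler_normB _ _)); have := GB t; have := GB (t + s n); lra.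
  have /andP[s0 s1] := s01 n.
  have [t1 t2] : M < `|t| /\ M < `|t + s n|.
    move: h; rewrite -ler_norml -ltNge => h; split; first by lra.
    have : `|t| <= `|t + s n| + `|s n|.
      by have := ler_normB (t + s n) (s n); rewrite addrK.
    by rewrite (ger0_norm s0); lra.
  by rewrite !GM// subrr normr0 mulr0.
have mD n : measurable_fun [set: R] (fun t => G t - G (t + s n)).
  by apply: measurable_funB => //; apply: (measurableT_comp mG); exact: measurable_add.
have iG : mu.-integrable setT (EFin \o G).
  apply: (@le_integrableT _ _ _ mu G bnd) => // t.
  rewrite /bnd /box; case: (boolP (_ <= _ <= _)) => h.
    by rewrite mulr1; have := GB t; lra.
  by rewrite GM ?normr0 ?mulr0//; move: h; rewrite -ler_norml -ltNge; lra.
have iD n : mu.-integrable setT (EFin \o (fun t => G t - G (t + s n))).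
  exact: (@le_integrableT _ TR R mu (fun t => G t - G (t + s n)) bnd (mD n) (Gb n) ibnd).
have half n : `|\int[mu]_t (G t * cos (u n * t + th))| <= \int[mu]_t `|G t - G (t + s n)|.
  have iGs : mu.-integrable setT (EFin \o (fun t => G (t + s n))).
    have := integrableB measurableT iG (iD n); congr (mu.-integrable setT _).
    by apply/funext => t /=; rewrite -EFinB subKr.
  have E : \int[mu]_t (G t * cos (u n * t + th)) = - \int[mu]_t (G (t + s n) * cos (u n * t + th)).
    rewrite -[RHS]mulN1r -RintegralZl//; last exact: integrable_mul_cos.
    rewrite /Rintegral -(@integral_translate (s n) (fun t => G t * cos (u n * t + th))); last first.
      by apply: measurable_funM => //; exact: measurable_cos_lin.
    congr (fine _); apply: eq_integral => t _; congr (_%:E).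
    have -> : u n * (t + s n) + th = u n * t + th + pi.
      by rewrite /s; field; exact: lt0r_neq0.
    by rewrite cosDpi; ring.
  have -> : \int[mu]_t (G t * cos (u n * t + th)) =
      2^-1 * \int[mu]_t ((G t - G (t + s n)) * cos (u n * t + th)).
    rewrite (_ : \int[mu]_t ((G t - _) * _) = \int[mu]_t (G t * cos (u n * t + th)) -
         \int[mu]_t (G (t + s n) * cos (u n * t + th))); last first.
      rewrite -RintegralB//; [|exact: integrable_mul_cos|exact: integrable_mul_cos].
      by apply: eq_Rintegral => t _; rewrite mulrBl.
    by rewrite [X in _ = _ * (X - _)]E {1}E; field.
  rewrite normrM ger0_norm ?invr_ge0//.
  apply: half_le; first exact: Rintegral_ge0.
  exact: le_norm_integral_cos (u n) th (iD n).
have L : \int[mu]_t `|G t - G (t + s n)| @[n --> \oo] --> (0 : R).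
  have := @dominated_convergenceT _ TR R mu (fun n t => `|G t - G (t + s n)|) (cst 0) bnd.
  move=> /(_ _ _ _ _ ibnd) H.
  have {}H : (\int[mu]_t `|G t - G (t + s n)|%:E)%E @[n --> \oo] --> (\int[mu]_t (cst 0 t)%:E)%E.
    apply: H.
    - by move=> n; apply: measurableT_comp => //; exact: mD.
    - exact: measurable_cst.
    - move=> t; rewrite /cst -(normr0 R) -(subrr (G t)).
      apply: cvg_norm; apply: cvgB; first exact: cvg_cst.
      apply: continuous_cvg; first exact: cG.
      by rewrite -[X in _ --> X]addr0; apply: cvgD => //; exact: cvg_cst.
    - by move=> n t; rewrite normr_id.
  have I0 : (\int[mu]_t (cst (0 : R) t)%:E)%E = 0%:E by rewrite integral0.
  by rewrite I0 in H; exact: (fine_cvg H).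
apply/norm_cvg0P; apply: (squeeze_cvgr _ (cvg_cst 0) L).
by apply: nearW => n; rewrite normr_ge0 half.
Qed.

(** The cutoff min (1, max (0, M - |t|)), written with absolute values so that its continuity is
    immediate. *)
Definition tent (M t : R) : R := (`|M - `|t| | - `|M - `|t| - 1| + 1) / 2.

Lemma tent01 M t : 0 <= tent M t <= 1.
Proof.
rewrite /tent; set y := M - `|t|.
have [h|h] := leP 0 y; have [h'|h'] := leP 0 (y - 1);
  rewrite ?(ger0_norm h) ?(ltr0_norm h) ?(ger0_norm h') ?(ltr0_norm h');
  by apply/andP; split; lra.
Qed.

Lemma tent_compl M t : `|1 - tent M t| <= 1.
Proof.
have := tent01 M t; rewrite ler_norml => /andP[t0 t1].
by apply/andP; split; lra.
Qed.

Lemma tent_eq0 M t : M <= `|t| -> tent M t = 0.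
Proof.
move=> h; have h1 : M - `|t| <= 0 by lra.
have h2 : M - `|t| - 1 <= 0 by lra.
by rewrite /tent (ler0_norm h1) (ler0_norm h2); lra.
Qed.

Lemma tent_eq1 (M t : R) : `|t| <= M - 1 -> tent M t = 1.
Proof.
move=> h; have h1 : 0 <= M - `|t| by lra.
have h2 : 0 <= M - `|t| - 1 by lra.
by rewrite /tent (ger0_norm h1) (ger0_norm h2); lra.
Qed.

Lemma continuous_tent M : continuous (tent M).
Proof.
have cn (f : R -> R) : continuous f -> continuous (fun t => `|f t|).
  by move=> cf x; apply: (@continuous_comp _ _ _ f Num.norm); [exact: cf|exact: norm_continuous].
have c1 : continuous (fun t : R => M - `|t|).
  by move=> x; apply: continuousB; [exact: cst_continuous|exact: norm_continuous].
move=> x; apply: (@continuousM _ _ (fun t => `|M - `|t| | - `|M - `|t| - 1| + 1) (fun=> 2^-1)); last exact: cst_continuous.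
apply: continuousD; last exact: cst_continuous.
apply: continuousB; apply: cn => // y.
by apply: (@continuousB _ _ _ (fun t : R => M - `|t|) (cst 1)); [exact: c1|exact: cst_continuous].
Qed.

(** By density: [k] is within 2 eps / 3, in mean, of a continuous function G of compact support, one
    third being spent on the cutoff and one on the approximation inside it. *)
Lemma riemann_lebesgue_ge (k : R -> R) (th : R) (u : nat -> R) :
  mu.-integrable setT (EFin \o k) ->
  (forall n, pi <= u n) -> u n @[n --> \oo] --> +oo ->
  \int[mu]_t (k t * cos (u n * t + th)) @[n --> \oo] --> (0 : R).
Proof.
move=> ik upi uoo; have mk : measurable_fun [set: R] k by case/integrableP : ik => /measurable_EFinP.
have mt M : measurable_fun [set: R] (tent M) by apply: continuous_measurable_fun; exact: continuous_tent.
have ika := integrable_abse ik.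
apply/cvgrPdist_le => eps eps0; pose e := eps / 3; have e0 : 0 < e by rewrite divr_gt0.
have [m mP] : exists m : nat, \int[mu]_t (`|k t| * (1 - tent m%:R t)) <= e.
  have := @dominated_convergenceT _ TR R mu (fun n t => `|k t| * (1 - tent n%:R t)) (cst 0) (fun t => `|k t|).
  move=> /(_ _ _ _ _ ika) H.
  have {}H : (\int[mu]_t (`|k t| * (1 - tent n%:R t))%:E)%E @[n --> \oo] --> (\int[mu]_t (cst (0 : R) t)%:E)%E.
    apply: H.
    - move=> n; apply: measurable_funM; first exact: measurableT_comp.
      by apply: measurable_funB => //; exact: mt.
    - exact: measurable_cst.
    - move=> t; apply: cvg_near_cst; near=> n.
      rewrite tent_eq1 ?subrr ?mulr0// lerBrDr.
      by near: n; exact: nbhs_infty_ger.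
    - move=> n t; rewrite normrM normr_id ler_piMr//.
      exact: tent_compl.
  have I0 : (\int[mu]_t (cst (0 : R) t)%:E)%E = 0%:E by rewrite integral0.
  rewrite I0 in H.
  have F : \int[mu]_t (`|k t| * (1 - tent n%:R t)) @[n --> \oo] --> (0 : R) by exact: (fine_cvg H).
  move/cvgrPdist_le : F => /(_ _ e0)[m _ /(_ m (leqnn m))].
  rewrite /= sub0r normrN => h; exists m; apply: le_trans h.
  exact: ler_norm.
pose E : set R := `[- (m%:R : R), m%:R]%classic.
have mE : measurable (E : set TR) by exact: measurable_itv.
have ikE : mu.-integrable E (EFin \o k).
  by apply: (integrableS _ mE _ ik).
have Efin : (mu E < +oo)%E.
  by rewrite lebesgue_measure_itv/=; case: ifP => _; rewrite -?EFinN -?EFinD ltry.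
have [g [cg ig gcvg]] := approximation_continuous_integrable mE Efin ikE.
have [p pP] : exists p, \int[mu]_(z in E) `|k z - g p z| <= e.
  have F : \int[mu]_(z in E) `|k z - g n z| @[n --> \oo] --> (0 : R) by exact: (fine_cvg gcvg).
  move/cvgrPdist_le : F => /(_ _ e0)[p _ /(_ p (leqnn p))].
  by rewrite /= sub0r normrN => h; exists p; apply: le_trans h; exact: ler_norm.
pose G t := g p t * tent m%:R t.
have cG : continuous G.
  by move=> x; apply: continuousM; [exact: cg|exact: continuous_tent].
have G0 t : m%:R < `|t| -> G t = 0 by move=> h; rewrite /G tent_eq0 ?mulr0// ltW.
have mG : measurable_fun [set: R] G by exact: continuous_measurable_fun.
have mgp : measurable_fun [set: R] (g p) by exact: continuous_measurable_fun.
pose q t := (t \in E)%:R * `|k t - g p t|.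
have ikg : mu.-integrable E (fun t => `|k t - g p t|%:E).
  exact: (integrable_abse (integrableB mE ikE (ig p))).
have iq : mu.-integrable setT (fun t => (q t)%:E).
  have := (integrable_mkcond _ mE).1 ikg; congr (mu.-integrable setT _).
  by apply/funext => t; rewrite patchE /q; case: ifPn => _; rewrite ?mul1r ?mul0r.
have qE : \int[mu]_t q t = \int[mu]_(z in E) `|k z - g p z|.
  rewrite /Rintegral; congr (fine _); rewrite [RHS]integral_indicE//.
have ik1 : mu.-integrable setT (fun t => (`|k t| * (1 - tent m%:R t))%:E).
  apply: (@le_integrableT _ TR R mu (fun t => `|k t| * (1 - tent m%:R t)) (fun t => `|k t|)) => //.
    by apply: measurable_funM; [exact: measurableT_comp|apply: measurable_funB => //; exact: mt].
  move=> t; rewrite normrM normr_id ler_piMr//.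
  exact: tent_compl.
have bd t : `|k t - G t| <= `|k t| * (1 - tent m%:R t) + q t.
  have /andP[t0 t1] := tent01 m%:R t.
  have t1' : 0 <= 1 - tent m%:R t by rewrite subr_ge0.
  have -> : k t - G t = k t * (1 - tent m%:R t) + tent m%:R t * (k t - g p t) by rewrite /G; ring.
  apply: (le_trans (ler_normD _ _)); rewrite (normrM (k t)) (normrM (tent m%:R t)) (ger0_norm t0) (ger0_norm t1') lerD2l /q.
  rewrite mem_setE in_itv/= -ler_norml; case: (leP `|t| m%:R) => h; first by rewrite mul1r ler_piMl.
  by rewrite tent_eq0 ?mul0r// ltW.
have isum : mu.-integrable setT (fun t => (`|k t| * (1 - tent m%:R t) + q t)%:E).
  by have := integrableD measurableT ik1 iq; apply.
have ikG : mu.-integrable setT (EFin \o (fun t => k t - G t)).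
  apply: (@le_integrableT _ TR R mu (fun t => k t - G t) _ _ bd isum).
  exact: measurable_funB.
have iG : mu.-integrable setT (EFin \o G).
  have := integrableB measurableT ik ikG; congr (mu.-integrable setT _).
  by apply/funext => t /=; rewrite -EFinB subKr.
have small n : `|\int[mu]_t ((k t - G t) * cos (u n * t + th))| <= e + e.
  apply: (le_trans (le_norm_integral_cos _ _ ikG)).
  apply: (@le_trans _ _ (\int[mu]_t (`|k t| * (1 - tent m%:R t) + q t))).
    by apply: le_Rintegral => //; exact: (integrable_abse ikG).
  by rewrite RintegralD// lerD// qE.
have := riemann_lebesgue_compact th cG (ler0n _ m) G0 upi uoo.
move=> /cvgrPdist_le/(_ _ e0); apply: filterS => n.
rewrite !sub0r !normrN => h.
have -> : \int[mu]_t (k t * cos (u n * t + th)) =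
    \int[mu]_t (G t * cos (u n * t + th)) + \int[mu]_t ((k t - G t) * cos (u n * t + th)).
  rewrite -RintegralD//; [|exact: integrable_mul_cos|exact: integrable_mul_cos].
  by apply: eq_Rintegral => t _; ring.
apply: (le_trans (ler_normD _ _)); have -> : eps = e + (e + e) by rewrite /e; field.
by apply: lerD.
Unshelve. all: by end_near. Qed.

Lemma riemann_lebesgue (k : R -> R) (th : R) :
  mu.-integrable setT (EFin \o k) ->
  \int[mu]_t (k t * cos (y * t + th)) @[y --> +oo] --> (0 : R).
Proof.
move=> ik; apply/cvg_pinftyP => u uoo.
(* [v] agrees with [u] from some rank on and meets the lower bound everywhere. *)
pose v n := Num.max (u n) pi.
have uv : \forall n \near \oo, v n = u n.
  by move/cvgryPge : uoo => /(_ pi); apply: filterS => n h; rewrite /v max_l.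
have voo : v n @[n --> \oo] --> +oo.
  apply: cvg_trans uoo; apply: near_eq_cvg.
  by apply: filterS uv => n ->.
have := riemann_lebesgue_ge th ik _ voo.
have vpi n : pi <= v n by rewrite /v le_max lexx orbT.
move=> /(_ vpi); apply: cvg_trans; apply: near_eq_cvg.
by apply: filterS uv => n /= ->.
Qed.

Lemma ge0_integral_opp (g : R -> \bar R) : measurable_fun [set: R] g -> (forall x, 0 <= g x)%E ->
  (\int[mu]_x g (- x)%R = \int[mu]_x g x)%E.
Proof.
move=> mg g0; have mo : measurable_fun [set: TR] (@GRing.opp R : TR -> TR) by exact: oppr_measurable.
pose M : {measure set TR -> \bar R} :=
  measure_function_pushforward__canonical__measure_function_Measure mu mo.
have E A : measurable A -> pushforward mu (@GRing.opp R : TR -> TR) A = mu A.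
  move=> mA; apply/esym/(@lebesgue_measure_unique R M) => //= _ [[a b]] _ <-.
  rewrite /M /= /pushforward /=.
  rewrite (_ : _ @^-1` _ = `[- b, - a[%classic).
    rewrite !lebesgue_measure_itv/= !lte_fin ltrN2.
    by case: ifP => // _; rewrite -!EFinB; congr EFin; ring.
  by apply/seteqP; split => x /=; rewrite !in_itv/= => /andP[x1 x2]; apply/andP; split; lra.
rewrite [RHS](@eq_measure_integral _ _ _ _ (pushforward mu (@GRing.opp R : TR -> TR))).
  by rewrite ge0_integral_pushforward.
by move=> A mA _; apply/esym/E.
Qed.

Lemma measurable_gt0 : measurable_fun [set: R] (fun x : R => (0 < x)%R%:R : R).
Proof.
rewrite (_ : (fun _ => _) = \1_(`]0, +oo[ : set R)); first exact: measurable_indic.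
by apply/funext => s; rewrite indicE mem_setE in_itv/= andbT.
Qed.

(** On each half-line the inverse is e ^ (- ln) up to sign; both terms vanish at 0, in accordance
    with 1 / 0 = 0. *)
Lemma measurable_invr : measurable_fun [set: R] (@GRing.inv R).
Proof.
pose f (x : R) : R := (0 < x)%R%:R * expR (- ln x).
have mf : measurable_fun [set: R] f.
  apply: measurable_funM; first exact: measurable_gt0.
  apply: (measurableT_comp (@measurable_expR R)).
  by apply: (measurableT_comp (@oppr_measurable R setT)); exact: measurable_ln.
have -> : @GRing.inv R = fun x => f x - f (- x).
  apply/funext => x; rewrite /f oppr_gt0.
  have [x0|x0|->] := ltgtP x 0; rewrite ?mul1r ?mul0r ?subr0 ?sub0r.
  - by rewrite expRN lnK ?posrE ?oppr_gt0// invrN opprK.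
  - by rewrite expRN lnK ?posrE.
  - exact: invr0.
apply: measurable_funB => //; apply: (measurableT_comp mf).
exact: oppr_measurable.
Qed.

(** For t > 0 the substitution t = e ^ u turns the integrand into e ^ (u / 2) on u <= 0; negative t
    follows by parity. *)
Lemma integrable_inv_sqrt : mu.-integrable setT (fun t : TR => (box 1 t / Num.sqrt `|t|)%:E).
Proof.
have msq : measurable_fun [set: R] (@Num.sqrt R).
  by apply: continuous_measurable_fun; exact: sqrt_continuous.
have mn : measurable_fun [set: R] (fun t : R => Num.sqrt `|t|).
  by apply: (measurableT_comp msq); exact: normr_measurable.
pose f (t : R) : R := box 1 t / Num.sqrt `|t|.
have mf : measurable_fun [set: R] f.
  by apply: measurable_funM; [exact: measurable_box|exact: (measurableT_comp measurable_invr)].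
have f0 t : 0 <= f t by rewrite divr_ge0// box_ge0.
have mEf : measurable_fun [set: R] (EFin \o f) by apply/measurable_EFinP.
have fE0 x : (0 <= (EFin \o f) x)%E by rewrite lee_fin.
have half : (\int[mu]_(t in `]0%R, +oo[) (f t)%:E < +oo)%E.
  rewrite (ge0_integral_expR (g := EFin \o f))//.
  have le u : expR u * f (expR u) <= expR (- (2^-1 * `|u|)).
    rewrite /f (ger0_norm (expR_ge0 u)).
    have sE : Num.sqrt (expR u) = expR (u / 2).
      have -> : expR u = expR (u / 2) ^+ 2 by rewrite -expRM_natl; congr expR; field.
      by rewrite sqrtr_sqr ger0_norm ?expR_ge0.
    rewrite sE /box; case: (boolP (_ <= _ <= _)) => [/andP[_]|_]; last first.
      by rewrite mul0r mulr0 expR_ge0.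
    rewrite -{1}expR0 ler_expR => u0; rewrite ler0_norm// mul1r -expRB ler_expR; lra.
  apply: (@le_lt_trans _ _ (\int[mu]_u (expR (- (2^-1 * `|u|)))%:E)%E); last first.
    by rewrite integral_expRN_norm ?invr_gt0// ltry.
  apply: ge0_le_integral => //.
  - by move=> u _; rewrite -EFinM lee_fin mulr_ge0// expR_ge0.
  - apply: emeasurable_funM; first by apply/measurable_EFinP; exact: measurable_expR.
    by apply: (measurableT_comp mEf); exact: measurable_expR.
  - by apply/measurable_EFinP; exact: measurable_expRN_norm.
  - by move=> u _; rewrite -EFinM lee_fin; exact: le.
apply/integrableP; split; first exact/measurable_EFinP.
have -> : (\int[mu]_x `|(box 1 x / Num.sqrt `|x|)%:E| = \int[mu]_x (EFin \o f) x)%E.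
  by apply: eq_integral => x _; rewrite abse_EFin -/(f x) (ger0_norm (f0 x)).
pose p x := ((0 < x)%R%:R * f x)%:E.
have mp : measurable_fun [set: R] p.
  apply/measurable_EFinP; apply: measurable_funM => //.
  exact: measurable_gt0.
have p0 x : (0 <= p x)%E by rewrite lee_fin mulr_ge0.
have pE : (\int[mu]_x p x = \int[mu]_(t in `]0%R, +oo[) (f t)%:E)%E.
  rewrite [RHS]integral_indicE//; apply: eq_integral => x _.
  by rewrite mem_setE in_itv/= andbT -EFinM.
have -> : (\int[mu]_x (EFin \o f) x = \int[mu]_x p x + \int[mu]_x p x)%E.
  rewrite -{2}(ge0_integral_opp mp p0) -ge0_integralD//; last first.
    by apply: (measurableT_comp mp); exact: oppr_measurable.
  apply: eq_integral => x _; rewrite /p -EFinD /= oppr_gt0; congr (_%:E).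
  have fN : f (- x) = f x.
    by rewrite /f /box -!ler_norml normrN.
  rewrite fN; case: (ltgtP x 0) => [x0|x0|->]; rewrite ?mul1r ?mul0r ?addr0 ?add0r//.
  by rewrite /f normr0 sqrtr0 invr0 mulr0.
by rewrite pE lte_add_pinfty.
Qed.

End RiemannLebesgue.

(** * Fourier inversion under Dini's condition *)

Section FourierInversion.
Context {R : realType}.
Notation mu := (@lebesgue_measure R).
Notation TR := (measurableTypeR R).
Local Open Scope complex_scope.

Definition cos_transform (h : R -> R) (y th : R) : R := \int[mu]_t (h t * cos (y * t + th)).

Lemma integral_opp (f : R -> R) : measurable_fun [set: R] f ->
  (\int[mu]_x (f (- x))%:E = \int[mu]_x (f x)%:E)%E.
Proof.
move=> mf; have mE : measurable_fun [set: R] (EFin \o f) by apply/measurable_EFinP.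
rewrite [LHS]integralE [RHS]integralE.
rewrite -(ge0_integral_opp (measurable_funepos mE)); last by move=> x; exact: funepos_ge0.
rewrite -(ge0_integral_opp (measurable_funeneg mE)); last by move=> x; exact: funeneg_ge0.
by congr (_ - _)%E; apply: eq_integral => t _; rewrite ?funeposE ?funenegE.
Qed.

(* 1 / z as a Laplace transform: the case of a single eigenvalue, where the
   slice distribution is the indicator function of [0, +oo[. *)
Lemma cmom_rslice0 (z : R[i]) : 0 < complex.Re z -> cmom mu id (@rslice_weight R 1 0) z = z^-1.
Proof.
move=> z0; have Gz := gam_neq0 (isT : (0 < 1)%N) z0.
have := selb_slice (isT : (0 < 1)%N) 0 z0.
rewrite cmom_gamma_weight (cGammaE 1) mulr1 /slice_exponent !mulr0 add0r mul1r gamS//.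
move=> H; have z1 : z != 0 by apply: contraTneq z0 => ->; rewrite /= ltxx.
by apply: (mulfI (mulf_neq0 z1 Gz)); rewrite -H mulrAC mulfV// mul1r.
Qed.

Lemma rslice0 beta (x : R) : rslice beta 0 x = (0 <= x)%R%:R.
Proof.
rewrite /rslice /slice_distr integral_tuple0 /=.
rewrite /slice_weight /texp /pairprod !big_ord1 big_pred0 ?mul1r; last first.
  by move=> j; rewrite ltnNge leq_ord.
by rewrite /zcons tnth0 /tsum big_ord0 oppr0 ler_expR.
Qed.

Lemma rslice_weight0 (u : R) : @rslice_weight R 1 0 u = (u <= 0)%R%:R.
Proof.
by rewrite /rslice_weight /slice_exponent !mulr0 mul0r expR0 mul1r rslice0 oppr_ge0.
Qed.

(** The function is the sum of [q], which is e ^ t on t <= 0, and of its reflection; the transform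
    of [q] is read off 1 / (1 + i v) by [cmom_rslice0]. *)
Lemma cos_transform_exp_norm (y th : R) :
  cos_transform (fun t => expR (- `|t|)) y th = 2 * cos th / (1 + y ^+ 2).
Proof.
pose q (t : R) : R := expR (1 * t) * @rslice_weight R 1 0 t.
have qE t : q t = expR t * (t <= 0)%R%:R by rewrite /q mul1r rslice_weight0.
have mid : measurable_fun setT (id : TR -> TR) by exact: measurable_id.
have iw := @integrable_rslice_weight R 1 isT 0.
have mw := @measurable_rslice_weight R 1 0; have w0 := @rslice_weight_ge0 R 1 0.
have iq : mu.-integrable setT (EFin \o q) by exact: iw.
have mq : measurable_fun [set: R] q by case/integrableP : iq => /measurable_EFinP.
have m v t : cos_transform q v t = (cos t + sin t * v) / (1 + v ^+ 2).
  have -> : cos_transform q v t = mom mu id (@rslice_weight R 1 0) 1 v t by [].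
  rewrite (mom_phase mid mw w0 iw v t ltr01).
  have := cmom_rslice0 (z := 1 +i* v) ltr01; rewrite cmomE => -[-> ->].
  by rewrite expr1n; ring.
have mcos v t : measurable_fun [set: R] (fun x : R => q x * cos (v * x + t)).
  by apply: measurable_funM => //; exact: measurable_cos_lin.
have mqo : measurable_fun [set: R] (fun x => q (- x)).
  by apply: (measurableT_comp mq); exact: oppr_measurable.
have E2 : \int[mu]_t (q (- t) * cos (y * t + th)) = cos_transform q (- y) th.
  rewrite /cos_transform /Rintegral -(integral_opp (mcos (- y) th)).
  by congr (fine _); apply: eq_integral => t _; rewrite mulNr mulrN opprK.
have iqo : mu.-integrable setT (EFin \o (fun t => q (- t))).
  apply/integrableP; split; first exact/measurable_EFinP.
  case/integrableP : iq => mEq; rewrite -(ge0_integral_opp (g := fun x => `|(q x)%:E|%E))//.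
  by apply: measurableT_comp => //; exact/measurable_EFinP.
transitivity (\int[mu]_t (q t * cos (y * t + th) + q (- t) * cos (y * t + th))).
  rewrite /cos_transform /Rintegral; congr (fine _).
  apply: ae_eq_integral => //.
  - apply/measurable_EFinP; apply: measurable_funM; last exact: measurable_cos_lin.
    apply: (measurableT_comp (@measurable_expR R)); apply: (measurableT_comp (@oppr_measurable R setT)).
    exact: normr_measurable.
  - apply/measurable_EFinP; apply: measurable_funD; first exact: mcos.
    by apply: measurable_funM => //; exact: measurable_cos_lin.
  (* At t = 0 both halves are counted and the sum is 2, so the equality holds only almost
     everywhere. *)
  - exists [set 0]; split; [exact: measurable_set1|exact: lebesgue_measure_set1|].
    move=> t /= /existsNP[_ ht]; apply: contrapT => /eqP t0; apply: ht.
    congr (_%:E); rewrite -mulrDl !qE oppr_le0; congr (_ * _).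
    by case: (ltgtP t 0) t0 => // h _; rewrite ?mulr1 ?mulr0 ?addr0 ?add0r ?(ltr0_norm h) ?(gtr0_norm h) ?opprK.
rewrite RintegralD//; [|exact: integrable_mul_cos|exact: integrable_mul_cos].
rewrite E2 -/(cos_transform q y th) !m sqrrN; field.
by rewrite gt_eqF// ltr_pwDl// sqr_ge0.
Qed.

Section Primitive.
Variables (k : R -> R) (l : R).
Hypothesis ik : mu.-integrable setT (EFin \o k).
Hypothesis itk : mu.-integrable setT (fun t => (t * k t)%:E).

Lemma is_derive_cos_lin (a b y : R) :
  is_derive y (1 : R) (fun y => cos (y * a + b)) (- a * sin (y * a + b)).
Proof.
have da : is_derive y (1 : R) (fun y : R => y * a + b) a.
  have -> : (fun y : R => y * a + b) = (a \*: (id : R -> R)) + cst b.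
    by apply/funext => v; rewrite !fctE /GRing.scale/= mulrC.
  have := is_deriveD (is_deriveZ a (is_derive_id y (1 : R))) (is_derive_cst b y (1 : R)).
  by move=> h; apply: (is_derive_eq h); rewrite /GRing.scale/= mulr1 addr0.
have := @is_derive1_comp R (@cos R) (fun y : R => y * a + b) y _ _ (is_derive_cos (y * a + b)) da.
by move=> h; apply: (is_derive_eq h); ring.
Qed.

(** The phase - pi / 2 makes the cosine a sine; differentiation under the integral sign is dominated
    by the integrable function |l t k(t)|. *)
Lemma is_derive_cos_transform (y th : R) :
  is_derive y (1 : R) (fun y => cos_transform k (l * y) (th - pi / 2))
    (l * cos_transform (fun t => t * k t) (l * y) th).
Proof.
pose f (y t : R) : R := k t * cos (l * y * t + (th - pi / 2)).
have df (x t : R) : is_derive x (1 : R) (f ^~ t) (l * (t * k t * cos (l * x * t + th))).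
  have := is_derive_cos_lin (l * t) (th - pi / 2) x => /(is_deriveZ (k t)).
  rewrite (_ : (k t \*: (fun y0 : R => cos (y0 * (l * t) + (th - pi / 2)))) = f ^~ t); last first.
    by apply/funext => v; rewrite /f /GRing.scale/= [v * _]mulrCA mulrA.
  move=> h; apply: (is_derive_eq h); rewrite /GRing.scale/= addrA sinBpihalf.
  by rewrite [x * _]mulrCA mulrA; ring.
have intf x : (`]y - 1, y + 1[%classic : set R) x -> mu.-integrable setT (EFin \o f x).
  by move=> _; exact: integrable_mul_cos.
have Iy : (`]y - 1, y + 1[%classic : set R) y by rewrite /= in_itv/=; apply/andP; split; lra.
have der x t : (`]y - 1, y + 1[%classic : set R) x -> setT t -> derivable (f ^~ t) x 1.
  by move=> _ _; exact: ex_derive.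
pose G (t : R) := `|l| * `|t * k t|.
have G0 t : 0 <= G t by rewrite mulr_ge0.
have iG : mu.-integrable setT (EFin \o G).
  exact: (integrableZl measurableT `|l| (integrable_abse itk)).
have d1 x t : partial1of2 f x t = l * (t * k t * cos (l * x * t + th)).
  by rewrite partial1of2E; apply: derive_val.
have Gub x t : (`]y - 1, y + 1[%classic : set R) x -> setT t -> `|partial1of2 f x t| <= G t.
  by move=> _ _; rewrite d1 normrM ler_wpM2l// normrM ler_piMr// normr_cos_le1.
have D := derivable_under_integral measurableT Iy intf der G0 iG Gub.
have V := differentiation_under_integral measurableT Iy intf der G0 iG Gub.
apply: DeriveDef; first exact: D.
rewrite -derive1E V -RintegralZl//.
  by apply: eq_Rintegral => t _; rewrite d1.
exact: (integrable_mul_cos (k := fun t => t * k t)).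
Qed.

End Primitive.

Lemma continuous_cos_transform (h : R -> R) (l th : R) : mu.-integrable setT (EFin \o h) ->
  continuous (fun y => cos_transform h (l * y) th).
Proof.
move=> ih y.
have := @continuity_under_integral R _ TR mu (fun y t => h t * cos (l * y * t + th)) setT
  measurableT (y - 1) (y + 1) _ _ (fun t => `|h t|).
apply.
- by move=> x _; exact: integrable_mul_cos.
- apply: aeW => t _ x _; apply: continuousM; first exact: cst_continuous.
  apply: (@continuous_comp _ _ _ (fun x => l * x * t + th) (@cos R)); last exact: continuous_cos.
  apply: continuousD; last exact: cst_continuous.
  apply: continuousM; last exact: cst_continuous.
  apply: continuousM; [exact: cst_continuous|exact: (fun _ => id)].
- exact: (integrable_abse ih).
- by move=> x _; apply: aeW => t _; rewrite normrM ler_piMr// normr_cos_le1.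
- by rewrite inE/= in_itv/=; apply/andP; split; lra.
Qed.

Lemma Rintegral_is_derive (F f : R -> R) (a b : R) : a < b ->
  (forall x : R, is_derive x (1 : R) F (f x)) -> continuous f ->
  \int[mu]_(y in `[a, b]) f y = F b - F a.
Proof.
move=> ab dF cf; rewrite /Rintegral (@continuous_FTC2 _ f F _ _ ab)//.
- exact: continuous_subspaceT.
- have cF (x : R) : {for x, continuous F} by exact: (is_derive_continuous (dF x)).
  split.
  + by move=> x _; apply: ex_derive; exact: dF.
  + by apply: cvg_at_right_filter; exact: cF.
  + by apply: cvg_at_left_filter; exact: cF.
- by move=> x _; rewrite derive1E; apply: derive_val; exact: dF.
Qed.

Section Inversion.
Variables (h : R -> R) (l : R).
Hypotheses (ih : mu.-integrable setT (EFin \o h)) (l0 : 0 < l).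

(** Subtracting h(0) e ^ (- |t|) cancels the value at 0 and keeps integrability at infinity;
    integrability of the quotient is Dini's condition at 0. *)
Definition dini_quotient (t : R) : R := (h t - h 0 * expR (- `|t|)) / t.

Local Notation k := dini_quotient.

Hypothesis ik : mu.-integrable setT (EFin \o k).

Lemma dini_quotientE t : t * k t = h t - h 0 * expR (- `|t|).
Proof.
rewrite /dini_quotient; have [->|t0] := eqVneq t 0; last by rewrite mulrC divfK.
by rewrite mul0r normr0 oppr0 expR0 mulr1 subrr.
Qed.

Lemma integrable_exp_norm : mu.-integrable setT (EFin \o (fun t : R => expR (- `|t|))).
Proof.
have := integrable_expRN_norm (@ltr01 R); congr (mu.-integrable setT _).
by apply/funext => t /=; rewrite mul1r.
Qed.

Lemma integrable_mul_dini : mu.-integrable setT (fun t => (t * k t)%:E).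
Proof.
have := integrableB measurableT ih (integrableZl measurableT (h 0) integrable_exp_norm).
by congr (mu.-integrable setT _); apply/funext => t; rewrite dini_quotientE.
Qed.

(* Dini's criterion: h is h 0 e ^ (- |t|), whose transform is explicit, plus
   t k t, whose transform is the derivative of that of k. *)
Lemma cos_transform_dini y th :
  cos_transform h y th = 2 * h 0 * cos th / (1 + y ^+ 2) + cos_transform (fun t => t * k t) y th.
Proof.
have -> : 2 * h 0 * cos th / (1 + y ^+ 2) = h 0 * cos_transform (fun t => expR (- `|t|)) y th.
  by rewrite cos_transform_exp_norm; ring.
have i1 := integrable_mul_cos y th integrable_exp_norm.
have i2 := @integrable_mul_cos R (fun t => t * k t) y th integrable_mul_dini.
rewrite /cos_transform -RintegralZl// -RintegralD//.
  by apply: eq_Rintegral => t _; rewrite dini_quotientE; ring.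
exact: (integrableZl measurableT (h 0) i1).
Qed.

(** The arctangent integrates the transform of h(0) e ^ (- |t|), the second term that of t k(t). *)
Definition transform_primitive (th y : R) : R :=
  2 * h 0 * cos th / l * atan (l * y) + l^-1 * cos_transform k (l * y) (th - pi / 2).

Lemma is_derive_transform_primitive th (y : R) :
  is_derive y (1 : R) (transform_primitive th) (cos_transform h (l * y) th).
Proof.
have dl : is_derive y (1 : R) (fun y : R => l * y) l.
  have := is_deriveZ l (is_derive_id y (1 : R)).
  by move=> d; apply: (is_derive_eq d); rewrite /GRing.scale/= mulr1.
have da := @is_derive1_comp R (@atan R) (fun y : R => l * y) y _ _ (is_derive1_atan (l * y)) dl.
have dk := is_derive_cos_transform l ik integrable_mul_dini y th.
have := is_deriveD (is_deriveZ (2 * h 0 * cos th / l) da) (is_deriveZ l^-1 dk).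
move=> d; apply: (is_derive_eq d); rewrite /GRing.scale/= cos_transform_dini.
by field; rewrite (lt0r_neq0 l0) gt_eqF// ltr_pwDl// sqr_ge0.
Qed.

Lemma integral_cos_transform th (A B : R) : - A < B ->
  \int[mu]_(y in `[- A, B]) cos_transform h (l * y) th =
  transform_primitive th B - transform_primitive th (- A).
Proof.
move=> AB; apply: (Rintegral_is_derive AB); last exact: continuous_cos_transform.
exact: is_derive_transform_primitive.
Qed.

Lemma cvg_mulr_pinfty : l * x @[x --> +oo] --> +oo.
Proof.
apply/cvgryPge => a; near=> x; rewrite mulrC -ler_pdivrMr//.
Unshelve. all: by end_near. Qed.

Lemma cvg_transform_primitive th :
  transform_primitive th x @[x --> +oo] --> pi * h 0 * cos th / l.
Proof.
have -> : pi * h 0 * cos th / l = 2 * h 0 * cos th / l * (pi / 2) + l^-1 * 0 by field; exact: lt0r_neq0.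
apply: cvgD; apply: cvgM; [exact: cvg_cst| |exact: cvg_cst|].
- exact: (cvg_comp _ _ cvg_mulr_pinfty (@cvgy_atan R)).
- exact: (cvg_comp _ _ cvg_mulr_pinfty (@riemann_lebesgue R k (th - pi / 2) ik)).
Qed.

Lemma cvg_transform_primitiveN th :
  transform_primitive th (- x) @[x --> +oo] --> - (pi * h 0 * cos th / l).
Proof.
have -> : - (pi * h 0 * cos th / l) = - (2 * h 0 * cos th / l) * (pi / 2) + l^-1 * 0 by field; exact: lt0r_neq0.
have E x : transform_primitive th (- x) = - (2 * h 0 * cos th / l) * atan (l * x) +
    l^-1 * cos_transform k (l * x) (pi / 2 - th).
  rewrite /transform_primitive mulrN atanN mulrN mulNr; congr (_ + _ * _).
  apply: eq_Rintegral => t _; congr (_ * _); rewrite -[RHS]cosN; congr cos; ring.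
under eq_fun do rewrite E.
apply: cvgD; apply: cvgM; [exact: cvg_cst| |exact: cvg_cst|].
- exact: (cvg_comp _ _ cvg_mulr_pinfty (@cvgy_atan R)).
- exact: (cvg_comp _ _ cvg_mulr_pinfty (@riemann_lebesgue R k (pi / 2 - th) ik)).
Qed.

(** The primitive has a limit at each end: the arctangent gives pi / 2 up to sign, and the other
    term vanishes by the Riemann-Lebesgue lemma. Hence the two ends may tend to infinity
    independently. *)
Lemma fourier_inversion th :
  (fun ab : R * R => \int[mu]_(y in `[- ab.1, ab.2]) cos_transform h (l * y) th)
    @ filter_prod (pinfty_nbhs R) (pinfty_nbhs R) --> 2 * pi * h 0 * cos th / l.
Proof.
have c2 : transform_primitive th ab.2 @[ab --> filter_prod (pinfty_nbhs R) (pinfty_nbhs R)]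
    --> pi * h 0 * cos th / l.
  apply: (@cvg_comp _ _ _ snd (transform_primitive th) _ (pinfty_nbhs R)); first exact: cvg_snd.
  exact: cvg_transform_primitive.
have c1 : transform_primitive th (- ab.1) @[ab --> filter_prod (pinfty_nbhs R) (pinfty_nbhs R)]
    --> - (pi * h 0 * cos th / l).
  apply: (@cvg_comp _ _ _ fst (fun x => transform_primitive th (- x)) _ (pinfty_nbhs R)); first exact: cvg_fst.
  exact: cvg_transform_primitiveN.
have -> : 2 * pi * h 0 * cos th / l = pi * h 0 * cos th / l - - (pi * h 0 * cos th / l) by ring.
apply: cvg_trans (cvgB c2 c1); apply: near_eq_cvg.
exists ([set x | 0 < x], [set x | 0 < x]); first by split; exists 0; split.
move=> [a b] [/= a0 b0]; rewrite integral_cos_transform//.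
by apply: lt_trans b0; rewrite oppr_lt0.
Qed.

End Inversion.

End FourierInversion.

(** * The delta-function integral in logarithmic variables *)

Section DeltaIntegral.
Context {R : realType}.
Notation mu := (@lebesgue_measure R).
Notation TR := (measurableTypeR R).
Notation leb := (@lebesgue_tuple R).
Variable beta : nat.

(** The density of d sigma / sigma on the half-line, the measure left once the delta function is
    integrated out. The map [phi] is sigma = e ^ (u / 2), so that sigma ^ 2 = e ^ u. *)
Let w1 (x : R) : R := (0 < x)%R%:R / x.
Let phi (u : R) : R := expR (u / 2).

Let mw1 : measurable_fun [set: R] w1.
Proof. by apply: measurable_funM; [exact: measurable_gt0|exact: measurable_invr]. Qed.

Let mphi : measurable_fun [set: R] phi.
Proof. by apply: (measurableT_comp (@measurable_expR R)); exact: measurable_funM. Qed.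

Let w10 x : 0 <= w1 x.
Proof. by rewrite /w1; have [x0|x0] := ltP 0 x; rewrite ?mul0r// mul1r invr_ge0 ltW. Qed.

Let subst_half (q : R -> \bar R) : measurable_fun [set: R] q -> (forall x, 0 <= q x)%E ->
  (\int[mu]_x ((w1 x)%:E * q x) = \int[mu]_x ((2^-1)%:E * q (phi x)))%E.
Proof.
move=> mq q0; have h0 : 0 < 2^-1 :> R by rewrite invr_gt0.
have mqe : measurable_fun [set: R] (fun u : R => q (expR u)).
  by apply: (measurableT_comp mq); exact: measurable_expR.
have mqp : measurable_fun [set: R] (fun u : R => q (phi u)) by exact: measurableT_comp.
pose q2 x := ((w1 x)%:E * q x)%E.
have mq2 : measurable_fun [set: R] q2 by apply: emeasurable_funM => //; exact/measurable_EFinP.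
have q20 x : (0 <= q2 x)%E by rewrite mule_ge0// lee_fin.
transitivity (\int[mu]_(x in `]0%R, +oo[) q2 x)%E.
  rewrite [RHS]integral_indicE//; apply: eq_integral => x _; rewrite mem_setE in_itv/= andbT /q2 /w1.
  by have [x0|x0] := ltP 0 x; rewrite ?mul1e ?mul0r ?mul0e.
rewrite ge0_integral_expR//.
transitivity (\int[mu]_u q (expR u))%E.
  apply: eq_integral => u _; rewrite /q2 /w1 expR_gt0 mul1r muleA -EFinM divff ?mul1e//.
  by rewrite gt_eqF// expR_gt0.
rewrite (ge0_integral_scale h0 mqe)//.
transitivity ((2^-1)%:E * \int[mu]_u q (phi u))%E.
  by congr (_ * _)%E; apply: eq_integral => u _; rewrite /phi [u / 2]mulrC.
by rewrite ge0_integralZl// lee_fin ltW.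
Qed.

Definition sqr_diff (x y : R) : R := `|x ^+ 2 - y ^+ 2| ^+ beta.

Lemma sqr_diffC x y : sqr_diff x y = sqr_diff y x.
Proof. by rewrite /sqr_diff distrC. Qed.

Lemma sqr_diff_ge0 x y : 0 <= sqr_diff x y.
Proof. by rewrite exprn_ge0. Qed.

Definition unit_cons n (t : n.-tuple R) : n.+1.-tuple R := [tuple of (\prod_(x <- t) x)^-1 :: t].

(** The determined coordinate comes last in [delta_integral] and first in the slices; as the
    integrand is symmetric, a permutation reconciles the two. *)
Lemma complete_unit_prod_perm n (t : n.-tuple R) : exists s : {perm 'I_n.+1},
  forall i, complete_unit_prod t i = tnth (unit_cons t) (s i).
Proof.
pose t' : n.+1.-tuple R := [tuple of rcons t (\prod_(x <- t) x)^-1].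
have /tuple_permP[s sE] : perm_eq t' (unit_cons t) by rewrite perm_rcons.
exists s => i; have -> : complete_unit_prod t i = tnth t' i by rewrite (tnth_nth 0).
by rewrite (tnth_nth 0) sE -tnth_nth tnth_mktuple.
Qed.

Definition slice_fun n (r : R) (t : n.-tuple R) : R :=
  (\sum_(i < n.+1) tnth (unit_cons t) i ^+ 2 <= r ^+ 2)%R%:R * pairprod sqr_diff (unit_cons t).

Lemma measurable_slice_fun n r : measurable_fun setT (fun t : n.-tuple TR => slice_fun r t).
Proof.
have mp : measurable_fun setT (fun t : n.-tuple TR => \prod_(x <- t) x).
  rewrite (_ : (fun _ => _) = fun t : n.-tuple TR => \prod_(i < n) tnth t i).
    by apply: measurable_prod => i _; exact: measurable_tnth.
  by apply/funext => t; rewrite big_tuple.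
have mu1 : measurable_fun setT (@unit_cons n : n.-tuple TR -> n.+1.-tuple TR).
  apply: (measurable_cons (f := fun t : n.-tuple TR => (\prod_(x <- t) x)^-1 : TR) (g := id)) => //.
  exact: (measurableT_comp measurable_invr).
apply: measurable_funM.
  apply: measurable_le_fun => //.
  apply: (measurableT_comp (f := fun t : n.+1.-tuple TR => \sum_(i < n.+1) tnth t i ^+ 2)) => //.
  by apply: (measurable_tsum (f := fun x : R => x ^+ 2)); exact: measurable_funX.
apply: (measurableT_comp (f := fun t : n.+1.-tuple TR => pairprod sqr_diff t)) => //.
apply: measurable_pairprod; apply: measurable_funX.
apply: measurableT_comp; first exact: normr_measurable.
by apply: measurable_funB; apply: measurable_funX; [exact: measurable_fst|exact: measurable_snd].
Qed.

Lemma slice_fun_ge0 n r (t : n.-tuple R) : 0 <= slice_fun r t.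
Proof. by rewrite mulr_ge0// pairprod_ge0//; exact: sqr_diff_ge0. Qed.

Lemma slice_fun_exp n r (u : n.-tuple R) : 0 < r ->
  slice_fun r [tuple of map phi u] =
  slice_weight beta u * (texp (zcons u) <= expR (2 * ln r))%R%:R.
Proof.
move=> r0.
have pE : (\prod_(x <- [tuple of map phi u]) x)^-1 = phi (- tsum u).
  rewrite big_map big_tuple /phi -expR_sum -expRN; congr expR.
  by rewrite /tsum mulNr mulr_suml.
have uE : unit_cons [tuple of map phi u] = [tuple of map phi (zcons u)].
  by apply: val_inj => /=; rewrite -pE.
have phi2 x : phi x ^+ 2 = expR x by rewrite /phi -expRM_natl; congr expR; field.
rewrite /slice_fun uE mulrC; congr (_ * _).
  apply: eq_bigr => i _; apply: eq_bigr => j _; rewrite !tnth_map /sqr_diff !phi2.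
  by rewrite /vdm_factor addr0 sqrtr_sqr.
have -> : r ^+ 2 = expR (2 * ln r) by rewrite expRM_natl lnK.
by congr (_ <= _)%R%:R; apply: eq_bigr => i _; rewrite tnth_map phi2.
Qed.

(** With sigma = e ^ (u / 2), each of the n = N - 1 free variables has d sigma / sigma = du / 2,
    whence 2 ^ (- n); the condition on the sum of squares becomes that of [slice_distr] at 2 ln
    r. *)
Lemma IhatE n (r : R) : 0 < r ->
  Ihat beta n.+1 r = (n.+1`!%:R^-1 * (2^-1 ^+ n * rslice beta n (2 * ln r)))%:E.
Proof.
move=> r0; rewrite /Ihat EFinM; congr (_ * _)%E; rewrite /delta_integral/= integral_mkcond.
have P0 m (w : R -> R) (t : m.-tuple R) : (forall x, 0 <= w x) -> 0 <= \prod_(i < m) w (tnth t i).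
  by move=> w0; apply: prodr_ge0.
transitivity (\int[leb n]_t ((\prod_(i < n) w1 (tnth t i))%:E * (slice_fun r t)%:E))%E.
  apply: eq_integral => t _; rewrite patchE.
  have [s sE] := complete_unit_prod_perm t.
  have sumE : \sum_(j < n.+1) complete_unit_prod t j ^+ 2 = \sum_(i < n.+1) tnth (unit_cons t) i ^+ 2.
    by rewrite [RHS](reindex_inj (@perm_inj _ s)); apply: eq_bigr => i _; rewrite sE.
  have prodE : \prod_(j < n.+1) \prod_(k < n.+1 | (j < k)%N)
      `|complete_unit_prod t j ^+ 2 - complete_unit_prod t k ^+ 2| ^+ beta = pairprod sqr_diff (unit_cons t).
    have H := prod_pair_perm (h := fun i j => sqr_diff (tnth (unit_cons t) i) (tnth (unit_cons t) j)) s
      (fun i j => sqr_diffC _ _) (fun i j => sqr_diff_ge0 _ _).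
    apply: etrans H.
    by apply: eq_bigr => i _; apply: eq_bigr => j _; rewrite /sqr_diff !sE.
  rewrite prodE -EFinM.
  have [/forallP t0|] := boolP [forall i, 0 < tnth t i]; last first.
    rewrite negb_forall => /existsP[i ti]; rewrite (bigD1 i)//= {1}/w1 (negbTE ti) !mul0r.
    by rewrite memNset// => -[/= t0 _]; move: ti; rewrite t0.
  have p0 : 0 < \prod_(x <- t) x by rewrite big_tuple; apply: prodr_gt0 => i _; exact: t0.
  have -> : \prod_(i < n) w1 (tnth t i) = (\prod_(x <- t) x)^-1.
    rewrite big_tuple -prodfV; apply: eq_bigr => i _.
    by rewrite /w1 t0 mul1r.
  rewrite /slice_fun; have [rs|rs] := boolP (\sum_(i < n.+1) tnth (unit_cons t) i ^+ 2 <= r ^+ 2).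
    rewrite mul1r mulrC mem_set//=; split=> //; split; last by rewrite sumE.
    move=> l; rewrite sE; case: (unliftP ord0 (s l)) => [k ->|->].
      by rewrite tnthS.
    by rewrite tnth0 invr_gt0.
  rewrite mul0r mulr0 memNset// => -[/= _ []]; rewrite sumE => _ h.
  by move: rs; rewrite h.
rewrite (ge0_integral_map_tuple (w2 := cst 2^-1) mphi mw1 (measurable_cst _) w10 _ subst_half); last 3 first.
- by move=> x; rewrite invr_ge0.
- by apply/measurable_EFinP; exact: measurable_slice_fun.
- by move=> t; rewrite lee_fin slice_fun_ge0.
rewrite EFinM -rsliceE /slice_distr -ge0_integralZl; last first.
- by rewrite lee_fin exprn_ge0// invr_ge0.
- by move=> t _; rewrite lee_fin mulr_ge0// slice_weight_ge0.
- apply/measurable_EFinP; apply: measurable_funM; first exact: measurable_slice_weight.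
  by apply: measurable_le_fun => //; exact: measurable_texp_zcons.
- exact: measurableT.
apply: eq_integral => t _; rewrite slice_fun_exp// prodr_const card_ord.
by [].
Qed.

End DeltaIntegral.

(** * The function to invert and its Dini condition *)

Section InverseLaplace.
Context {R : realType}.
Notation mu := (@lebesgue_measure R).
Notation TR := (measurableTypeR R).
Notation leb := (@lebesgue_tuple R).
Local Open Scope complex_scope.

Lemma expR_dist_le (M x y : R) : x <= M -> y <= M -> `|expR x - expR y| <= expR M * `|x - y|.
Proof.
wlog xy : x y / x <= y => [H|] xM yM.
  have [/H|/ltW/H] := leP x y; first exact.
  by rewrite distrC [`|x - y|]distrC; apply.
rewrite distrC [`|x - y|]distrC !ger0_norm ?subr_ge0 ?ler_expR//.
exact: expR_lip.
Qed.

Lemma normr_le_sqrt (t : R) : `|t| <= 1 -> `|t| <= Num.sqrt `|t|.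
Proof.
move=> t1; rewrite -[leLHS]sqr_sqrtr// expr2 ler_piMr ?sqrtr_ge0//.
by rewrite -[leRHS](sqrtr1 R) ler_wsqrtr.
Qed.

(** For |t| <= d the quotient is at most a multiple of 1 / sqrt |t|, and beyond d the division by t
    costs at most 1 / d. *)
Lemma integrable_dini (h : R -> R) (d C : R) : 0 < d <= 1 -> 0 <= C ->
  mu.-integrable setT (EFin \o h) ->
  (forall t, `|t| <= d -> `|h t - h 0| <= C * Num.sqrt `|t|) ->
  mu.-integrable setT (EFin \o dini_quotient h).
Proof.
move=> /andP[d0 d1] C0 ih hd.
have mh : measurable_fun [set: R] h by case/integrableP : ih => /measurable_EFinP.
have me : measurable_fun [set: R] (fun t : R => expR (- `|t|)).
  by have := @integrable_exp_norm R => /integrableP[/measurable_EFinP].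
pose B1 (t : R) := (C + `|h 0|) * (box 1 t / Num.sqrt `|t|).
pose B2 (t : R) := d^-1 * (`|h t| + `|h 0| * expR (- `|t|)).
have iB : mu.-integrable setT (fun t : TR => (B1 t + B2 t)%:E).
  have i1 := integrableZl measurableT (C + `|h 0|) (@integrable_inv_sqrt R).
  have i3 := integrableZl measurableT `|h 0| (@integrable_exp_norm R).
  have i2 := integrableZl measurableT d^-1 (integrableD measurableT (integrable_abse ih) i3).
  by have := integrableD measurableT i1 i2; apply.
apply: (@le_integrableT _ TR R mu (dini_quotient h) (fun t => B1 t + B2 t)) => //.
  apply: measurable_funM; last exact: measurable_invr.
  by apply: measurable_funB => //; apply: measurable_funM.
move=> t; rewrite /dini_quotient normrM normfV.
have e0 : 0 <= expR (- `|t|) by exact: expR_ge0.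
have B20 : 0 <= B2 t by rewrite mulr_ge0 ?invr_ge0 ?(ltW d0)// addr_ge0// mulr_ge0.
have B10 : 0 <= B1 t by rewrite mulr_ge0 ?addr_ge0// divr_ge0 ?box_ge0 ?sqrtr_ge0.
have [td|td] := leP `|t| d; last first.
  apply: (@le_trans _ _ (B2 t)); last by rewrite lerDr.
  rewrite /B2 mulrC ler_pM ?invr_ge0//.
    by rewrite lef_pV2 ?posrE// ?ltW// (lt_trans d0).
  by apply: (le_trans (ler_normB _ _)); rewrite normrM (ger0_norm e0).
apply: (@le_trans _ _ (B1 t)); last by rewrite lerDl.
have [->|t0] := eqVneq t 0; first by rewrite normr0 invr0 mulr0 /B1 normr0 sqrtr0 invr0 !mulr0.
have tp : 0 < `|t| by rewrite normr_gt0.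
have t1 : `|t| <= 1 by exact: le_trans td d1.
rewrite /B1 /box -ler_norml t1 mul1r ler_pdivrMr//.
have -> : (C + `|h 0|) * (Num.sqrt `|t|)^-1 * `|t| = (C + `|h 0|) * Num.sqrt `|t|.
  rewrite -{2}[`|t|]sqr_sqrtr// expr2 -!mulrA; congr (_ * _).
  by rewrite mulrA mulVf ?mul1r// gt_eqF// sqrtr_gt0.
have -> : h t - h 0 * expR (- `|t|) = (h t - h 0) + h 0 * (expR 0 - expR (- `|t|)) by rewrite expR0; ring.
apply: (le_trans (ler_normD _ _)); rewrite mulrDl lerD ?hd// normrM ler_wpM2l//.
apply: le_trans (normr_le_sqrt t1).
have N0 : - `|t| <= 0 by rewrite oppr_le0.
by have := expR_dist_le (lexx 0) N0; rewrite expR0 mul1r opprK add0r normr_id.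
Qed.

Variable beta : nat.
Hypothesis beta_gt0 : (0 < beta)%N.
Variable n : nat.
Local Notation N := (n.+1%:R : R).
Local Notation e := (slice_exponent beta n : R).
Local Notation W2 := (@rslice_weight R beta n).

(** For n = 0 the distribution is an indicator function, constant within |x0| / 2 of x0 != 0; for n
    > 0 this is [rslice_holder]. *)
Lemma rslice_local (x0 : R) : (n = 0%N -> x0 != 0) ->
  exists d C, [/\ 0 < d <= 1, 0 <= C &
    forall t, `|t| <= d -> `|rslice beta n (x0 - t) - rslice beta n x0| <= C * Num.sqrt `|t|].
Proof.
case: n => [|m] hx.
  have x00 : 0 < `|x0| by rewrite normr_gt0 hx.
  exists (Num.min 1 (`|x0| / 2)), 0; split => //.
    by rewrite lt_min ltr01 divr_gt0//= ge_min lexx.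
  move=> t; rewrite le_min => /andP[_ tx]; rewrite !rslice0 mul0r.
  rewrite (_ : (0 <= x0 - t) = (0 <= x0)) ?subrr ?normr0//.
  move: tx; rewrite ler_norml => /andP[t1 t2].
  have [h|h] := leP 0 x0; first by move: t2 x00; rewrite (ger0_norm h) => ? ?; lra.
  by apply/negbTE; rewrite -ltNge; move: t1; rewrite (ltr0_norm h); lra.
have M0 : 0 <= `|x0| + 1 by rewrite addr_ge0.
have [C C0 HC] := rslice_holder beta m M0.
exists 1, C; split=> //; first by rewrite ltr01 lexx.
have x0M := ler_norm x0.
move=> t; rewrite ler_norml => /andP[t1 t2].
have [t0|t0] := leP 0 t.
  have le : x0 - t <= x0 by lra.
  rewrite distrC ger0_norm ?subr_ge0 ?rslice_le// (ger0_norm t0).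
  by have := HC _ _ le; rewrite subKr; apply; lra.
have le : x0 <= x0 - t by lra.
rewrite ger0_norm ?subr_ge0 ?rslice_le// (ltr0_norm t0).
by have := HC _ _ le; rewrite addrAC subrr add0r; apply; lra.
Qed.

Variables (kappa a x0 : R).
Hypothesis a0 : 0 < a.
Hypothesis kappa0 : 0 <= kappa.

(** Built so that its transform at frequency v gives the parts of kappa e ^ ((a + i v) x0) times the
    moment of [rslice_weight] at a + i v, while its value at 0 contains [rslice] at x0. *)
Definition inversion_fun (t : R) : R := kappa * (expR (a * t) * W2 (t - x0)).
Local Notation h := inversion_fun.

Lemma measurable_inversion_fun : measurable_fun [set: R] h.
Proof.
apply: measurable_funM => //; apply: measurable_funM; first exact: measurable_expRl.
by apply: (measurableT_comp (@measurable_rslice_weight R beta n)); exact: measurable_add.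
Qed.

Lemma integrable_inversion_fun : mu.-integrable setT (EFin \o h).
Proof.
apply/integrableP; split; first by apply/measurable_EFinP; exact: measurable_inversion_fun.
pose G (u : R) : \bar R := (kappa * (expR (a * x0) * (expR (a * u) * W2 u)))%:E.
have W20 := @rslice_weight_ge0 R beta n.
have eW0 u : 0 <= expR (a * u) * W2 (u - x0) by apply: mulr_ge0; [exact: expR_ge0|exact: W20].
have G0 u : (0 <= G u)%E.
  rewrite lee_fin; apply: mulr_ge0 => //; apply: mulr_ge0; first exact: expR_ge0.
  by apply: mulr_ge0; [exact: expR_ge0|exact: W20].
have iG : mu.-integrable setT G.
  have i := integrable_rslice_weight beta_gt0 n a0.
  have := integrableZl measurableT (kappa * expR (a * x0)) i; congr (mu.-integrable setT _).
  by apply/funext => u; rewrite /G -EFinM; congr (_%:E); ring.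
have mG : measurable_fun [set: R] G by case/integrableP : iG.
have -> : (\int[mu]_x `|(EFin \o h) x| = \int[mu]_x G (x - x0)%R)%E.
  apply: eq_integral => t _ /=; rewrite ger0_norm; last by apply: mulr_ge0 => //; exact: eW0.
  congr (_%:E); rewrite /inversion_fun; congr (_ * _).
  by rewrite mulrA -expRD; congr (expR _ * _); ring.
rewrite (ge0_integral_translate (- x0) mG G0).
have <- : (\int[mu]_x `|G x| = \int[mu]_x G x)%E.
  by apply: eq_integral => u _; rewrite gee0_abs.
by case/integrableP : iG.
Qed.

Lemma inversion_fun0 : h 0 = kappa * (expR (- (e * x0)) * rslice beta n x0).
Proof. by rewrite /inversion_fun /rslice_weight mulr0 expR0 mul1r sub0r mulrN opprK. Qed.

(** Up to constants the function is an exponential, which is Lipschitz near 0, times the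
    distribution, to which [rslice_local] applies; M bounds the exponential for |t| <= 1. *)
Lemma integrable_dini_inversion : (n = 0%N -> x0 != 0) ->
  mu.-integrable setT (EFin \o dini_quotient h).
Proof.
move=> hx; have [d [C [d01 C0 HC]]] := rslice_local hx.
have e0 := slice_exponent_ge0 beta n : 0 <= e.
pose b := a + e; have b0 : 0 <= b by rewrite addr_ge0// ltW.
pose M := expR (b - e * x0); have M0 : 0 <= M by exact: expR_ge0.
pose K := rslice beta n x0; have K0 : 0 <= K by exact: rslice_ge0.
apply: (@integrable_dini h d (kappa * (M * C + M * b * K)) d01).
- by rewrite mulr_ge0// addr_ge0// !mulr_ge0.
- exact: integrable_inversion_fun.
move=> t td; have td1 : `|t| <= 1 by case/andP : d01 => _ /(le_trans td).
have t1 : t <= 1 by exact: le_trans (ler_norm t) td1.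
have hE s : h s = kappa * (expR (b * s - e * x0) * rslice beta n (x0 - s)).
  rewrite /inversion_fun /rslice_weight opprB; congr (_ * _).
  by rewrite mulrA -expRD; congr (expR _ * _); rewrite /b; ring.
have bt : b * t - e * x0 <= b - e * x0 by rewrite lerD2r ler_piMr.
have b1 : b * 0 - e * x0 <= b - e * x0 by rewrite lerD2r mulr0.
have X := expR_dist_le bt b1; have Y := HC t td; have Z := normr_le_sqrt td1.
rewrite !hE subr0 -mulrBr normrM (ger0_norm kappa0) -[leRHS]mulrA ler_wpM2l//.
set E1 := expR (b * t - e * x0); set E0 := expR (b * 0 - e * x0).
have E1M : E1 <= M by rewrite ler_expR.
have -> : E1 * rslice beta n (x0 - t) - E0 * rslice beta n x0 =
    E1 * (rslice beta n (x0 - t) - K) + (E1 - E0) * K by rewrite /K; ring.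
apply: (le_trans (ler_normD _ _)); rewrite [leRHS]mulrDl; apply: lerD.
  by rewrite normrM (ger0_norm (expR_ge0 _)) -mulrA; apply: ler_pM => //; exact: expR_ge0.
rewrite normrM (ger0_norm K0) mulrAC ler_wpM2r//.
rewrite -[leRHS]mulrA; apply: (le_trans X); apply: ler_wpM2l => //.
have -> : b * t - e * x0 - (b * 0 - e * x0) = b * t by ring.
by rewrite normrM (ger0_norm b0) ler_wpM2l.
Qed.

Lemma cos_transform_inversion (v th : R) :
  cos_transform h v th = kappa * expR (a * x0) * mom mu id W2 a v (v * x0 + th).
Proof.
have mid : measurable_fun setT (id : TR -> TR) by exact: measurable_id.
have I := integrable_mom (mm := mu) mid (@measurable_rslice_weight R beta n) (@rslice_weight_ge0 R beta n)
  (fun b b0 => integrable_rslice_weight beta_gt0 n b0) v (v * x0 + th) a0.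
rewrite /mom -RintegralZl// /cos_transform /Rintegral; congr (fine _).
have mh : measurable_fun [set: R] (fun t => h t * cos (v * t + th)).
  by apply: measurable_funM; [exact: measurable_inversion_fun|exact: measurable_cos_lin].
rewrite -(integral_translate x0 mh); apply: eq_integral => u _; congr (_%:E).
rewrite /inversion_fun addrK mulrDr expRD.
have -> : v * (u + x0) + th = v * u + (v * x0 + th) by ring.
by rewrite /=; ring.
Qed.

End InverseLaplace.

(** * The integral over the vertical line *)

Section VerticalLine.
Context {R : realType}.
Notation mu := (@lebesgue_measure R).
Notation TR := (measurableTypeR R).
Variable beta : nat.
Hypothesis beta_gt0 : (0 < beta)%N.
Variable n : nat.
Local Notation N := (n.+1%:R : R).
Local Notation e := (slice_exponent beta n : R).
Local Notation C := (@selberg_constant R beta n.+1).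
Local Open Scope complex_scope.

Lemma selberg_constant_gt0 m : 0 < @selberg_constant R beta m.
Proof.
have g0 : 0 < beta%:R / 2 :> R by rewrite divr_gt0 ?ltr0n.
by apply: prodr_gt0 => j _; rewrite divr_gt0// rgam_gt0// ltr_pwDl// ?mulr_ge0// ltW.
Qed.

Lemma complexV (x : R) : (x^-1)%:C = (x%:C)^-1.
Proof. exact: fmorphV. Qed.

Lemma complex_nat (m : nat) : (m%:R : R)%:C = m%:R.
Proof. exact: rmorph_nat. Qed.

Lemma gamprodE (z : R[i]) :
  \prod_(1 <= j < n.+2) cGamma (z + (beta * (n.+1 - j))%:R / 2) = gamprod beta n.+1 z.
Proof.
rewrite big_add1/= big_mkord /gamprod (reindex_inj rev_ord_inj); apply: eq_bigr => i _.
rewrite (cGammaE beta); congr (selb _ _ (z + _)) => /=.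
rewrite !subSS subKn; last by rewrite -ltnS ltn_ord.
by rewrite natrM !rmorphM/= complexV !complex_nat; ring.
Qed.

Lemma selberg_constantE :
  \prod_(1 <= j < n.+2) (cGamma (1 + (beta * j)%:R / 2) / cGamma (1 + beta%:R / 2)) = C%:C.
Proof.
rewrite big_add1/= big_mkord.
transitivity (\prod_(j < n.+1) (selb beta 1 (1 + j.+1%:R * (beta%:R / 2) : R)%:C /
    selb beta 1 (1 + beta%:R / 2 : R)%:C)).
  apply: eq_bigr => i _; rewrite !(cGammaE beta).
  congr (selb _ _ _ / selb _ _ _); rewrite ?natrM !rmorphD !rmorph1 !rmorphM/= complexV !complex_nat//.
  by congr (_ + _); ring.
rewrite /selberg_constant rmorph_prod; apply: eq_bigr => i _.
by rewrite !selb_real -complexV; apply/esym; exact: rmorphM.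
Qed.

(** Equates the two expressions of the Selberg integral, by Gamma functions and by slicing, and
    divides by the Gamma factor, which has no zero in the half-plane. *)
Lemma gamma_quotient (z : R[i]) : 0 < complex.Re z ->
  gamprod beta n.+1 z / cGamma (z * N%:C + (e + 1)%:C) =
  (N / C)%:C * cmom mu id (@rslice_weight R beta n) (z * N%:C).
Proof.
move=> z0; have C0 := selberg_constant_gt0 n.+1.
have e0 := slice_exponent_ge0 beta n : 0 <= e.
have G0 : cGamma (z * N%:C + (e + 1)%:C) != 0.
  rewrite (cGammaE beta); apply: gam_neq0 => //; rewrite Re_addC.
  have : 0 < complex.Re (z * N%:C) by case: z z0 => x y /= x0; rewrite mulr0 subr0 mulr_gt0.
  by move=> ?; lra.
have C1 : C%:C != 0 by rewrite eq_complex/= eqxx andbT gt_eqF.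
have := selb_slice beta_gt0 n z0; rewrite cmom_gamma_weight (selbE_gamprod beta_gt0 n.+1 z0) => H.
apply: (mulIf G0); rewrite divfK//; apply: (mulfI C1); rewrite H rmorphM/= complexV.
have fld (x y u v : R[i]) : x != 0 -> y * u * v = x * (y / x * v * u) by move=> x0; field.
exact: fld.
Qed.

Variables (r c : R).
Hypotheses (r0 : 0 < r) (c0 : 0 < c).

(** With z = s / 2 the moments are taken at z N, so the line Re s = c becomes Re = c N / 2; r ^ (s
    N) is e ^ (x0 s N / 2) for x0 = 2 ln r; the factor N / C comes from [gamma_quotient]. *)
Definition vline_fun : R -> R := inversion_fun beta n (N / C) (c * N / 2) (2 * ln r).

Lemma vline_integrand (y : R) :
  (\prod_(1 <= j < n.+2) cGamma ((c +i* y) / 2 + (beta * (n.+1 - j))%:R / 2))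
    / cGamma ((c +i* y) * n.+1%:R / 2 + (beta * n.+1 * (n.+1 - 1))%:R / 2 + 1)
    * cpow r ((c +i* y) * n.+1%:R) =
  cos_transform vline_fun (N / 2 * y) 0 +i* cos_transform vline_fun (N / 2 * y) (- pi / 2).
Proof.
set s := c +i* y; have C0 := selberg_constant_gt0 n.+1.
have N0 : 0 < N by rewrite ltr0n.
have half : s / 2 = (c / 2) +i* (y / 2).
  have -> : 2 = (2 : R)%:C :> R[i] by rewrite complex_nat.
  by rewrite -complexV; apply/eqP; rewrite eq_complex/= !mulr0 subr0 add0r !eqxx.
have z0 : 0 < complex.Re (s / 2) by rewrite half /= divr_gt0.
rewrite gamprodE.
have -> : s * n.+1%:R / 2 + (beta * n.+1 * (n.+1 - 1))%:R / 2 + 1 = s / 2 * N%:C + (e + 1)%:C.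
  rewrite subn1/= !natrM /slice_exponent rmorphD rmorph1 !rmorphM/= complexV !complex_nat.
  by rewrite addrA; congr (_ + _ + _); ring.
rewrite gamma_quotient//.
have a0 : 0 < c * N / 2 by rewrite !mulr_gt0// invr_gt0.
have zE : s / 2 * N%:C = (c * N / 2) +i* (y * N / 2).
  by rewrite half; apply/eqP; rewrite eq_complex/= !mulr0 subr0 add0r; apply/andP; split; apply/eqP; ring.
have pE : cpow r (s * n.+1%:R) = (expR (c * N / 2 * (2 * ln r)))%:C *
    (cos (y * N / 2 * (2 * ln r)) +i* sin (y * N / 2 * (2 * ln r))).
  rewrite -complex_nat /cpow /= !mulr0 subr0 add0r.
  have -> : c * N * ln r = c * N / 2 * (2 * ln r) by field.
  by have -> : y * N * ln r = y * N / 2 * (2 * ln r) by field.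
have mid : measurable_fun setT (id : TR -> TR) by exact: measurable_id.
have rot := cmom_rot (mm := mu) mid (@measurable_rslice_weight R beta n) (@rslice_weight_ge0 R beta n)
  (fun b b0 => integrable_rslice_weight beta_gt0 n b0) (y * N / 2) (y * N / 2 * (2 * ln r)) a0.
rewrite zE pE -mulrA [X in _ * X]mulrCA rot !cos_transform_inversion//.
have -> : N / 2 * y = y * N / 2 by ring.
rewrite addr0 [y * N / 2 * (2 * ln r) + - pi / 2](_ : _ = y * N / 2 * (2 * ln r) - pi / 2); last by rewrite mulNr.
by apply/eqP; rewrite eq_complex/=; apply/andP; split; apply/eqP; ring.
Qed.

Lemma cvg_complex (T : Type) (F : set_system T) {FF : Filter F} (u v : T -> R) (x y : R) :
  u t @[t --> F] --> x -> v t @[t --> F] --> y ->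
  (fun t => ('i%C * (u t +i* v t) : R[i]^o)) @ F --> ('i%C * (x +i* y) : R[i]^o).
Proof.
move=> ux vy; apply/cvgrPdist_lt => eps eps0.
(* A positive element of R[i] is real. *)
have epsE : eps = (complex.Re eps)%:C.
  by move: eps0; rewrite ltcE/= => /andP[/eqP h _]; case: eps h => a b /= ->.
have e0 : 0 < complex.Re eps / 2.
  by move: eps0; rewrite ltcE/= => /andP[_ h]; rewrite divr_gt0.
move/cvgrPdist_lt : vy => /(_ _ e0); move/cvgrPdist_lt : ux => /(_ _ e0).
apply: filterS2 => t hu hv; rewrite epsE -mulrBr normrM.
have -> : `|'i%C| = 1 :> R[i] by rewrite normc_def/= expr0n/= add0r expr1n sqrtr1.
rewrite mul1r normc_def/= ltcR.
have := normc_le (x - u t) (y - v t); rewrite /normc/= => h.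
by apply: (le_lt_trans h); rewrite [ltRHS](splitr _); exact: ltrD.
Qed.

(** Fourier inversion at frequency scale l = N / 2 gives 2 pi h(0) / l; the phase - pi / 2
    contributes cos (- pi / 2) = 0, so the integral in y is real. *)
Lemma vline_integral : ~ (n.+1 = 1%N /\ r = 1) ->
  is_vline_integral c
    (fun s : R[i] =>
       (\prod_(1 <= j < n.+2) cGamma (s / 2 + (beta * (n.+1 - j))%:R / 2))
       / cGamma (s * n.+1%:R / 2 + (beta * n.+1 * (n.+1 - 1))%:R / 2 + 1)
       * cpow r (s * n.+1%:R))
    ('i%C * (4 * pi * vline_fun 0 / N)%:C).
Proof.
move=> hNr; have C0 := selberg_constant_gt0 n.+1.
have N0 : 0 < N by rewrite ltr0n.
have a0 : 0 < c * N / 2 by rewrite !mulr_gt0// invr_gt0.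
have k0 : 0 <= N / C by rewrite divr_ge0// ltW.
have l0 : 0 < N / 2 by rewrite divr_gt0.
have ih : mu.-integrable setT (EFin \o vline_fun) by exact: integrable_inversion_fun.
have ik : mu.-integrable setT (EFin \o dini_quotient vline_fun).
  apply: integrable_dini_inversion => // n0; apply/eqP => lr.
  apply: hNr; split; first by rewrite n0.
  have : ln r = 0 by lra.
  by move/eqP; rewrite ln_eq0// => /eqP.
have I th := fourier_inversion ih l0 ik th.
rewrite /is_vline_integral.
have -> : (4 * pi * vline_fun 0 / N)%:C =
    (2 * pi * vline_fun 0 * cos 0 / (N / 2)) +i* (2 * pi * vline_fun 0 * cos (- pi / 2) / (N / 2)).
  rewrite mulNr cosN cos_pihalf cos0 mulr0 mul0r; congr (_ +i* _).
  by field; rewrite lt0r_neq0.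
have FP : Filter (filter_prod (pinfty_nbhs R) (pinfty_nbhs R)) by exact: filter_prod_filter.
have := @cvg_complex _ _ FP _ _ _ _ (I 0) (I (- pi / 2)).
apply: cvg_trans; apply: near_eq_cvg; apply: nearW => -[A B] /=.
rewrite /cintegral; congr ('i%C * (_ +i* _)).
  by apply: eq_Rintegral => y _; rewrite vline_integrand.
by apply: eq_Rintegral => y _; rewrite vline_integrand.
Qed.

End VerticalLine.

Local Open Scope complex_scope.

Theorem proposition5 (R : realType) (beta N : nat) (r c : R)
    (hbeta : beta \in [:: 1; 2; 4]%N) (hN : (0 < N)%N) (hr : 0 < r)
    (hNr : ~ (N = 1%N /\ r = 1)) (hc : 0 < c) :
  exists (I : R) (L : R[i]),
    [/\ Ihat beta N r = I%:E,
        is_vline_integral c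
          (fun s : R[i] =>
             (\prod_(1 <= j < N.+1) cGamma (s / 2 + (beta * (N - j))%:R / 2))
             / cGamma (s * N%:R / 2 + (beta * N * (N - 1))%:R / 2 + 1)
             * cpow r (s * N%:R)) L
      & I%:C =
          (r ^+ (beta * N * (N - 1)) / (2 ^+ N * N`!%:R))%:C
          * (\prod_(1 <= j < N.+1)
               (cGamma (1 + (beta * j)%:R / 2) / cGamma (1 + beta%:R / 2)))
          * ((2 * pi)%:C * 'i%C)^-1 * L].
Proof.
have beta_gt0 : (0 < beta)%N by move: hbeta; rewrite !inE => /or3P[]/eqP->.
case: N hN hNr => [//|n] _ hNr.
(* Here N = n + 1, and n counts the free variables of the delta integral. *)
exists (n.+1`!%:R^-1 * (2^-1 ^+ n * rslice beta n (2 * ln r))).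
exists ('i%C * (4 * pi * vline_fun beta n r c 0 / n.+1%:R)%:C); split.
- exact: IhatE.
- exact: vline_integral.
have -> : vline_fun beta n r c 0 = n.+1%:R / selberg_constant beta n.+1 *
    (expR (- (slice_exponent beta n * (2 * ln r))) * rslice beta n (2 * ln r)).
  exact: inversion_fun0.
rewrite selberg_constantE.
set C := selberg_constant beta n.+1; set K := rslice beta n _.
have C0 : 0 < C by exact: selberg_constant_gt0.
(* The power of r in front cancels the factor e ^ (- e x0), x0 = 2 ln r, in the value of [vline_fun]
   at 0, where e is [slice_exponent]. *)
have rE : r ^+ (beta * n.+1 * (n.+1 - 1)) = expR (slice_exponent beta n * (2 * ln r)).
  rewrite subn1/= -[in LHS](lnK hr) -expRM_natl /slice_exponent !natrM; congr expR.
  by field.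
rewrite rE expRN; set E := expR _; have E0 : 0 < E by exact: expR_gt0.
have i0 : 'i%C != 0 :> R[i] by rewrite eq_complex/= oner_eq0 andbF.
have p0 : (2 * pi)%:C != 0 :> R[i].
  by rewrite eq_complex/= eqxx andbT gt_eqF// mulr_gt0// pi_gt0.
have fld (x y p i z : R[i]) : p != 0 -> i != 0 -> x * y * (p * i)^-1 * (i * z) = x * y * p^-1 * z.
  by move=> p1 i1; field; rewrite p1.
rewrite fld// -complexV -!rmorphM/=.
congr (_%:C); rewrite exprS exprVn.
move: (pi_gt0 R) {p0}; move: (pi : R) => p p_gt0; field.
by rewrite nat1r pnatr_eq0/= !gt_eqF ?exprn_gt0 ?ltr0n ?fact_gt0.
Qed.
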